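(* For every positive integer $n$, and all $x,y,z_1,z_2$, $$Z^{\mathrm{ASM}}_n(x,y,z_1,z_2)=Z^{\mathrm{DPP}}_n(x,y,z_1,z_2).$$ Equivalently, for all integers $n\ge1$ and $p,m,k_1,k_2$, the sets $\{A\in\mathrm{ASM}(n)\mid \nu(A)=p,\ \mu(A)=m,\ \rho_1(A)=k_1,\ \rho_2(A)=k_2\}$ and $\{D\in\mathrm{DPP}(n)\mid \nu(D)=p,\ \mu(D)=m,\ \rho_1(D)=k_1,\ \rho_2(D)=k_2\}$ have the same size.
   Context: An alternating sign matrix (ASM) is a square matrix with entries in $\{0,1,-1\}$ such that in each row and each column the nonzero entries alternate in sign and sum to $1$. $\mathrm{ASM}(n)$ is the set of $n\times n$ ASMs. For $A\in\mathrm{ASM}(n)$: $\nu(A)=\sum_{1\le i<i'\le n,\ 1\le j'\le j\le n}A_{ij}A_{i'j'}$; $\mu(A)$ is the number of $-1$ entries of $A$; $\rho_1(A)$ is the number of $0$'s to the left of the $1$ in the first row of $A$; $\rho_2(A)$ is the number of $0$'s to the right of the $1$ in the last row of $A$. A descending plane partition (DPP) is an array of positive integers (parts) $D_{ij}$, with $t\ge0$ rows, where row $i$ consists of $D_{ii},D_{i,i+1},\dots,D_{i,\lambda_i+i-1}$ (so row $i$ has length $\lambda_i$ and is indented by $i-1$ positions), such that parts weakly decrease along rows, strictly decrease down columns (i.e. $D_{ij}>D_{i+1,j}$ whenever both are defined), and $D_{11}>\lambda_1\ge D_{22}>\lambda_2\ge\cdots\ge D_{tt}>\lambda_t$. The empty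 array is a DPP. $\mathrm{DPP}(n)$ is the set of DPPs all of whose parts are at most $n$. For $D\in\mathrm{DPP}(n)$: $\nu(D)$ is the number of parts with $D_{ij}>j-i$; $\mu(D)$ is the number of parts with $D_{ij}\le j-i$; $\rho_1(D)$ is the number of parts equal to $n$; $\rho_2(D)$ is the number of parts equal to $n-1$ plus the number of rows of $D$ of length $n-1$. $Z^{\mathrm{ASM}}_n(x,y,z_1,z_2)=\sum_{A\in\mathrm{ASM}(n)}x^{\nu(A)}y^{\mu(A)}z_1^{\rho_1(A)}z_2^{\rho_2(A)}$ and $Z^{\mathrm{DPP}}_n(x,y,z_1,z_2)=\sum_{D\in\mathrm{DPP}(n)}x^{\nu(D)}y^{\mu(D)}z_1^{\rho_1(D)}z_2^{\rho_2(D)}$. *)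

(* Defs.v *)
From HB Require Import structures.
From mathcomp Require Import all_boot all_order all_algebra.
From mathcomp Require Import finmap.

Set Implicit Arguments.
Unset Strict Implicit.
Unset Printing Implicit Defensive.

Import Order.TTheory GRing.Theory Num.Theory.
Local Open Scope ring_scope.

Definition sign_values : seq int := [:: 0; 1; -1].

(* [sorted] compares consecutive items of the list of nonzero entries. *)
Definition asm_line (s : seq int) : bool :=
  [&& all [in sign_values] s,
      sorted (fun a b => a * b < 0) [seq a <- s | a != 0]
    & \sum_(a <- s) a == 1].

Definition is_asm n (A : 'M[int]_n) : bool :=
  [forall i, asm_line [seq A i j | j <- enum 'I_n]] &&
  [forall j, asm_line [seq A i j | i <- enum 'I_n]].

(* The finitely many matrices with entries in [sign_values] provide the
   finiteness; membership is characterised by [in_ASM]. *)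
Definition ASM n : {fset 'M[int]_n} :=
  [fset A in [seq map_mx val B | B : 'M[seq_sub sign_values]_n] | is_asm A]%fset.

Definition asm_nu n (A : 'M[int]_n) : int :=
  \sum_(i < n) \sum_(i' < n | (i < i')%N)
    \sum_(j' < n) \sum_(j < n | (j' <= j)%N) A i j * A i' j'.

Definition asm_mu n (A : 'M[int]_n) : nat :=
  #|[set p : 'I_n * 'I_n | A p.1 p.2 == -1]|.

Definition asm_rho1 n (A : 'M[int]_n) : nat :=
  #|[set p : 'I_n * 'I_n |
     [&& p.1 == 0%N :> nat, A p.1 p.2 == 0
       & [exists k : 'I_n, (p.2 < k)%N && (A p.1 k == 1)]]]|.

Definition asm_rho2 n (A : 'M[int]_n) : nat :=
  #|[set p : 'I_n * 'I_n |
     [&& p.1.+1 == n, A p.1 p.2 == 0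
       & [exists k : 'I_n, (k < p.2)%N && (A p.1 k == 1)]]]|.

(* [asm_nu] is an integer, nonnegative on ASMs by [asm_nu_ge0], so taking its
   absolute value turns it into a natural exponent without changing it. *)
Definition ZASM (R : comNzRingType) (n : nat) (x y z1 z2 : R) : R :=
  \sum_(A <- ASM n)
    x ^+ `|asm_nu A|%N * y ^+ asm_mu A * z1 ^+ asm_rho1 A * z2 ^+ asm_rho2 A.

(* An array is the list of its rows, stored left-justified: with indices
   starting from 0, row [i] occupies the columns [i, ..., i + lambda_i - 1],
   so that the entry in column [j] sits at position [j - i] of the list.  Since
   the statistics only involve [j - i], starting from 0 changes nothing. *)
Section Arrays.
Local Open Scope nat_scope.
Implicit Type D : seq (seq nat).

Definition row_length D (i : nat) : nat := size (nth [::] D i).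

Definition part D (i j : nat) : nat := nth 0 (nth [::] D i) (j - i).

Definition cells D : seq (nat * nat) :=
  [seq (i, j) | i <- iota 0 (size D), j <- iota i (row_length D i)].

Definition is_dpp D : bool :=
  [&& all (fun i => 0 < row_length D i) (iota 0 (size D)),
      all (fun c => 0 < part D c.1 c.2) (cells D),
      all (fun c => ((c.1, c.2.+1) \in cells D) ==>
                    (part D c.1 c.2.+1 <= part D c.1 c.2)) (cells D),
      all (fun c => ((c.1.+1, c.2) \in cells D) ==>
                    (part D c.1.+1 c.2 < part D c.1 c.2)) (cells D),
      all (fun i => row_length D i < part D i i) (iota 0 (size D))
    & all (fun i => (i.+1 < size D) ==>
                    (part D i.+1 i.+1 <= row_length D i)) (iota 0 (size D))].

Definition parts_le (n : nat) D : bool :=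
  all (fun c => part D c.1 c.2 <= n) (cells D).

(* A DPP with parts at most n has at most n rows, each of length at most n,
   whence the finite type of arrays; membership is characterised by
   [in_DPP]. *)
Definition DPP (n : nat) : {fset seq (seq nat)} :=
  [fset D in [seq [seq map val (r : n.-bseq 'I_n.+1) | r <- bseqval B]
             | B : n.-bseq (n.-bseq 'I_n.+1)] | is_dpp D && parts_le n D]%fset.

Definition dpp_nu D : nat :=
  count (fun c => c.2 - c.1 < part D c.1 c.2) (cells D).

Definition dpp_mu D : nat :=
  count (fun c => part D c.1 c.2 <= c.2 - c.1) (cells D).

Definition dpp_rho1 (n : nat) D : nat :=
  count (fun c => part D c.1 c.2 == n) (cells D).

Definition dpp_rho2 (n : nat) D : nat :=
  count (fun c => part D c.1 c.2 == n - 1) (cells D) +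
  count (fun i => row_length D i == n - 1) (iota 0 (size D)).

End Arrays.

Definition ZDPP (R : comNzRingType) (n : nat) (x y z1 z2 : R) : R :=
  \sum_(D <- DPP n)
    x ^+ dpp_nu D * y ^+ dpp_mu D * z1 ^+ dpp_rho1 n D * z2 ^+ dpp_rho2 n D.

Lemma in_ASM n (A : 'M[int]_n) : (A \in ASM n) = is_asm A.
Proof.
rewrite !inE /=; apply/andP/idP => [[]//|AA]; split=> //.
have Aval i j : A i j \in sign_values.
  case/andP: AA => /forallP/(_ i) /and3P[/allP h _ _] _.
  by apply: h; apply: map_f; rewrite mem_enum.
apply/mapP; exists (\matrix_(i, j) SeqSub (Aval i j)); first by rewrite mem_enum.
by apply/matrixP => i j; rewrite !mxE.
Qed.

Lemma mem_cells D i j :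
  ((i, j) \in cells D) =
  ((i < size D) && (i <= j) && (j < i + row_length D i))%N.
Proof.
apply/allpairsPdep/idP => [[i' [j' []]]|/andP[/andP[h1 h2] h3]].
  by rewrite !mem_iota add0n => /andP[_ h1] /andP[h2 h3] [-> ->]; rewrite h1 h2.
by exists i, j; rewrite !mem_iota add0n h1 h2.
Qed.

Lemma in_DPP n D : (D \in DPP n) = is_dpp D && parts_le n D.
Proof.
rewrite !inE /=; apply/andP/idP => [[]//|DD]; split=> //.
have /andP[/and5P[/allP len /allP pos _ _ /andP[/allP diag /allP desc]] /allP le_n] := DD.
have celld i : (i < size D)%N -> (i, i) \in cells D.
  move=> li; rewrite mem_cells li leqnn /= -addn1 leq_add2l.
  by apply: len; rewrite mem_iota.
have lrow i : (i < size D)%N -> (row_length D i < n)%N.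
  move=> li; apply: leq_trans (le_n _ (celld i li)).
  by apply: diag; rewrite mem_iota.
have szD : (size D <= n)%N.
  have dec i : (i < size D)%N -> (part D i i + i <= n)%N.
    elim: i => [|i IH] li; first by rewrite addn0; exact: (le_n _ (celld _ li)).
    have li' := ltnW li.
    apply: leq_trans (IH li'); rewrite addnS -addSn leq_add2r.
    apply: leq_ltn_trans (diag i _); last by rewrite mem_iota.
    by have := desc i; rewrite mem_iota add0n li' => /(_ isT)/implyP; apply.
  case E: (size D) => [//|m]; have lm : (m < size D)%N by rewrite E.
  by apply: leq_trans (dec _ lm); rewrite -add1n leq_add2r; exact: (pos _ (celld _ lm)).
have rowP r : r \in D -> (size r <= n)%N && all (fun a => a < n.+1)%N r.
  move=> /(nthP [::])[i li <-]; rewrite (ltnW (lrow i li)) /=.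
  apply/(all_nthP 0%N) => k lk; rewrite ltnS.
  have := le_n (i, (i + k)%N); rewrite mem_cells li leq_addr ltn_add2l /=.
  by rewrite /part addKn; apply.
have rowE r : r \in D -> exists b : n.-bseq 'I_n.+1, map val b = r.
  move=> /rowP/andP[sr /allP ar].
  have sb : (size [seq inord a : 'I_n.+1 | a <- r] <= n)%N by rewrite size_map.
  exists (Bseq sb) => /=; rewrite -map_comp -[RHS]map_id.
  by apply/eq_in_map => a /ar la /=; rewrite inordK.
have [s sE] : exists s : seq (n.-bseq 'I_n.+1), [seq map val (bseqval b) | b <- s] = D.
  elim: (D) rowE => [|r D' IH] h; first by exists [::].
  have [b <-] := h r (mem_head _ _).
  have [s <-] := IH (fun r' hr => h r' (mem_behead (s := r :: D') hr)).
  by exists (b :: s).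
have ss : (size s <= n)%N by rewrite -sE size_map in szD.
by apply/mapP; exists (Bseq ss); rewrite ?mem_enum //=.
Qed.

Lemma asm_prefix (s : seq int) (k : nat) :
  asm_line s -> 0 <= \sum_(a <- take k s) a <= 1.
Proof.
case/and3P=> ins alt sum1.
suff H (t : seq int) (e : int) : all [in sign_values] t ->
    (e == 1) || (e == -1) -> path (fun a b => a * b < 0) e [seq a <- t | a != 0] ->
    forall m, (\sum_(a <- take m t) a == 0) || (\sum_(a <- take m t) a == - e).
  have pre t (e : int) : (forall m, (\sum_(a <- take m t) a == 0) ||
      (\sum_(a <- take m t) a == - e)) -> \sum_(a <- t) a == 1 -> 
      (e == 1) || (e == -1) -> e = -1.
    move=> h /eqP s1; have := h (size t); rewrite take_size s1 /=.
    by move=> /eqP E _; rewrite E opprK.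
  case E: [seq a <- s | a != 0] alt => [|b t] alt.
    have: \sum_(a <- s) a = 0.
      apply: big1_seq => a /andP[_ ain]; apply/eqP; apply/negPn/negP => a0.
      have: a \in [seq c <- s | c != 0] by rewrite mem_filter a0 ain.
      by rewrite E.
    by move/eqP: sum1 => ->.
  have bin : (b == 1) || (b == -1).
    have: b \in [seq a <- s | a != 0] by rewrite E mem_head.
    rewrite mem_filter => /andP[b0 /(allP ins)].
    by rewrite inE (negPf b0) !inE.
  have h := H s (- b) ins; rewrite E /= in h.
  have bh : (- b == 1) || (- b == -1) by case/orP: bin => /eqP ->.
  have p2 : (- b * b < 0) && path (fun a c => a * c < 0) b t.
    by rewrite /= in alt; rewrite alt andbT; case/orP: bin => /eqP ->.
  have {}h := h bh p2.
  have bE := pre s (- b) h sum1 bh; have := h k; rewrite bE.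
  by case/orP => /eqP ->.
elim: t e => [|a t IH] e /= ht he hp m; first by rewrite big_nil eqxx.
case: m => [|m]; first by rewrite take0 big_nil eqxx.
rewrite /= big_cons; case/andP: ht => ha ht.
case: (eqVneq a 0) hp => [-> /=|a0 /=] hp; first by rewrite add0r; exact: IH.
case/andP: hp => ae hp.
have aE : a = - e.
  move: ha ae; rewrite inE (negPf a0) !inE /=.
  by case/orP: he => /eqP ->; case/orP => /eqP ->.
have ha' : (a == 1) || (a == -1) by move: ha; rewrite inE (negPf a0) !inE.
have := IH a ht ha' hp m.
by case/orP => /eqP ->; rewrite ?addr0 ?subrr ?eqxx ?orbT // aE eqxx orbT.
Qed.

Lemma sum_take_ord n (f : 'I_n -> int) (k : nat) :
  \sum_(a <- take k [seq f i | i <- enum 'I_n]) a = \sum_(i < n | (i < k)%N) f i.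
Proof.
rewrite -map_take big_map /=.
have -> : take k (enum 'I_n) = [seq i : 'I_n <- enum 'I_n | (i < k)%N];
  last by rewrite big_filter big_enum_cond.
apply: (inj_map val_inj).
rewrite map_take val_enum_ord -(filter_map val (fun i => i < k)%N) val_enum_ord.
rewrite take_iota; have [kn|nk] := leqP k n.
  by rewrite -[n in RHS](subnKC kn) iotaD filter_cat add0n
             (@eq_in_filter _ _ predT) ?filter_predT
             ?(@eq_in_filter _ _ pred0 (iota k _)) ?filter_pred0 ?cats0 // => i;
     rewrite mem_iota ?add0n => /andP[] //= h _; rewrite ltnNge h.
by rewrite (@eq_in_filter _ _ predT) ?filter_predT // => i;
   rewrite mem_iota add0n => /andP[_ h]; apply: ltn_trans nk.
Qed.

Lemma asm_nu_ge0 n (A : 'M[int]_n) : is_asm A -> 0 <= asm_nu A.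
Proof.
case/andP=> /forallP rows /forallP cols.
have -> : asm_nu A = \sum_(i' < n) \sum_(j < n)
    (\sum_(i < n | (i < i')%N) A i j) * (\sum_(j' < n | (j' < j.+1)%N) A i' j').
  rewrite /asm_nu (exchange_big_dep predT) //=; apply: eq_bigr => i' _.
  under [RHS]eq_bigr => j _ do rewrite mulr_suml.
  rewrite [RHS]exchange_big /=; apply: eq_bigr => i _.
  under [RHS]eq_bigr => j _ do rewrite mulr_sumr.
  by rewrite [RHS](exchange_big_dep predT) //=.
apply: sumr_ge0 => i' _; apply: sumr_ge0 => j _; apply: mulr_ge0.
  by have /andP[] := asm_prefix i' (cols j); rewrite (sum_take_ord (A^~ j)).
by have /andP[] := asm_prefix j.+1 (rows i'); rewrite (sum_take_ord (A i')).
Qed.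

(* Main.v *)
(* Both generating functions equal one and the same determinant.

   ASMs are the states of a six-vertex model with domain-wall boundary, whose
   edges carry the partial row and column sums.  With spectral parameters u on
   the columns and v on the rows, its partition function satisfies the
   Izergin-Korepin determinant formula.  At u = 0 and
   v = (v1, 0, ..., 0, v2), with z_i = 1 / (1 - v_i), the partition function
   is Z^ASM up to a power of (1 - v1)(1 - v2), and the homogeneous limit of the
   formula turns it into the determinant whose rows hold the coefficients of n
   explicit polynomials modulo X^n.

   A DPP is cut into slices: the p-th parts of all its rows.  The parts of a
   slice weakly decrease and interlace with those of the next slice, so summing
   slice by slice, as for non-intersecting paths, gives Z^DPP as a determinant
   of vectors defined by a recurrence.  That recurrence is solved by generating
   functions, and one unitriangular Toeplitz matrix maps these vectors to the
   rows of the determinant above.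

   Division by quantities such as z1 - z2 makes this argument valid only
   generically.  Taking powers X, X^B, X^(B^2), X^(B^3) of one variable for x,
   y, z1, z2 satisfies the genericity conditions and separates the statistics,
   so the two sides have the same multiset of statistics, whence the identity
   over every commutative ring. *)

From HB Require Import structures.
Require Import Defs.
From mathcomp Require Import all_boot all_order all_algebra.
From mathcomp Require Import finmap.
From mathcomp Require Import ring zify.

Set Implicit Arguments.
Unset Strict Implicit.
Unset Printing Implicit Defensive.

Import Order.TTheory GRing.Theory Num.Theory.
Local Open Scope ring_scope.

(** * The six-vertex partition function *)

(** The vertex weights parametrise rationally the curve x A^2 + B^2 - C = (1 + x - y) A B, where A =
    [wA u v], B = [wB u v], and C = [gu u * qv v] is the product of the weights of an entry 1 and an
    entry -1. A constant ratio of this kind is what makes a Yang-Baxter relation possible, and u = v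
    = 0 gives A = B = 1 and C = y. The parameters v1 and v2 can stay free because the first and last
    rows of an ASM contain no -1: there v enters only through factors 1 - v at zero entries. The
    obstacle is that the determinant formula degenerates when parameters coincide. For u this is
    avoided by taking matrix columns that are symmetric in the u's, so that u = 0 is a plain
    evaluation. For v, one row parameter at a time is an indeterminate, a power of which is
    cancelled before it is set to 0. On the DPP side no sign-reversing involution is used: the lower
    limit of a part is the upper bound of the next row, and the forbidden terms vanish because they
    give a determinant with two equal rows. *)

Fixpoint bits (n : nat) : seq bitseq :=
  if n is n'.+1 then [seq b :: s | b <- [:: false; true], s <- bits n']
  else [:: [::]].

Lemma bitsP n s : (s \in bits n) = (size s == n).
Proof.
elim: n s => [|n IH] [|b s] //=.
  by apply/negbTE; rewrite !mem_cat !negb_or /=; apply/and3P; split=> //;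
    apply/negP => /mapP[].
rewrite !mem_cat orbF (_ : (_.+1 == _) = (s \in bits n)); last by rewrite IH.
apply/orP/idP => [[]/mapP[s' hs [_ ->]] //|hs].
by case: b; [right|left]; apply: map_f.
Qed.

Lemma big_bitsS (R : nmodType) n (F : bitseq -> R) :
  \sum_(s <- bits n.+1) F s =
  \sum_(s <- bits n) F (false :: s) + \sum_(s <- bits n) F (true :: s).
Proof. by rewrite big_allpairs_dep !big_cons big_nil /= addr0. Qed.

Section Vertex.
Variables (R : comNzRingType) (x y : R).
Implicit Types (u v w : R) (us vs : seq R) (t h k : bool).

(** At u = 0 the weights [wA], [wB], [gu] become 1, 1 - v, 1, and [qv] at v = 0 is y. A row with v =
    0 thus contributes only powers of x and y. *)
Definition wA u v := 1 - u * v.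
Definition wB u v := 1 - v - u * (y + (x - y) * v).
Definition qv v := v ^+ 2 - (1 + y - x) * v + y.
Definition gu u := 1 - (1 + y - x) * u + y * u ^+ 2.

(* Vertex with top edge [t], left edge [h], right edge [k] and bottom edge
   [t + k - h]: the first two are the sums of the entries above and to the left,
   so the entry is [k - h], and (false, false, true) is a 1 and
   (true, true, false) a -1.  On the vertices of nonzero weight the bottom edge
   is [t (+) h (+) k]. *)
Definition wt u v t h k : R :=
  match t, h, k with
  | false, false, false => wA u v
  | true, true, true => x * wA u v
  | true, false, false | false, true, true => wB u v
  | false, false, true => 1
  | true, true, false => gu u * qv v
  | _, _, _ => 0
  end.

Fixpoint colw u vs t (hs ks : bitseq) : R :=
  match vs, hs, ks with
  | [::], [::], [::] => (t : nat)%:R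
  | v :: vs', h :: hs', k :: ks' =>
      wt u v t h k * colw u vs' (t (+) h (+) k) hs' ks'
  | _, _, _ => 0
  end.

Fixpoint Zv vs us (hs : bitseq) : R :=
  if us is u :: us' then
    \sum_(ks <- bits (size vs)) colw u vs false hs ks * Zv vs us' ks
  else (all id hs)%:R.

Definition Z6v vs us := Zv vs us (nseq (size vs) false).

Definition col2 u w vs t1 t2 (hs ls : bitseq) : R :=
  \sum_(ks <- bits (size vs)) colw u vs t1 hs ks * colw w vs t2 ks ls.

Lemma col2_cons u w v vs t1 t2 h hs l ls :
  col2 u w (v :: vs) t1 t2 (h :: hs) (l :: ls) =
  \sum_(k <- [:: false; true])
    wt u v t1 h k * wt w v t2 k l *
    col2 u w vs (t1 (+) h (+) k) (t2 (+) k (+) l) hs ls.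
Proof.
rewrite /col2 big_bitsS !big_cons big_nil addr0 !mulr_sumr.
by congr (_ + _); apply: eq_bigr => ks _ /=; rewrite mulrACA.
Qed.

Definition Rdiag u w := 1 + (x - y) * u - w + y * u * w.

(* Yang-Baxter relation between two adjacent columns.  Only the case where both
   top edges are false is needed; the others carry the induction on the rows. *)
Lemma col2_exchange u w vs hs ls : size hs = size vs -> size ls = size vs ->
  [/\ Rdiag u w * col2 u w vs false false hs ls =
        Rdiag u w * col2 w u vs false false hs ls,
      gu u * col2 u w vs false true hs ls +
        x * (u - w) * col2 u w vs true false hs ls =
        Rdiag u w * col2 w u vs false true hs ls,
      (u - w) * col2 u w vs false true hs ls +
        gu w * col2 u w vs true false hs ls =
        Rdiag u w * col2 w u vs true false hs ls &
      Rdiag u w * col2 u w vs true true hs ls =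
        Rdiag u w * col2 w u vs true true hs ls].
Proof.
elim: vs hs ls => [|v vs IH] [|h hs] [|l ls] //=.
  by rewrite /col2 /= !big_cons !big_nil /= !(mulr0, mul0r, addr0).
move=> [hsz] [lsz]; have [e1 e2 e3 e4] := IH _ _ hsz lsz.
rewrite !col2_cons !big_cons !big_nil /= !addr0.
(* After exchange, the column sums occur only multiplied by [Rdiag u w], so the induction hypotheses
   eliminate them and a polynomial identity in the weights remains for each pair of outer edges. *)
case: h l {IH hsz lsz} => [] []; rewrite /= ?(mulr0, mul0r, addr0, add0r);
  move: (col2 u w vs false false hs ls) (col2 w u vs false false hs ls)
    (col2 u w vs false true hs ls) (col2 w u vs false true hs ls)
    (col2 u w vs true false hs ls) (col2 w u vs true false hs ls)
    (col2 u w vs true true hs ls) (col2 w u vs true true hs ls) e1 e2 e3 e4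
    => c1 d1 c2 d2 c3 d3 c4 d4 e1 e2 e3 e4; split;
  rewrite ?[Rdiag u w * (_ + _)]mulrDr;
  rewrite ?[Rdiag u w * (_ * d1)]mulrCA ?[Rdiag u w * (_ * d2)]mulrCA
    ?[Rdiag u w * (_ * d3)]mulrCA ?[Rdiag u w * (_ * d4)]mulrCA -?e1 -?e2 -?e3 -?e4;
  rewrite /wA /wB /gu /qv /Rdiag; ring.
Qed.

Lemma Zv_cons2 u w us vs hs :
  Zv vs (u :: w :: us) hs =
  \sum_(ls <- bits (size vs)) col2 u w vs false false hs ls * Zv vs us ls.
Proof.
rewrite /=; under eq_bigr => ks _ do rewrite mulr_sumr.
rewrite exchange_big /=; apply: eq_bigr => ls _.
by rewrite /col2 mulr_suml; apply: eq_bigr => ks _; rewrite mulrA.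
Qed.

(** Along the top, a row that has reached its 1 cannot leave the value true, since (false, true,
    false) has weight 0; each further vertex weighs [wB]. *)
Lemma Zv_top_true v vs us hs :
  Zv (v :: vs) us (true :: hs) = (\prod_(u <- us) wB u v) * Zv vs us hs.
Proof.
elim: us hs => [|u us IH] hs; first by rewrite /= big_nil mul1r.
rewrite /= big_bitsS [X in X + _]big1 ?add0r => [|ks _]; last by rewrite !mul0r.
rewrite big_cons mulr_sumr; apply: eq_bigr => ks _.
by rewrite -/(Zv (v :: vs) us (true :: ks)) IH /=; ring.
Qed.

(** The vertical counterpart: (true, false, true) has weight 0, so no horizontal edge can start
    below the 1 of the first column. *)
Lemma colw_below_one u vs (F : bitseq -> R) :
  \sum_(ks <- bits (size vs))
     colw u vs true (nseq (size vs) false) ks * F ks =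
  (\prod_(v <- vs) wB u v) * F (nseq (size vs) false).
Proof.
elim: vs F => [|v vs IH] F /=; first by rewrite big_seq1 big_nil.
rewrite big_bitsS [X in _ + X]big1 ?addr0 => [|ks _]; last by rewrite !mul0r.
rewrite big_cons -mulrA -(IH (fun ks => F (false :: ks))) mulr_sumr.
by apply: eq_bigr => ks _; rewrite mulrA.
Qed.

(** When [wA u v] vanishes the corner must be a 1, which fixes the first row and the first column
    and leaves a smaller system. *)
Lemma Z6v_frozen u v us vs : wA u v = 0 ->
  Z6v (v :: vs) (u :: us) =
  (\prod_(w <- us) wB w v) * (\prod_(w <- vs) wB u w) * Z6v vs us.
Proof.
move=> A0; rewrite {1}/Z6v /= big_bitsS [X in X + _]big1 ?add0r => [|ks _]; last first.
  by rewrite A0 !mul0r.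
rewrite /Z6v [RHS]mulrAC [RHS]mulrC -(Zv_top_true v).
rewrite -(colw_below_one u vs (fun ks => Zv (v :: vs) us (true :: ks))).
by apply: eq_bigr => ks _; rewrite mul1r.
Qed.

Fixpoint Vdm vs : R :=
  if vs is v :: vs' then (\prod_(w <- vs') (w - v)) * Vdm vs' else 1.

(* [Ebez us n m v / qv v] is the entry of the Izergin-Korepin matrix (see
   [Ebez_dvd]); the factor [qv v] is kept so that no division occurs. *)
Definition Ebez us (n m : nat) v : R :=
  (y + (x - y) * v) ^+ m.+1 * (1 - v) ^+ (n - m.+1) * \prod_(u <- us) wA u v
  - v ^+ m.+1 * \prod_(u <- us) wB u v.

(** With a = 1 - v and b = y + (x - y) v, one has qv v = b - v a and wB u v = a wA u v - u qv v.
    Modulo [qv v] the two terms of [Ebez] therefore coincide. *)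
Lemma Ebez_dvd us m v : (m < size us)%N ->
  exists e, Ebez us (size us) m v = qv v * e.
Proof.
move=> lt_m.
pose b := y + (x - y) * v; pose a := 1 - v.
have qE : qv v = b - v * a by rewrite /qv /a /b; ring.
have [e1 e1E] : exists e1, \prod_(u <- us) wB u v =
    a ^+ size us * \prod_(u <- us) wA u v - qv v * e1.
  elim: (us) => [|u us' [e1 IH]]; first by exists 0; rewrite !big_nil /=; ring.
  exists (u * (a ^+ size us' * \prod_(u <- us') wA u v) + wB u v * e1).
  by rewrite !big_cons IH /= exprS qE /wA /wB /a /b; ring.
exists (a ^+ (size us - m.+1) * (\prod_(u <- us) wA u v) *
        (\sum_(i < m.+1) b ^+ (m - i) * (v * a) ^+ i) + v ^+ m.+1 * e1).
rewrite /Ebez e1E -/a -/b mulrDr.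
have -> : b ^+ m.+1 = qv v * (\sum_(i < m.+1) b ^+ (m - i) * (v * a) ^+ i)
    + v ^+ m.+1 * a ^+ m.+1.
  by rewrite -exprMn qE -(subrXX b (v * a) m.+1) subrK.
by rewrite -[in a ^+ size us](subnKC lt_m) exprD; ring.
Qed.

Lemma eq_Ebez us us' n m v : perm_eq us us' -> Ebez us n m v = Ebez us' n m v.
Proof.
by move=> p; rewrite /Ebez; congr (_ * _ - _ * _); apply: perm_big.
Qed.

(** This links [IKmx] to the classical matrix: iterating over all u's but one leaves [Ebez [:: u] 1
    0 v], which equals [qv v], times the product of [wA * wB] over the others. Up to a common row
    factor this is the entry 1 / (wA * wB). *)
Lemma Ebez_column_op u us n m v : (m < n)%N ->
  Ebez (u :: us) n.+1 m v - u * Ebez (u :: us) n.+1 m.+1 v =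
  wA u v * wB u v * Ebez us n m v.
Proof.
move=> lt_mn; rewrite /Ebez !big_cons !subSS.
rewrite -(subnSK lt_mn).
rewrite !exprS /wA /wB; ring.
Qed.

Lemma Ebez_special u us n m v : wA u v = 0 ->
  Ebez (u :: us) n m v = - (v ^+ m.+1 * \prod_(w <- u :: us) wB w v).
Proof. by move=> A0; rewrite /Ebez big_cons A0 mul0r mulr0 sub0r. Qed.

Definition IKmx n us vs : 'M[R]_n := \matrix_(i, j) Ebez us n j vs`_i.

Lemma det_row_scale n (c : 'I_n -> R) (M : 'M[R]_n) :
  \det (\matrix_(i, j) (c i * M i j)) = (\prod_i c i) * \det M.
Proof.
have -> : (\matrix_(i, j) (c i * M i j)) = diag_mx (\row_i c i) *m M.
  by apply/matrixP => i j; rewrite mul_diag_mx !mxE.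
by rewrite det_mulmx det_diag; congr (_ * _); apply: eq_bigr => i _; rewrite mxE.
Qed.

(** By [Ebez_special] the first row is geometric of ratio v, and u v = 1. Subtracting from each
    column u times the next one clears this row except for its last entry, and turns the other rows
    into multiples of rows of the smaller matrix. *)
Lemma det_IKmx_special u v us vs n : size vs = n -> wA u v = 0 ->
  \det (IKmx n.+1 (u :: us) (v :: vs)) =
  (-1) ^+ n.+1 * v ^+ n.+1 * (\prod_(w <- u :: us) wB w v) *
  (\prod_(w <- vs) (wA u w * wB u w)) * \det (IKmx n us vs).
Proof.
move=> szvs A0; have uv1 : u * v = 1.
  by apply/eqP; rewrite eq_sym -subr_eq0; apply/eqP.
(* The unitriangular matrix of these column operations; the last column has no successor and stays
   unchanged. *)
pose U : 'M[R]_n.+1 := \matrix_(i, j) ((i == j)%:R - u * (i == j.+1 :> nat)%:R).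
have detU : \det U = 1.
  rewrite det_trig; last first.
    apply/is_trig_mxP => i j lt_ij; rewrite !mxE -val_eqE (ltn_eqF lt_ij) /=.
    by rewrite ltn_eqF ?mulr0 ?subrr // ltnS ltnW.
  by apply: big1 => i _; rewrite mxE eqxx ltn_eqF // mulr0 subr0.
have MU i j : (IKmx n.+1 (u :: us) (v :: vs) *m U) i j =
    Ebez (u :: us) n.+1 j (v :: vs)`_i -
    (if (j < n)%N then u * Ebez (u :: us) n.+1 j.+1 (v :: vs)`_i else 0).
  rewrite mxE; under eq_bigr => k _ do rewrite !mxE mulrBr.
  rewrite sumrB; congr (_ - _).
    rewrite (bigD1 j) //= eqxx mulr1 big1 ?addr0 // => k /negPf ->.
    by rewrite mulr0.
  case: ltnP => [lt_jn|le_nj]; last first.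
    rewrite big1 // => k _; rewrite ltn_eqF ?mulr0 ?mulr0 //.
    by rewrite (leq_trans (ltn_ord k)).
  rewrite (bigD1 (Ordinal (lt_jn : (j.+1 < n.+1)%N))) //= eqxx mulr1 mulrC.
  rewrite big1 ?addr0 // => k; rewrite -val_eqE /= => /negPf ->.
  by rewrite !mulr0.
rewrite -[LHS]mulr1 -[X in _ * X = _]detU -det_mulmx (expand_det_row _ ord0) (bigD1 ord_max) //=.
rewrite [X in _ + X]big1 ?addr0 => [|j]; last first.
  rewrite -val_eqE /= => ne_jn; rewrite MU /=.
  have lt_jn : (j < n)%N by rewrite ltn_neqAle ne_jn -ltnS ltn_ord.
  rewrite lt_jn !Ebez_special // [v ^+ j.+2]exprS.
  suff -> : - (v ^+ j.+1 * \prod_(w <- u :: us) wB w v) -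
     u * - (v * v ^+ j.+1 * \prod_(w <- u :: us) wB w v) =
     (u * v - 1) * (v ^+ j.+1 * \prod_(w <- u :: us) wB w v) by
    rewrite uv1 subrr !mul0r.
  by ring.
rewrite MU /= ltnn subr0 Ebez_special // /cofactor /= add0n.
have -> : row' ord0 (col' ord_max (IKmx n.+1 (u :: us) (v :: vs) *m U)) =
   \matrix_(i, j) ((wA u vs`_i * wB u vs`_i) * IKmx n us vs i j).
  apply/matrixP => i j; rewrite 2!mxE MU !mxE /= /bump leqNgt ltn_ord /= add0n.
  by rewrite ltn_ord Ebez_column_op.
rewrite det_row_scale [X in _ = _ * X * _](big_nth 0) big_mkord szvs.
rewrite !exprS; ring.
Qed.
End Vertex.

(** * Compatibility with ring morphisms, used to specialise parameters *)

Section Morph.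
Variables (R S : comNzRingType) (f : {rmorphism R -> S}) (x y : R).
Implicit Types (u v w : R) (us vs : seq R).

Lemma rmorph_wA u v : f (wA u v) = wA (f u) (f v).
Proof. by rewrite rmorphB rmorphM rmorph1. Qed.

Lemma rmorph_wB u v : f (wB x y u v) = wB (f x) (f y) (f u) (f v).
Proof. by rewrite !(rmorphB, rmorphM, rmorph1, rmorphD). Qed.

Lemma rmorph_qv v : f (qv x y v) = qv (f x) (f y) (f v).
Proof. by rewrite !(rmorphB, rmorphM, rmorph1, rmorphD, rmorphXn). Qed.

Lemma rmorph_gu u : f (gu x y u) = gu (f x) (f y) (f u).
Proof. by rewrite !(rmorphB, rmorphM, rmorph1, rmorphD, rmorphXn). Qed.

Lemma rmorph_wt u v t h k : f (wt x y u v t h k) = wt (f x) (f y) (f u) (f v) t h k.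
Proof.
by case: t h k => [] [] []; rewrite /= ?(rmorph0, rmorph1, rmorphM, rmorph_wA,
  rmorph_wB, rmorph_gu, rmorph_qv).
Qed.

Lemma rmorph_colw u vs t hs ks :
  f (colw x y u vs t hs ks) = colw (f x) (f y) (f u) (map f vs) t hs ks.
Proof.
elim: vs t hs ks => [|v vs IH] t [|h hs] [|k ks] //=; rewrite ?rmorph0 ?rmorph_nat //.
by rewrite rmorphM rmorph_wt IH.
Qed.

Lemma rmorph_Zv vs us hs :
  f (Zv x y vs us hs) = Zv (f x) (f y) (map f vs) (map f us) hs.
Proof.
elim: us hs => [|u us IH] hs; first by rewrite /= rmorph_nat.
rewrite /= rmorph_sum size_map; apply: eq_bigr => ks _.
by rewrite rmorphM rmorph_colw IH.
Qed.

Lemma rmorph_Z6v vs us :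
  f (Z6v x y vs us) = Z6v (f x) (f y) (map f vs) (map f us).
Proof. by rewrite /Z6v rmorph_Zv size_map. Qed.

Lemma rmorph_Ebez us n m v :
  f (Ebez x y us n m v) = Ebez (f x) (f y) (map f us) n m (f v).
Proof.
rewrite /Ebez rmorphB !rmorphM !rmorphXn rmorphD rmorphB rmorph1 rmorphM rmorphB.
rewrite !rmorph_prod !big_map.
by congr (_ * _ - _ * _); apply: eq_bigr => u _; rewrite (rmorph_wA, rmorph_wB).
Qed.

Lemma rmorph_Vdm vs : f (Vdm vs) = Vdm (map f vs).
Proof.
elim: vs => [|v vs IH]; first exact: rmorph1.
rewrite /= rmorphM IH rmorph_prod big_map; congr (_ * _).
by apply: eq_bigr => w _; rewrite rmorphB.
Qed.
End Morph.

Lemma Zv_swap (R : idomainType) (x y u w : R) us vs hs :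
  size hs = size vs -> Rdiag x y u w != 0 ->
  Zv x y vs (u :: w :: us) hs = Zv x y vs (w :: u :: us) hs.
Proof.
move=> szh r0; rewrite !Zv_cons2; apply: eq_big_seq => ls.
rewrite bitsP => /eqP szl; congr (_ * _).
by have [/(mulfI r0)] := col2_exchange x y u w szh szl.
Qed.

Lemma Z6v_front (R : idomainType) (x y u : R) us1 us2 vs :
  {in us1, forall w, Rdiag x y w u != 0} ->
  Z6v x y vs (us1 ++ u :: us2) = Z6v x y vs (u :: us1 ++ us2).
Proof.
move=> h; rewrite /Z6v; have := size_nseq (size vs) false.
move: (nseq _ _) => hs; elim: us1 hs h => [//|w us1 IH] hs h szh.
rewrite [in RHS]cat_cons -Zv_swap ?h ?mem_head //.
rewrite /=; apply: eq_big_seq => ks; rewrite bitsP => /eqP szk.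
by rewrite IH // => w' hw'; apply: h; rewrite inE hw' orbT.
Qed.

(** All top edges of the first row are false, so its vertices have degree at most 1 in the row
    parameter, and the vertex of its 1, present unless [h] is already true, has degree 0. *)
Lemma size_Zv (R : idomainType) (x y : R) vs us h hs : 
  (size (Zv x%:P y%:P ('X :: map polyC vs) (map polyC us) (h :: hs)) <= size us + h)%N.
Proof.
elim: us h hs => [|u us IH] h hs.
  by rewrite /=; case: h; case: all; rewrite /= ?size_poly1 ?size_poly0.
rewrite [Zv _ _ _ _ _]/= big_bitsS.
have colC t k ks : colw x%:P y%:P u%:P (map polyC vs) t k ks =
   (colw x y u vs t k ks)%:P by rewrite rmorph_colw.
have sum_le (p : {poly R}) t (F : bitseq -> {poly R}) (c : nat) :
    (size p <= 2)%N -> (forall ks, size (F ks) <= c)%N ->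
   (size (\sum_(ks <- bits (size (map polyC vs)))
      p * colw x%:P y%:P u%:P (map polyC vs) t hs ks * F ks)%R <= c.+1)%N.
  move=> szp szF; apply: (big_ind (fun p : {poly R} => size p <= c.+1)%N).
  - by rewrite size_poly0.
  - by move=> a b ha hb; apply: leq_trans (size_polyD _ _) _; rewrite geq_max ha.
  move=> ks _; rewrite colC -mulrA mulrCA mul_polyC.
  apply: leq_trans (size_scale_leq _ _) _.
  apply: leq_trans (size_polyMleq _ _) _.
  have := szF ks; move: szp; case: (size p) => [|[|[|]]] // _ h2; rewrite ?add0n.
  - by apply: leq_trans (leq_pred _) _; apply: leqW.
  by apply: leqW.
have szA : (size (wA u%:P 'X : {poly R})%R <= 2)%N.
  rewrite /wA; apply: leq_trans (size_polyD _ _) _.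
  rewrite size_poly1 geq_max /= size_polyN mul_polyC.
  by apply: leq_trans (size_scale_leq _ _) _; rewrite size_polyX.
have szB : (size (wB x%:P y%:P u%:P 'X : {poly R})%R <= 2)%N.
  have -> : wB x%:P y%:P u%:P 'X =
      (1 - u * y)%:P - (1 + u * (x - y)) *: 'X :> {poly R}.
    by rewrite -mul_polyC !(polyCB, polyCD, polyCM) /wB; ring.
  apply: leq_trans (size_polyD _ _) _; rewrite geq_max size_polyN.
  rewrite (leq_trans (size_polyC_leq1 _)) //=.
  by apply: leq_trans (size_scale_leq _ _) _; rewrite size_polyX.
apply: leq_trans (size_polyD _ _) _; rewrite geq_max; apply/andP; split.
  case: h; last first.
    rewrite addn0 /=; apply: sum_le => // ks.
    by apply: leq_trans (IH _ _) _; rewrite addn0.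
  by rewrite big1 ?size_poly0 // => ks _; rewrite !mul0r.
case: h; last first.
  rewrite addn0 /=; apply: (big_ind (fun p : {poly R} => size p <= _)%N).
  - by rewrite size_poly0.
  - by move=> a b ha hb; apply: leq_trans (size_polyD _ _) _; rewrite geq_max ha.
  move=> ks _; rewrite mul1r colC mul_polyC.
  apply: leq_trans (size_scale_leq _ _) _.
  by apply: leq_trans (IH _ _) _; rewrite addn1.
by rewrite /= addn1; apply: sum_le => // ks; apply: leq_trans (IH _ _) _; rewrite addn1.
Qed.

(** * The Izergin-Korepin determinant *)

Section IK.
Variables (F : fieldType) (x y : F).
Implicit Types (u v w : F) (us vs : seq F).

Lemma cofactor_IKmx us n v v' vs j :
  cofactor (IKmx x y n.+1 us (v :: vs)) ord0 j =
  cofactor (IKmx x y n.+1 us (v' :: vs)) ord0 j.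
Proof.
by congr (_ * \det _); apply/matrixP => i k; rewrite !mxE.
Qed.

(** In the first row the entries have degree at most 2n + 2 in v and are divisible by [qv], of
    degree 2. The resulting degree, at most 2n, is what 2n + 1 interpolation points determine. *)
Lemma det_IKmx_poly us n vs : size us = n.+1 ->
  exists2 p : {poly F}, (size p <= n + n.+1)%N &
    forall v, qv x y v * p.[v] = \det (IKmx x y n.+1 us (v :: vs)).
Proof.
move=> szus; pose EX m := Ebez x%:P y%:P (map polyC us) n.+1 m 'X.
have EXE m v : (EX m).[v] = Ebez x y us n.+1 m v.
  rewrite -horner_evalE /EX rmorph_Ebez /= !horner_evalE !hornerC hornerX.
  by rewrite -map_comp (eq_map (g := id)) ?map_id // => u /=; rewrite horner_evalE hornerC.
have qXE v : (qv x%:P y%:P 'X).[v] = qv x y v.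
  by rewrite -horner_evalE rmorph_qv /= !horner_evalE !hornerC hornerX.
have szq : size (qv x%:P y%:P ('X : {poly F})) = 3%N.
  have -> : qv x%:P y%:P 'X = 'X^2 + (y%:P - (1 + y - x) *: 'X) :> {poly F}.
    by rewrite -mul_polyC !(polyCB, polyCD) /qv; ring.
  rewrite size_polyDl size_polyXn // ltnS.
  apply: leq_trans (size_polyD _ _) _; rewrite geq_max size_polyN.
  rewrite (leq_trans (size_polyC_leq1 _)) //=.
  by apply: leq_trans (size_scale_leq _ _) _; rewrite size_polyX.
have size_pX (p : {poly F}) k c : (size p <= c.+1)%N -> (size (p ^+ k) <= (c * k).+1)%N.
  move=> szp; apply: leq_trans (size_poly_exp_leq _ _) _.
  by rewrite ltnS leq_mul2r -subn1 leq_subLR add1n szp orbT.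
have size_pM (p q : {poly F}) a b : (size p <= a.+1)%N -> (size q <= b.+1)%N ->
    (size (p * q)%R <= (a + b).+1)%N.
  move=> hp hq; apply: leq_trans (size_polyMleq _ _) _.
  rewrite -subn1 leq_subLR add1n; apply: leq_trans (leq_add hp hq) _.
  by rewrite addnS.
have size_prod (f : F -> {poly F}) :
    (forall u, size (f u) <= 2)%N -> (size (\prod_(u <- us) f u)%R <= n.+2)%N.
  move=> szf; rewrite -szus; elim: (us) => [|u us' IH] /=.
    by rewrite big_nil size_poly1.
  by rewrite big_cons; apply: (@size_pM _ _ 1%N).
have size_lin a b : (size (a%:P + b *: 'X : {poly F})%R <= 2)%N.
  apply: leq_trans (size_polyD _ _) _; rewrite geq_max.
  rewrite (leq_trans (size_polyC_leq1 _)) //=.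
  by apply: leq_trans (size_scale_leq _ _) _; rewrite size_polyX.
have szEX m : (m < n.+1)%N -> (size (EX m) <= (n.+1 + n.+1).+1)%N.
  move=> lt_m; rewrite /EX /Ebez !big_map.
  apply: leq_trans (size_polyD _ _) _; rewrite geq_max size_polyN.
  apply/andP; split.
    apply: (size_pM); last first.
      apply: (size_prod) => u; rewrite /wA mul_polyC -scaleNr; exact: (size_lin).
    rewrite -[n.+1 in leqRHS](subnKC lt_m); apply: (size_pM).
      rewrite -[X in (_ <= X.+1)%N]mul1n; apply: (size_pX).
      by rewrite -polyCB mul_polyC; apply: (size_lin).
    rewrite -[X in (_ <= X.+1)%N]mul1n; apply: (size_pX).
    by rewrite -[- 'X]scaleN1r; apply: (size_lin).
  apply: (size_pM); first by rewrite size_polyXn.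
  apply: (size_prod) => u.
  have -> : wB x%:P y%:P u%:P 'X =
      (1 - u * y)%:P + - (1 + u * (x - y)) *: 'X :> {poly F}.
    by rewrite -mul_polyC !(polyCN, polyCB, polyCD, polyCM) /wB; ring.
  exact: (size_lin).
have [e eE] : exists e : 'I_n.+1 -> {poly F}, forall j : 'I_n.+1,
    EX j = qv x%:P y%:P 'X * e j.
  have h (j : 'I_n.+1) : exists e, EX j = qv x%:P y%:P 'X * e.
    have lt_j : (j < size (map polyC us))%N by rewrite size_map szus.
    have [e eE] := Ebez_dvd x%:P y%:P 'X lt_j.
    by exists e; rewrite -eE size_map szus.
  by have [e eE] := fin_all_exists h; exists e.
have sze j : (size (e j) <= n + n.+1)%N.
  have [->|e0] := eqVneq (e j) 0; first by rewrite size_poly0.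
  have := szEX j (ltn_ord j); rewrite eE size_mul ?szq //.
    by rewrite -size_poly_gt0 szq.
exists (\sum_j (cofactor (IKmx x y n.+1 us (0 :: vs)) ord0 j) *: e j).
  apply: (big_ind (fun p : {poly F} => size p <= _)%N).
  - by rewrite size_poly0.
  - by move=> a b ha hb; apply: leq_trans (size_polyD _ _) _; rewrite geq_max ha.
  by move=> j _; apply: leq_trans (size_scale_leq _ _) _.
move=> v; rewrite (expand_det_row _ ord0) horner_sum mulr_sumr.
apply: eq_bigr => j _; rewrite hornerZ (cofactor_IKmx us v 0) mulrCA.
by rewrite -qXE -hornerM -eE EXE mulrC mxE.
Qed.

(** Induction on n by Lagrange interpolation in the first row parameter. Both sides vanish when it
    equals another row parameter, and at the inverse of any column parameter both reduce to the case
    of one row and one column less. Symmetry in the column parameters lets each u be moved to the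
    corner. *)
Lemma izergin_korepin n us vs : size us = n -> size vs = n ->
  {in us &, forall u w, Rdiag x y u w != 0} -> uniq us -> 0 \notin us ->
  uniq vs -> {in vs, forall v, qv x y v != 0} ->
  {in us & vs, forall u v, wA u v != 0} ->
  Z6v x y vs us * Vdm vs * (\prod_(v <- vs) qv x y v) =
  \det (IKmx x y n us vs).
Proof.
elim: n us vs => [|n IH] us vs.
  move=> /size0nil -> /size0nil -> _ _ _ _ _ _.
  by rewrite /Z6v /= big_nil det_mx00 !mulr1.
case: vs => [//|v vs] szus [szvs] hR uus u0 /= /andP[_ uvs] hq hA.
(* The left-hand side, up to the factor [qv] of the first row, as a polynomial in the first row
   parameter. *)
pose L := Zv x%:P y%:P ('X :: map polyC vs) (map polyC us) (nseq n.+1 false) *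
  (\prod_(w <- vs) (w%:P - 'X)) * (Vdm vs * \prod_(w <- vs) qv x y w)%:P.
have LE a : L.[a] = Z6v x y (a :: vs) us * (\prod_(w <- vs) (w - a)) *
    (Vdm vs * \prod_(w <- vs) qv x y w).
  rewrite !hornerM hornerC horner_prod -horner_evalE rmorph_Zv /=.
  rewrite !horner_evalE !hornerC hornerX /Z6v /= szvs -!map_comp.
  rewrite (eq_map (g := id)) ?map_id => [|u /=]; last first.
    by rewrite horner_evalE hornerC.
  rewrite (eq_map (g := id)) ?map_id => [|u /=]; last first.
    by rewrite horner_evalE hornerC.
  by congr (_ * _ * _); apply: eq_bigr => w _; rewrite hornerD hornerN hornerC hornerX.
have [p szp pE] := det_IKmx_poly vs szus.
have hA' : {in us & vs, forall u w, wA u w != 0}.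
  by move=> u w hu hw; apply: hA => //; rewrite inE hw orbT.
have hq' : {in vs, forall w, qv x y w != 0}.
  by move=> w hw; apply: hq; rewrite inE hw orbT.
have special u us1 us2 : us = us1 ++ u :: us2 -> L.[u^-1] = p.[u^-1].
  move=> usE; have pus : perm_eq us (u :: us1 ++ us2).
    by rewrite usE perm_catC /= perm_cons perm_catC.
  have hu : u \in us by rewrite (perm_mem pus) mem_head.
  have un0 : u != 0 by apply: contraNneq u0 => <-.
  have A0 : wA u u^-1 = 0 by rewrite /wA divff ?subrr.
  (* The hypothesis on [Rdiag] also covers two equal arguments, and that case gives this. *)
  have q0 : qv x y u^-1 != 0.
    have := hR u u hu hu; apply: contra_neq => q0.
    have -> : Rdiag x y u u = u ^+ 2 * qv x y u^-1 by rewrite /Rdiag /qv; field.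
    by rewrite q0 mulr0.
  have sz' : size (us1 ++ us2) = n.
    by have := perm_size pus; rewrite szus /= => -[].
  have sub' w : w \in us1 ++ us2 -> w \in us.
    by rewrite (perm_mem pus) inE => ->; rewrite orbT.
  have uus' : uniq (us1 ++ us2) by have := uus; rewrite (perm_uniq pus) /= => /andP[].
  have {IH} IH := IH _ vs sz' szvs _ uus' _ uvs hq' _.
  have {IH} IH : Z6v x y vs (us1 ++ us2) * Vdm vs * (\prod_(v <- vs) qv x y v) =
     \det (IKmx x y n (us1 ++ us2) vs).
    apply: IH => [a b /sub' ha /sub' hb||a b /sub' ha hb]; [exact: hR| |exact: hA'].
    by apply: contra u0 => /sub'.
  apply: (mulfI q0); rewrite pE LE.
  have -> : IKmx x y n.+1 us (u^-1 :: vs) = IKmx x y n.+1 (u :: us1 ++ us2) (u^-1 :: vs).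
    by apply/matrixP => i j; rewrite !mxE (eq_Ebez _ _ _ _ _ pus).
  rewrite usE Z6v_front -?usE; last first.
    by move=> w hw; apply: hR => //; rewrite usE mem_cat hw.
  rewrite Z6v_frozen // (det_IKmx_special _ _ _ szvs A0) -IH big_cons.
  have -> : \prod_(w <- vs) (w - u^-1) = (- u^-1) ^+ n * \prod_(w <- vs) wA u w.
    rewrite -szvs; elim: (vs) => [|w ws IHw]; first by rewrite !big_nil mulr1.
    by rewrite !big_cons IHw /= exprS /wA; field.
  have -> : qv x y u^-1 = - u^-1 * wB x y u u^-1 by rewrite /qv /wB; field.
  rewrite big_split /= [(- _) ^+ n]exprNn !exprS; ring.
have LpE : L = p.
  apply/eqP; rewrite -subr_eq0; apply/eqP.
  (* These are n + (n + 1) points, distinct because no [wA u v] vanishes. *)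
  apply: (@roots_geq_poly_eq0 _ _ (vs ++ map (fun u => u^-1) us)).
  - rewrite all_cat; apply/andP; split; apply/allP => a.
      move=> ha; rewrite rootE hornerD hornerN subr_eq0; apply/eqP.
      apply: (mulfI (hq' _ ha)); rewrite pE LE.
      rewrite [\prod_(w <- vs) (w - a)](_ : _ = 0).
        rewrite mulr0 mul0r mulr0; symmetry.
        have ia : (index a vs < n)%N by rewrite -szvs index_mem.
        apply: (@determinant_alternate _ _ _ ord0 (lift ord0 (Ordinal ia))) => // j.
        by rewrite !mxE /= nth_index.
      by apply/eqP; rewrite prodf_seq_eq0; apply/hasP; exists a; rewrite ?subrr ?eqxx.
    case/mapP => u hu ->; rewrite rootE hornerD hornerN subr_eq0; apply/eqP.
    by case/splitPr: hu (special u) => us1 us2 /(_ us1 us2 erefl).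
  - rewrite cat_uniq uvs map_inj_uniq ?uus ?andbT; last exact: invr_inj.
    apply/hasPn => a /mapP[u hu ->]; apply/negP => hv.
    have := hA' _ _ hu hv; rewrite /wA divff ?subrr ?eqxx //.
    by apply: contraNneq u0 => <-.
  - rewrite size_cat size_map szus szvs.
    apply: leq_trans (size_polyD _ _) _; rewrite geq_max size_polyN szp andbT.
    rewrite /L mulrC mul_polyC; apply: leq_trans (size_scale_leq _ _) _.
    apply: leq_trans (size_polyMleq _ _) _.
    have sz1 : (size (\prod_(w <- vs) (w%:P - 'X : {poly F}))%R <= n.+1)%N.
      rewrite -szvs; elim: (vs) => [|w ws IHw]; first by rewrite big_nil size_poly1.
      rewrite big_cons; apply: leq_trans (size_polyMleq _ _) _.
      rewrite -subn1 leq_subLR add1n /= -(opprB 'X) size_polyN size_XsubC !addSn !ltnS.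
      exact: IHw.
    have sz2 := size_Zv x y vs us false (nseq n false).
    rewrite szus addn0 in sz2.
    by rewrite -subn1 leq_subLR add1n; apply: leq_trans (leq_add sz2 sz1) _.
rewrite -(pE v) -LpE LE /= big_cons; ring.
Qed.
End IK.

(** * The homogeneous limit *)

Section RowDet.
Variables (R : comNzRingType) (n : nat).
Implicit Types (p q g : {poly R}) (rs s : seq {poly R}) (c : R) (cs : seq R).

Definition eqX p q := forall j, (j < n)%N -> p`_j = q`_j.

Lemma eqX_mull g p q : eqX p q -> eqX (g * p) (g * q).
Proof.
move=> pq j lt_jn; rewrite !coefMr; apply: eq_bigr => i _.
by rewrite pq // (leq_ltn_trans _ lt_jn) // -ltnS.
Qed.

Definition rdet rs : R := \det (\matrix_(i < n, j < n) (rs`_i)`_j).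

Lemma eq_rdet rs rs' :
  (forall i, (i < n)%N -> eqX rs`_i rs'`_i) -> rdet rs = rdet rs'.
Proof. by move=> h; congr (\det _); apply/matrixP => i j; rewrite !mxE h. Qed.

Lemma rdet_lin s1 s2 c p q : (size s1 < n)%N ->
  rdet (s1 ++ (c *: p + q) :: s2) = c * rdet (s1 ++ p :: s2) + rdet (s1 ++ q :: s2).
Proof.
move=> lt_n; rewrite -[X in _ = _ + X]mul1r.
have nthE r r' (i : 'I_n) : i != Ordinal lt_n ->
    (s1 ++ r :: s2)`_i = (s1 ++ r' :: s2)`_i.
  rewrite -val_eqE /= !nth_cat => ne; case: ltnP => // le_i.
  by rewrite -(subnSK (_ : size s1 < i)%N) // ltn_neqAle eq_sym ne.
apply: (@determinant_multilinear _ _ _ _ _ (Ordinal lt_n)).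
- by apply/matrixP => i j; rewrite !mxE /= !nth_cat ltnn subnn /= !coefE mul1r.
- by apply/matrixP => i j; rewrite !mxE (nthE _ (c *: p + q)) // eq_sym neq_lift.
- by apply/matrixP => i j; rewrite !mxE (nthE _ (c *: p + q)) // eq_sym neq_lift.
Qed.

Lemma rdet0 s1 s2 : (size s1 < n)%N -> rdet (s1 ++ 0 :: s2) = 0.
Proof.
move=> lt_n; have := rdet_lin s2 (-1) 0 0 lt_n.
by rewrite scaler0 addr0 mulN1r addNr.
Qed.

Lemma rdet_alt s1 s2 p : (size (s1 ++ s2) < n)%N -> p \in s1 ++ s2 ->
  rdet (s1 ++ p :: s2) = 0.
Proof.
rewrite size_cat mem_cat => lt_n /orP[] ps.
  have lt_i : (index p s1 < size s1)%N by rewrite index_mem.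
  have lt_s1 : (size s1 < n)%N by apply: leq_ltn_trans (leq_addr _ _) lt_n.
  apply: (@determinant_alternate _ _ _ (Ordinal (ltn_trans lt_i lt_s1)) (Ordinal lt_s1)).
    by rewrite -val_eqE /= ltn_eqF.
  by move=> j; rewrite !mxE /= !nth_cat lt_i ltnn subnn nth_index.
have lt_i : (index p s2 < size s2)%N by rewrite index_mem.
have lt_s1 : (size s1 < n)%N by apply: leq_ltn_trans (leq_addr _ _) lt_n.
have lt_s2 : (size s1 + (index p s2).+1 < n)%N.
  by apply: leq_ltn_trans lt_n; rewrite leq_add2l.
apply: (@determinant_alternate _ _ _ (Ordinal lt_s1) (Ordinal lt_s2)).
  by rewrite -val_eqE /= addnS ltn_eqF // ltnS leq_addr.
move=> j; rewrite !mxE /= !nth_cat ltnn subnn addnS ltnNge leqW ?leq_addr //=.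
by rewrite subSn ?leq_addr // addKn /= nth_index.
Qed.

Lemma rdet_addl s1 s2 p q : (size (s1 ++ s2) < n)%N -> q \in s1 ++ s2 ->
  forall c, rdet (s1 ++ (c *: q + p) :: s2) = rdet (s1 ++ p :: s2).
Proof.
move=> lt_n qs c; have lt_s1 : (size s1 < n)%N.
  by apply: leq_ltn_trans lt_n; rewrite size_cat leq_addr.
by rewrite rdet_lin // rdet_alt // mulr0 add0r.
Qed.

Lemma rdet_add_sum s1 s2 p k (c : nat -> R) (f : nat -> {poly R}) :
  (size (s1 ++ s2) < n)%N -> (forall i, (i < k)%N -> f i \in s1 ++ s2) ->
  rdet (s1 ++ (\sum_(i < k) c i *: f i + p) :: s2) = rdet (s1 ++ p :: s2).
Proof.
move=> lt_n; elim: k => [|k IH] fs1; first by rewrite big_ord0 add0r.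
rewrite big_ord_recr /= -addrA addrCA rdet_addl ?fs1 //.
by rewrite IH // => i lt_ik; apply/fs1/ltnW.
Qed.

Lemma rdet_scale cs rs rs' :
  (forall i, (i < n)%N -> eqX rs'`_i (cs`_i *: rs`_i)) ->
  rdet rs' = (\prod_(i < n) cs`_i) * rdet rs.
Proof.
move=> h; rewrite -det_row_scale; congr (\det _); apply/matrixP => i j.
by rewrite !mxE h // coefZ.
Qed.

(** Multiplication by g modulo X^n acts on coefficient rows as an upper triangular Toeplitz matrix
    with diagonal g_0. *)
Lemma rdet_mull g rs : rdet [seq g * r | r <- rs] = g`_0 ^+ n * rdet rs.
Proof.
pose T : 'M[R]_n := \matrix_(i, j) if (i <= j)%N then g`_(j - i) else 0.
have -> : g`_0 ^+ n = \det T.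
  rewrite -det_tr det_trig; last first.
    by apply/is_trig_mxP => i j lt_ij; rewrite !mxE leqNgt lt_ij.
  rewrite (eq_bigr (fun=> g`_0)) ?prodr_const ?card_ord // => i _.
  by rewrite !mxE leqnn subnn.
rewrite mulrC -det_mulmx; congr (\det _); apply/matrixP => i j; rewrite !mxE.
have -> : [seq g * r | r <- rs]`_i = g * rs`_i.
  have [lt_i|le_i] := ltnP i (size rs); first by rewrite (nth_map 0).
  by rewrite !nth_default ?size_map // mulr0.
rewrite coefMr (big_ord_widen_cond _ predT (fun k => g`_(j - k) * rs`_i`_k) (ltn_ord j)).
rewrite big_mkcond; apply: eq_bigr => k _.
by rewrite !mxE ltnS mulrC; case: leqP; rewrite ?mulr0.
Qed.
End RowDet.

Lemma rmorph_rdet (R S : comNzRingType) (f : {rmorphism R -> S}) n rs :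
  f (rdet n rs) = rdet n (map (map_poly f) rs).
Proof.
rewrite /rdet -det_map_mx; congr (\det _); apply/matrixP => i j; rewrite !mxE.
rewrite -coef_map; have [lt_i|le_i] := ltnP i (size rs); first by rewrite (nth_map 0).
have -> : [seq map_poly f r | r <- rs]`_i = 0 by rewrite nth_default ?size_map.
have -> : rs`_i = 0 by apply: nth_default.
by rewrite rmorph0.
Qed.

Lemma eqX_mulI (R : idomainType) n (g p q : {poly R}) : g`_0 != 0 ->
  eqX n (g * p) (g * q) -> eqX n p q.
Proof.
move=> g0 h; elim/ltn_ind => j IH lt_jn; have := h j lt_jn.
rewrite !coefM !big_ord_recl !subn0.
rewrite [X in _ + X = _](_ : _ = \sum_(i < j) g`_(bump 0 i) * q`_(j - bump 0 i)).
  by move/addIr/(mulfI g0).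
apply: eq_bigr => i _; rewrite IH //; last exact: leq_ltn_trans (leq_subr _ _) lt_jn.
by rewrite ltn_subrL /= (leq_ltn_trans _ (ltn_ord i)).
Qed.

Lemma eqX_XnM (R : comNzRingType) n (p : {poly R}) : eqX n ('X^n * p) 0.
Proof. by move=> j lt_jn; rewrite coefXnM lt_jn coef0. Qed.

Lemma eqXD (R : comNzRingType) n (p q r : {poly R}) m :
  (n <= m)%N -> p = q + 'X^m * r -> eqX n p q.
Proof.
move=> le_nm -> j lt_jn; rewrite coefD coefXnM (leq_trans lt_jn) // addr0 //.
Qed.

Section HomogeneousRows.
Variables (R : comNzRingType) (x y : R).
Implicit Types (v : R).

Definition apoly : {poly R} := 1 - y *: 'X.
Definition bpoly : {poly R} := 1 + (x - y) *: 'X.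

(** [Yrow] and [Vrow] are truncated geometric series: modulo X^n they are (1 - v)^n / (a - v b) and
    1 / (1 - v X), with a = [apoly] and b = [bpoly]. *)
Definition Yrow n v : {poly R} :=
  \poly_(m < n) ((y + (x - y) * v) ^+ m * (1 - v) ^+ (n.-1 - m)).
Definition Vrow n v : {poly R} := \poly_(m < n) v ^+ m.
Definition Prow n v : {poly R} := Yrow n v * Vrow n v.

Lemma YrowE n v :
  (apoly - v *: bpoly) * Yrow n v =
  ((1 - v) ^+ n)%:P - 'X^n * ((y + (x - y) * v) ^+ n)%:P.
Proof.
have -> : apoly - v *: bpoly = (1 - v)%:P - (y + (x - y) * v)%:P * 'X.
  rewrite /apoly /bpoly -!mul_polyC !(polyCB, polyCD, polyCM); ring.
have -> : Yrow n v = \sum_(i < n) (1 - v)%:P ^+ (n.-1 - i) *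
    ((y + (x - y) * v)%:P * 'X) ^+ i.
  rewrite /Yrow poly_def; apply: eq_bigr => i _.
  by rewrite exprMn -!polyC_exp -mul_polyC polyCM; ring.
by rewrite -subrXX !polyC_exp exprMn; ring.
Qed.

Lemma VrowE n v : (1 - v *: 'X) * Vrow n v = 1 - 'X^n * (v ^+ n)%:P.
Proof.
have -> : Vrow n v = \sum_(i < n) 1 ^+ (n.-1 - i) * (v%:P * 'X) ^+ i.
  rewrite /Vrow poly_def; apply: eq_bigr => i _.
  by rewrite expr1n mul1r exprMn -polyC_exp mul_polyC.
by rewrite -mul_polyC -subrXX expr1n exprMn polyC_exp; ring.
Qed.

Lemma coef_Prow n v m : (m < n)%N ->
  (Prow n v)`_m =
  \sum_(k < m.+1) v ^+ (m - k) * ((y + (x - y) * v) ^+ k * (1 - v) ^+ (n.-1 - k)).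
Proof.
move=> lt_m; rewrite coefM; apply: eq_bigr => k _; rewrite mulrC !coef_poly.
by rewrite (leq_ltn_trans _ lt_m) ?leq_subr // (leq_trans (ltn_ord k) lt_m).
Qed.

Lemma Ebez0 n m v : (m < n)%N ->
  Ebez x y (nseq n 0) n m v = qv x y v * (Prow n v)`_m.
Proof.
move=> lt_m; rewrite coef_Prow // /Ebez.
have -> : \prod_(u <- nseq n 0) wA u v = 1.
  by rewrite big1_seq // => u /andP[_ /nseqP[-> _]]; rewrite /wA mul0r subr0.
have -> : \prod_(u <- nseq n 0) wB x y u v = (1 - v) ^+ n.
  elim: {lt_m}n => [|k IH]; first by rewrite big_nil.
  by rewrite /= big_cons IH exprS /wB mul0r subr0.
rewrite mulr1; set b := y + _.
have qE : qv x y v = b - v * (1 - v) by rewrite /qv /b; ring.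
have -> : (1 - v) ^+ n = (1 - v) ^+ m.+1 * (1 - v) ^+ (n - m.+1).
  by rewrite -exprD subnKC.
rewrite [X in _ - X]mulrA -exprMn.
rewrite [X in _ - X]mulrC -[b ^+ _ * _]mulrC -mulrBr subrXX -qE mulrCA.
congr (_ * _); rewrite mulr_sumr (reindex_inj rev_ord_inj) /=.
apply: eq_bigr => k _; have le_km : (k <= m)%N by rewrite -ltnS.
rewrite !subSS !subKn // exprMn.
have -> : (n.-1 - k = (n - m.+1) + (m - k))%N by lia.
by rewrite exprD; ring.
Qed.

(** From the partial fractions (b - X a) / ((a - v b)(1 - v X)) = b / (a - v b) - X / (1 - v X):
    after multiplication by a^N, [kappa N j] is the coefficient of v^j for j < N. [grow] is the
    factor (b - X a) a^N, and [rhorow] carries the terms from v^N on, scaled by (1 - v)^(N+2),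
    modulo X^(N+2). *)
Definition kappa N j : {poly R} :=
  apoly ^+ (N.-1 - j) * (bpoly ^+ j.+1 - ('X * apoly) ^+ j.+1).
Definition grow N : {poly R} := (bpoly - 'X * apoly) * apoly ^+ N.
Definition rhorow N v : {poly R} :=
  bpoly ^+ N.+1 * Yrow N.+2 v - ((1 - v) ^+ N.+2) *: 'X^(N.+1).

Lemma kappa_sum N v :
  (apoly - v *: bpoly) * (1 - v *: 'X) * \sum_(j < N) v ^+ j *: kappa N j =
  bpoly * (1 - v *: 'X) * (apoly ^+ N - (v *: bpoly) ^+ N) -
  'X * apoly ^+ N * (apoly - v *: bpoly) * (1 - (v *: 'X) ^+ N).
Proof.
rewrite -[1 in X in _ = _ - _ * X](expr1n _ N) !subrXX.
have -> : \sum_(j < N) v ^+ j *: kappa N j =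
  bpoly * (\sum_(i < N) apoly ^+ (N.-1 - i) * (v *: bpoly) ^+ i) -
  'X * apoly ^+ N * (\sum_(i < N) 1 ^+ (N.-1 - i) * (v *: 'X) ^+ i).
  rewrite !mulr_sumr -sumrB; apply: eq_bigr => j _.
  have -> : apoly ^+ N = apoly ^+ (N.-1 - j) * apoly ^+ j.+1.
    by rewrite -exprD; congr (_ ^+ _); have := ltn_ord j; lia.
  rewrite /kappa expr1n -!mul_polyC polyC_exp !exprMn !exprS; ring.
ring.
Qed.
End HomogeneousRows.

Lemma grow_Prow (R : idomainType) (x y : R) N v : v != 1 ->
  eqX N.+2 (grow x y N * Prow x y N.+2 v)
    (\sum_(j < N) ((1 - v) ^+ N.+2 * v ^+ j) *: kappa x y N j +
     v ^+ N *: rhorow x y N v).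
Proof.
move=> v1; pose a := apoly y; pose b := bpoly x y.
(* This makes X^(N+1) a^N congruent to X^(N+1) modulo X^(N+2), which accounts for the simple last
   term of [rhorow]. *)
have [w wE] : exists w, a ^+ N - 1 = 'X * w.
  exists (- y%:P * \sum_(i < N) a ^+ (N.-1 - i) * 1 ^+ i).
  rewrite -[1 in LHS](expr1n _ N) subrXX /a /apoly -mul_polyC; ring.
apply: (@eqX_mulI _ _ ((a - v *: b) * (1 - v *: 'X))).
  rewrite coef0M /a /b /apoly /bpoly !coefE /=.
  by rewrite !(mulr0, subr0, addr0, mulr1) subr_eq0 eq_sym.
pose C := ((1 - v) ^+ N.+2)%:P; pose B := ((y + (x - y) * v) ^+ N.+2)%:P.
pose S := \sum_(j < N) v ^+ j *: kappa x y N j.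
have eY := YrowE x y N.+2 v; have eV := VrowE N.+2 v; have eK := kappa_sum x y N v.
rewrite -/a -/b -/C -/B -/S in eY eV eK.
have -> : \sum_(j < N) ((1 - v) ^+ N.+2 * v ^+ j) *: kappa x y N j = C * S.
  by rewrite mulr_sumr; apply: eq_bigr => j _; rewrite /C mul_polyC scalerA.
(* The witness gathers the multiples of X^(N+2): the truncation errors of the two geometric series,
   and what replacing a^N by 1 and 1 - v X by 1 in front of X^(N+1) leaves over. *)
apply: (@eqXD _ _ _ _ (grow x y N * (- B - C * (v ^+ N.+2)%:P +
    'X^(N.+2) * B * (v ^+ N.+2)%:P) - v%:P ^+ N * (C * (a - v *: b) * (w + v%:P)
    - b ^+ N.+1 * (1 - v *: 'X) * B)) N.+2) => //.
have -> : (a - v *: b) * (1 - v *: 'X) * (grow x y N * Prow x y N.+2 v) =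
    grow x y N * (((a - v *: b) * Yrow x y N.+2 v) * ((1 - v *: 'X) * Vrow N.+2 v)).
  by rewrite /Prow; ring.
have -> : (a - v *: b) * (1 - v *: 'X) * (C * S + v ^+ N *: rhorow x y N v) =
    C * ((a - v *: b) * (1 - v *: 'X) * S) + v%:P ^+ N * ((1 - v *: 'X) *
    (b ^+ N.+1 * ((a - v *: b) * Yrow x y N.+2 v) - (a - v *: b) * (C * 'X^(N.+1)))).
  by rewrite /rhorow -/b -!mul_polyC -/C polyC_exp; ring.
have aN : a ^+ N = 1 + 'X * w by rewrite -wE; ring.
rewrite eY eV eK /grow -/a -/b aN !exprZn -!mul_polyC !polyC_exp !exprS; ring.
Qed.

Lemma Vdm_not_uniq (R : comNzRingType) (vs : seq R) : ~~ uniq vs -> Vdm vs = 0.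
Proof.
elim: vs => [|v vs IH] //=; rewrite negb_and negbK => /orP[hv|/IH ->]; last first.
  by rewrite mulr0.
by rewrite (big_rem v) //= subrr !mul0r.
Qed.

Lemma map_horner0_polyC (R : comNzRingType) (s : seq R) :
  map (horner_eval 0) (map polyC s) = s.
Proof. by rewrite -map_comp -[RHS]map_id; apply: eq_map => a /=; rewrite horner_evalE hornerC. Qed.

(** The determinant formula is applied over a fraction field to column parameters that are powers of
    X. The resulting identity lies in the polynomial ring, where X can be set to 0. *)
Lemma Z6v_homogeneous_columns (R : idomainType) (x y : R) n vs :
  size vs = n -> {in vs, forall v, qv x y v != 0} ->
  Z6v x y vs (nseq n 0) * Vdm vs = rdet n (map (Prow x y n) vs).
Proof.
move=> szvs hq; have [uvs|nuvs] := boolP (uniq vs); last first.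
  rewrite Vdm_not_uniq // mulr0 /rdet.
  have /(uniqPn 0)[i [j [lt_ij lt_j e_ij]]] := nuvs; rewrite szvs in lt_j.
  symmetry; pose I := Ordinal (ltn_trans lt_ij lt_j); pose J := Ordinal lt_j.
  apply: (@determinant_alternate _ _ _ I J) => [|k].
    by rewrite -val_eqE /= ltn_eqF.
  rewrite !mxE /= !(nth_map 0) ?szvs ?e_ij //; exact: ltn_trans lt_ij lt_j.
pose f : {rmorphism {poly R} -> {fraction {poly R}}} := @tofrac {poly R}.
have f_inj : injective f.
  move=> p q /eqP; rewrite -subr_eq0 -rmorphB tofrac_eq0 subr_eq0; exact/eqP.
(* Distinct and nonzero, yet all zero at X = 0, where [Rdiag] and [wA] take the value 1 and hence
   are nonzero polynomials. *)
pose us := [seq 'X^(k.+1) : {poly R} | k <- iota 0 n].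
have us0 : map (horner_eval 0) us = nseq n 0.
  rewrite -map_comp; apply: (@eq_from_nth _ 0); rewrite ?size_map ?size_nseq ?size_iota // => i lt_i.
  rewrite (nth_map 0%N) ?size_iota // nth_nseq lt_i /= horner_evalE hornerXn.
  by rewrite expr0n.
have nz1 (p : {poly R}) : p.[0] = 1 -> p != 0.
  by move=> p0; apply/eqP => pz; move/eqP: p0; rewrite pz horner0 eq_sym oner_eq0.
have usX u : u \in us -> u.[0] = 0.
  by case/mapP => k _ ->; rewrite hornerXn expr0n.
have IK := @izergin_korepin _ (f x%:P) (f y%:P) n (map f us) (map f (map polyC vs)).
have {IK} IK : f (Z6v x%:P y%:P (map polyC vs) us * Vdm (map polyC vs) *
     \prod_(v <- map polyC vs) qv x%:P y%:P v) =
   f (\det (IKmx x%:P y%:P n us (map polyC vs))).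
  rewrite !rmorphM rmorph_Z6v rmorph_Vdm rmorph_prod.
  have -> : f (\det (IKmx x%:P y%:P n us [seq i%:P | i <- vs])) =
      \det (IKmx (f x%:P) (f y%:P) n (map f us) (map f (map polyC vs))).
    rewrite -det_map_mx; congr (\det _); apply/matrixP => i j; rewrite !mxE.
    by rewrite rmorph_Ebez [in RHS](nth_map 0) ?size_map ?szvs.
  rewrite -IK ?size_map ?size_iota //; last 6 first.
  - move=> _ _ /mapP[u hu ->] /mapP[w hw ->].
    suff : f (Rdiag x%:P y%:P u w) != 0.
      by rewrite !(rmorphB, rmorphD, rmorphM, rmorph1).
    rewrite tofrac_eq0; apply: nz1; rewrite /Rdiag !hornerE (usX _ hu) (usX _ hw).
    by rewrite !(mulr0, subr0, addr0, mul0r).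
  - rewrite !map_inj_uniq ?iota_uniq // => i j /(congr1 (size \o polyseq)).
    by rewrite /= !size_polyXn => -[].
  - apply/mapP => -[u hu /eqP]; rewrite eq_sym tofrac_eq0.
    by case/mapP: hu => k _ ->; rewrite -size_poly_eq0 size_polyXn.
  - by rewrite !map_inj_uniq //; exact: polyC_inj.
  - move=> _ /mapP[_ /mapP[v hv ->] ->]; rewrite -!rmorph_qv tofrac_eq0 polyC_eq0.
    exact: hq.
  - move=> _ _ /mapP[u hu ->] /mapP[_ /mapP[v hv ->] ->].
    rewrite -rmorph_wA tofrac_eq0; apply: nz1.
    by rewrite /wA !hornerE (usX _ hu) mul0r subr0.
  congr (_ * _); rewrite [RHS]big_map; apply: eq_bigr => v _.
  by rewrite rmorph_qv.
move/f_inj/(congr1 (horner_eval 0)): IK.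
rewrite 2!rmorphM rmorph_Z6v rmorph_Vdm rmorph_prod map_horner0_polyC us0.
rewrite /= !horner_evalE !hornerC big_map.
rewrite (eq_bigr (qv x y)) => [|v _]; last first.
  by rewrite rmorph_qv /= !horner_evalE !hornerC.
have -> : (\det (IKmx x%:P y%:P n us [seq i%:P | i <- vs])).[0] =
    (\prod_(v <- vs) qv x y v) * rdet n (map (Prow x y n) vs).
  rewrite (big_nth 0) big_mkord szvs -det_row_scale -horner_evalE -det_map_mx.
  congr (\det _); apply/matrixP => i j; rewrite !mxE rmorph_Ebez us0 /=.
  rewrite !horner_evalE !hornerC !(nth_map 0) ?szvs // -Ebez0 //.
  by rewrite hornerC.
rewrite [LHS]mulrC => /mulfI; apply.
by rewrite prodf_seq_neq0; apply/allP => v /hq.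
Qed.

Section HomMorph.
Variables (R S : comNzRingType) (f : {rmorphism R -> S}) (x y : R).
Local Notation mf := (map_poly f).

Lemma map_apoly : mf (apoly y) = apoly (f y).
Proof. by rewrite /apoly rmorphB rmorph1 /= map_polyZ map_polyX. Qed.

Lemma map_bpoly : mf (bpoly x y) = bpoly (f x) (f y).
Proof. by rewrite /bpoly rmorphD rmorph1 /= map_polyZ map_polyX rmorphB. Qed.

Lemma map_Yrow n v : mf (Yrow x y n v) = Yrow (f x) (f y) n (f v).
Proof.
apply/polyP => i; rewrite coef_map !coef_poly.
case: ltnP => _; last exact: rmorph0.
by rewrite /= rmorphM !rmorphXn rmorphD rmorphM !rmorphB rmorph1.
Qed.

Lemma map_Vrow n v : mf (Vrow n v) = Vrow n (f v).
Proof.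
apply/polyP => i; rewrite coef_map !coef_poly.
by case: ltnP => _; [exact: rmorphXn | exact: rmorph0].
Qed.

Lemma map_Prow n v : mf (Prow x y n v) = Prow (f x) (f y) n (f v).
Proof. by rewrite rmorphM /= map_Yrow map_Vrow. Qed.

Lemma map_kappa N j : mf (kappa x y N j) = kappa (f x) (f y) N j.
Proof.
by rewrite rmorphM rmorphB !rmorphXn rmorphM /= map_apoly map_bpoly map_polyX.
Qed.

Lemma map_grow N : mf (grow x y N) = grow (f x) (f y) N.
Proof. by rewrite rmorphM rmorphB rmorphXn rmorphM /= map_apoly map_bpoly map_polyX. Qed.
End HomMorph.

Lemma sum_ord_split (V : nmodType) N k (h : nat -> V) : (k < N)%N ->
  \sum_(i < N) h i =
  \sum_(i < k) h i + (h k + \sum_(i < N - k.+1) h (k.+1 + i)%N).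
Proof.
move=> lt_kN; rewrite -!(big_mkord predT) (big_cat_nat (n := k)) ?(ltnW lt_kN) //=.
rewrite [X in _ + X]big_ltn //; congr (_ + (_ + _)).
rewrite -[k.+1 in LHS]add0n big_addn big_mkord.
by apply: eq_bigr => i _; rewrite addnC.
Qed.

Lemma geometric_sum_split (R : comNzRingType) (V : lmodType R) N k (c a : R)
    (h : nat -> V) r : (k < N)%N ->
  \sum_(j < N) (c * a ^+ j) *: h j + a ^+ N *: r =
  \sum_(j < k) (c * a ^+ j) *: h j + a ^+ k *: (c *: h k + a *:
   (\sum_(i < N - k.+1) (c * a ^+ i) *: h (k.+1 + i)%N + a ^+ (N - k.+1) *: r)).
Proof.
move=> lt_kN; rewrite (sum_ord_split (fun j => (c * a ^+ j) *: h j) lt_kN) -!addrA.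
congr (_ + _); rewrite !scalerDr !scalerA [c * _]mulrC; congr (_ + (_ + _)).
  rewrite scaler_sumr; apply: eq_bigr => i _.
  by rewrite scalerA exprD !exprS; congr (_ *: _); ring.
by rewrite -exprSr -exprD subnKC.
Qed.

(** Each step sends one row parameter to 0. With this parameter an indeterminate X, its row loses
    the multiples of [kappa] 0 to k - 1, which are already rows, and what remains is divisible by
    X^k. After cancellation, X = 0 leaves [kappa] k. The powers of v1 and of the w's are the
    Vandermonde factors between these parameters and the k zeros. *)
Lemma Z6v_homogeneous_rows N k (R : idomainType) (x y v1 : R) ws :
  (k <= N)%N -> size ws = (N.+1 - k)%N ->
  {in v1 :: ws, forall v, qv x y v != 0} ->
  Z6v x y (v1 :: nseq k 0 ++ ws) (nseq N.+2 0) *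
    ((- v1) ^+ k * (\prod_(w <- ws) w ^+ k) * Vdm (v1 :: ws)) =
  rdet N.+2 (grow x y N * Prow x y N.+2 v1 :: mkseq (kappa x y N) k ++
             [seq grow x y N * Prow x y N.+2 w | w <- ws]).
Proof.
elim: k R x y v1 ws => [|k IH] R x y v1 ws le_kN szws hq.
  rewrite expr0 mul1r big1 // mul1r [nseq 0 0 ++ ws]/= Z6v_homogeneous_columns //;
    last by rewrite /= szws subn0.
  rewrite [mkseq _ _ ++ _]/=.
  have -> : grow x y N * Prow x y N.+2 v1 :: [seq grow x y N * Prow x y N.+2 w | w <- ws] =
     [seq grow x y N * r | r <- map (Prow x y N.+2) (v1 :: ws)].
    by rewrite /= -map_comp.
  rewrite rdet_mull coef0M.
  have a00 : (apoly y)`_0 = 1 by rewrite /apoly !coefE /= mulr0 subr0.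
  have -> : (apoly y ^+ N)`_0 = 1.
    by rewrite -horner_coef0 horner_exp horner_coef0 a00 expr1n.
  rewrite coefB coefXM /bpoly !coefE /= mulr0 addr0 subr0.
  by rewrite !mul1r expr1n mul1r.
pose X : {poly R} := 'X; pose wX := X :: map polyC ws.
have hqX : {in v1%:P :: wX, forall v, qv x%:P y%:P v != 0}.
  have qC v : v \in v1 :: ws -> qv x%:P y%:P v%:P != 0.
    by move=> hv; rewrite -rmorph_qv polyC_eq0 hq.
  move=> v; rewrite !inE => /or3P[/eqP->|/eqP->|/mapP[w hw ->]].
  - by apply: qC; rewrite mem_head.
  - apply/eqP => /(congr1 (fun p : {poly R} => p`_2)).
    have -> : qv x%:P y%:P X = 'X^2 - (1 + y - x) *: 'X + y%:P.
      by rewrite -mul_polyC !(polyCB, polyCD) /qv /X; ring.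
    rewrite !coefE /= mulr0 subr0 addr0 => /eqP; by rewrite oner_eq0.
  - by apply: qC; rewrite inE hw orbT.
have szwX : size wX = (N.+1 - k)%N by rewrite /= size_map szws; lia.
have := IH _ x%:P y%:P v1%:P wX (ltnW le_kN) szwX hqX.
set K := mkseq _ _; set g := grow _ _ _.
set r1 := g * Prow _ _ _ _.
pose r2 := [seq g * Prow x%:P y%:P N.+2 w | w <- map polyC ws].
have -> : [seq g * Prow x%:P y%:P N.+2 w | w <- wX] =
  g * Prow x%:P y%:P N.+2 X :: r2 by [].
have szr : (size (r1 :: K) < N.+2)%N by rewrite /= size_mkseq; lia.
have X1 : X != 1.
  apply/eqP => /(congr1 (fun p : {poly R} => p`_1)).
  by rewrite !coefE /= => /eqP; rewrite oner_eq0.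
pose c : {poly R} := (1 - X) ^+ N.+2.
pose kp := kappa x%:P y%:P N.
pose E1 := \sum_(i < N - k.+1) (c * X ^+ i) *: kp (k.+1 + i)%N.
pose E2 := c *: kp k + X *: (E1 + X ^+ (N - k.+1) *: rhorow x%:P y%:P N X).
(* [E2] is the row of X after removal of the [kappa] rows already present and division by X^k. *)
have -> : rdet N.+2 (r1 :: K ++ g * Prow x%:P y%:P N.+2 X :: r2) =
    X ^+ k * rdet N.+2 ((r1 :: K) ++ E2 :: r2).
  have -> : X ^+ k * rdet N.+2 ((r1 :: K) ++ E2 :: r2) =
      rdet N.+2 ((r1 :: K) ++ (X ^+ k *: E2 + 0) :: r2).
    by rewrite [RHS]rdet_lin // rdet0 // addr0.
  rewrite addr0 -(@rdet_add_sum _ _ _ _ _ k (fun i => c * X ^+ i) kp); last 2 first.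
  - by rewrite size_cat /= size_mkseq !size_map szws; lia.
  - by move=> i lt_ik; rewrite mem_cat inE map_f ?orbT // mem_iota.
  apply: eq_rdet => i _; rewrite -cat_cons !nth_cat; case: ltnP => // _.
  case: (i - _)%N => [|m] //=.
  move=> j lt_j; rewrite (grow_Prow x%:P y%:P X1) //; congr (_`_j).
  congr (polyseq _); exact: (geometric_sum_split c X kp _ le_kN).
move=> e; have {}e : Z6v x%:P y%:P (v1%:P :: nseq k 0 ++ wX) (nseq N.+2 0) *
    ((- v1%:P) ^+ k * (\prod_(w <- map polyC ws) w ^+ k) * Vdm (v1%:P :: wX)) =
    rdet N.+2 ((r1 :: K) ++ E2 :: r2).
  apply: (@mulfI _ (X ^+ k)); first by rewrite expf_neq0 // polyX_eq0.
  by rewrite -e big_cons; ring.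
move/(congr1 (horner_eval 0)): e; rewrite 3!rmorphM rmorph_Z6v rmorph_Vdm.
have fC a : horner_eval 0 a%:P = a by rewrite horner_evalE hornerC.
have fX : horner_eval 0 X = 0 by rewrite horner_evalE hornerX.
rewrite rmorph_rdet map_cat.
have -> : map (horner_eval 0) (nseq N.+2 0) = nseq N.+2 (0 : R).
  by rewrite map_nseq horner_evalE horner0.
have -> : map (horner_eval 0) (v1%:P :: nseq k 0 ++ wX) = v1 :: nseq k.+1 0 ++ ws.
  rewrite /= map_cat fC map_nseq horner_evalE horner0 /= map_horner0_polyC fX.
  by rewrite -cat_rcons -[0 :: nseq k 0 ++ ws]/(nseq k.+1 0 ++ ws) -(addn1 k) nseqD cats1.
have -> : map (horner_eval 0) (v1%:P :: wX) = v1 :: 0 :: ws.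
  by rewrite /= map_horner0_polyC fX fC.
have r1E : map_poly (horner_eval 0) r1 = grow x y N * Prow x y N.+2 v1.
  by rewrite /r1 rmorphM /= map_grow map_Prow /= !fC.
have KE : map (map_poly (horner_eval 0)) (r1 :: K) =
    grow x y N * Prow x y N.+2 v1 :: mkseq (kappa x y N) k.
  rewrite map_cons r1E /K -map_comp; congr (_ :: _); apply: eq_map => i /=.
  by rewrite map_kappa /= !fC.
have r2E : map (map_poly (horner_eval 0)) r2 =
    [seq grow x y N * Prow x y N.+2 w | w <- ws].
  rewrite /r2 -!map_comp; apply: eq_map => w /=.
  by rewrite rmorphM /= map_grow map_Prow /= !fC.
have E2E : map_poly (horner_eval 0) E2 = kappa x y N k.
  rewrite /E2 rmorphD /= !map_polyZ /= fX scale0r addr0 /kp map_kappa /= !fC.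
  by rewrite /c horner_evalE /X !hornerE subr0 expr1n scale1r.
rewrite KE [map _ (E2 :: r2)]map_cons E2E r2E mkseqS cat_rcons cat_cons => <-.
rewrite rmorphXn rmorphN rmorph_prod big_map /= !fC.
rewrite [X in _ * (_ * X * _)](eq_bigr (fun w => w ^+ k)) => [|w _]; last first.
  by rewrite rmorphXn /= fC.
rewrite /= big_cons sub0r.
have -> : \prod_(w <- ws) (w - 0) = \prod_(w <- ws) w.
  by apply: eq_bigr => w _; rewrite subr0.
have -> : \prod_(w <- ws) w ^+ k.+1 = (\prod_(w <- ws) w) * \prod_(w <- ws) w ^+ k.
  by rewrite -big_split; apply: eq_bigr => w _; rewrite exprS.
by rewrite exprS; ring.
Qed.

(** * The six-vertex determinant with two free row parameters *)

Section SixVertexDet.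
Variables (F : fieldType) (x y : F) (N : nat).
Implicit Types (v z : F).

(** This is (a - v b) / (1 - v) for z = 1 / (1 - v), the denominator of [Yrow] normalised to
    constant term 1. *)
Definition dpoly z : {poly F} := 1 + (x - y - z * x) *: 'X.

Definition dpp_rows z1 z2 : seq {poly F} :=
  bpoly x y ^+ N.+2 ::
  mkseq (fun j => - (dpoly z1 * dpoly z2 * kappa x y N j)) N ++
  [:: 'X^(N.+1) - z2 *: (bpoly x y ^+ N.+1 * dpoly z1)].

Lemma dpoly0 z : (dpoly z)`_0 = 1.
Proof. by rewrite /dpoly !coefE /= mulr0 addr0. Qed.

Lemma eqX_XnSM (p : {poly F}) n : p`_0 = 1 -> eqX n.+1 (p * 'X^n) 'X^n.
Proof.
move=> p0 j; rewrite ltnS leq_eqVlt => /orP[/eqP->|lt_jn]; rewrite coefMXn coefXn.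
  by rewrite ltnn subnn p0 eqxx.
by rewrite lt_jn ltn_eqF.
Qed.

Lemma dpoly_Yrow v z : v != 1 -> z = (1 - v)^-1 ->
  eqX N.+2 (dpoly z * Yrow x y N.+2 v) ((1 - v) ^+ N.+1)%:P.
Proof.
move=> v1 zE; have v1' : 1 - v != 0 by rewrite subr_eq0 eq_sym.
apply: (@eqX_mulI _ _ (1 - v)%:P); first by rewrite coefC.
have -> : (1 - v)%:P * (dpoly z * Yrow x y N.+2 v) =
    (apoly y - v *: bpoly x y) * Yrow x y N.+2 v.
  rewrite mulrA; congr (_ * _).
  have dE : x - y - z * x = - (y + (x - y) * v) / (1 - v) by rewrite zE; field.
  rewrite /apoly /bpoly /dpoly dE mul_polyC scalerDr scalerA mulrCA divff // mulr1.
  rewrite -!mul_polyC !(polyCB, polyCD, polyCM, polyCN); ring.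
apply: (@eqXD _ _ _ _ (- ((y + (x - y) * v) ^+ N.+2)%:P) N.+2) => //.
by rewrite YrowE -polyCM -exprS; ring.
Qed.

(** The rows of v1 and v2 reduce to v^N times [rhorow]. Multiplying every row by
    [dpoly z1 * dpoly z2] does not change the determinant and clears both denominators. *)
Lemma six_vertex_dpp_rows v1 v2 z1 z2 :
  v1 != 0 -> v2 != 0 -> v1 != v2 -> v1 != 1 -> v2 != 1 ->
  z1 = (1 - v1)^-1 -> z2 = (1 - v2)^-1 ->
  qv x y v1 != 0 -> qv x y v2 != 0 ->
  Z6v x y (v1 :: nseq N 0 ++ [:: v2]) (nseq N.+2 0) =
  ((1 - v1) * (1 - v2)) ^+ N.+1 * rdet N.+2 (dpp_rows z1 z2).
Proof.
move=> v10 v20 v12 v11 v21 z1E z2E q1 q2.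
have w1 : 1 - v1 != 0 by rewrite subr_eq0 eq_sym.
have w2 : 1 - v2 != 0 by rewrite subr_eq0 eq_sym.
have hq : {in [:: v1; v2], forall v, qv x y v != 0}.
  by move=> v; rewrite !inE => /orP[] /eqP ->.
have := Z6v_homogeneous_rows (leqnn N) (esym (subSnn N) : size [:: v2] = _) hq.
rewrite !big_cons !big_nil !mulr1 /= big_cons !big_nil !mulr1.
set g := grow x y N; set K := mkseq _ _.
have szK : size K = N by rewrite size_mkseq.
have -> : rdet N.+2 (g * Prow x y N.+2 v1 :: K ++ [:: g * Prow x y N.+2 v2]) =
    v1 ^+ N * v2 ^+ N * rdet N.+2 (rhorow x y N v1 :: K ++ [:: rhorow x y N v2]).
  have KK i s : (i < N)%N -> kappa x y N i \in K ++ s.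
    by move=> lt_i; rewrite mem_cat map_f // mem_iota.
  transitivity (rdet N.+2 (([::] ++ (\sum_(i < N) ((1 - v1) ^+ N.+2 * v1 ^+ i) *: kappa x y N i
     + (v1 ^+ N *: rhorow x y N v1 + 0)) :: (K ++ [:: g * Prow x y N.+2 v2])))).
    apply: eq_rdet => -[|i] // _ j lt_j.
    by rewrite addr0 /=; apply: (grow_Prow x y v11).
  rewrite (@rdet_add_sum _ _ _ _ _ _ (fun i => (1 - v1) ^+ N.+2 * v1 ^+ i)); last 2 first.
  - by rewrite /= size_cat szK addn1.
  - by move=> i lt_i; rewrite cat0s KK.
  rewrite rdet_lin // rdet0 // addr0 -mulrA; congr (_ * _).
  rewrite cat0s -cat_cons.
  transitivity (rdet N.+2 (((rhorow x y N v1 :: K) ++ (\sum_(i < N)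
     ((1 - v2) ^+ N.+2 * v2 ^+ i) *: kappa x y N i
     + (v2 ^+ N *: rhorow x y N v2 + 0)) :: [::]))).
    apply: eq_rdet => i _ j lt_j; rewrite !nth_cat; case: ltnP => // _.
    case: (i - _)%N => [|[|m]] //=.
    by rewrite addr0; apply: (grow_Prow x y v21).
  have sz1 : (size (rhorow x y N v1 :: K) < N.+2)%N by rewrite /= szK.
  rewrite (@rdet_add_sum _ _ _ _ _ _ (fun i => (1 - v2) ^+ N.+2 * v2 ^+ i)); last 2 first.
  - by rewrite cats0.
  - by move=> i lt_i; rewrite cats0 inE map_f ?orbT // mem_iota.
  by rewrite rdet_lin // rdet0 // addr0 cat_cons.
rewrite -[X in _ = _ * X]mul1r -[X in _ = _ * (X * _)](expr1n _ N.+2).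
have d0 : (dpoly z1 * dpoly z2)`_0 = 1 by rewrite coef0M !dpoly0 mulr1.
rewrite -[X in _ = _ * (X ^+ _ * _)]d0 -rdet_mull.
(* Factors pulled out of the rows; the signs are those with which the rows appear in [dpp_rows]. *)
pose cs := (1 - v1) ^+ N.+2 :: nseq N (-1) ++ [:: - (1 - v2) ^+ N.+2].
pose r1 := z1 *: (bpoly x y ^+ N.+1 * dpoly z2) - 'X^(N.+1).
have -> : rdet N.+2 [seq dpoly z1 * dpoly z2 * r | r <- rhorow x y N v1 :: K ++ [:: rhorow x y N v2]] =
   (\prod_(i < N.+2) cs`_i) * rdet N.+2 ([::] ++ r1 :: behead (dpp_rows z1 z2)).
  apply: rdet_scale => i lt_i.
  have rhoE v z z' : v != 1 -> z = (1 - v)^-1 ->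
    eqX N.+2 (dpoly z * dpoly z' * rhorow x y N v) ((1 - v) ^+ N.+2 *:
      (z *: (bpoly x y ^+ N.+1 * dpoly z') - 'X^(N.+1))).
    move=> hv hz j lt_j; rewrite /rhorow.
    have -> : dpoly z * dpoly z' * (bpoly x y ^+ N.+1 * Yrow x y N.+2 v -
        (1 - v) ^+ N.+2 *: 'X^(N.+1)) = (dpoly z' * bpoly x y ^+ N.+1) *
        (dpoly z * Yrow x y N.+2 v) - (1 - v) ^+ N.+2 *: (dpoly z * dpoly z' * 'X^(N.+1)).
      by rewrite -!mul_polyC; ring.
    rewrite coefB [in LHS]coefZ eqX_XnSM //; last by rewrite coef0M !dpoly0 mulr1.
    rewrite (eqX_mull _ (dpoly_Yrow hv hz)) // coefMC coefZ coefB coefZ mulrBr.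
    congr (_ - _); rewrite [dpoly z' * _]mulrC [LHS]mulrC mulrA; congr (_ * _).
    by rewrite hz [in RHS]exprSr mulfK // subr_eq0 eq_sym.
  case: i lt_i => [|i] lt_i.
    exact: rhoE.
  rewrite [cs`_i.+1]/= /= map_cat !nth_cat size_nseq size_mkseq size_map szK.
  case: ltnP => [lt_iN|le_Ni].
    rewrite nth_nseq lt_iN nth_mkseq // (nth_map 0) ?szK // nth_mkseq //.
    by rewrite scaleN1r opprK.
  have -> : i = N by apply/eqP; rewrite eqn_leq le_Ni andbT -ltnS.
  rewrite subnn /= => j lt_j.
  rewrite mulrC [dpoly z1 * _]mulrC mulrC (rhoE _ _ _ v21 z2E) // !coefZ mulNr -mulrN.
  by rewrite -coefN opprB.
(* Because z1 d2 - z2 d1 = (z1 - z2) b, adding the last row to the first leaves a multiple of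
   b^(N+2). Its factor z1 - z2 = (v1 - v2) z1 z2 cancels the remaining Vandermonde factor. *)
have -> : r1 = (z1 - z2) *: bpoly x y ^+ N.+2 +
    (-1 *: ('X^(N.+1) - z2 *: (bpoly x y ^+ N.+1 * dpoly z1)) + 0).
  rewrite /r1 !exprS /dpoly /bpoly -!mul_polyC !(polyCN, polyCB, polyCD, polyCM); ring.
rewrite rdet_lin // rdet_addl; last 2 first.
- by rewrite /= size_cat size_mkseq addn1.
- by rewrite /= mem_cat mem_head orbT.
rewrite rdet0 // addr0 [[::] ++ _]/= -/(dpp_rows z1 z2).
have -> : \prod_(i < N.+2) cs`_i = - ((1 - v1) ^+ N.+2 * (-1) ^+ N * (1 - v2) ^+ N.+2).
  have szcs : size cs = N.+2 by rewrite /= size_cat size_nseq addn1.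
  rewrite -(big_mkord predT (fun i => cs`_i)) -[X in \prod_(_ <= _ < X) _]szcs.
  rewrite -(big_nth 0 predT id).
  rewrite /cs big_cons big_cat /= big_seq1.
  have -> : \prod_(i <- nseq N (-1 : F)) i = (-1) ^+ N.
    by elim: (N) => [|k IH] /=; rewrite ?big_nil // big_cons IH exprS.
  by rewrite /=; ring.
move=> e; apply: (@mulfI _ ((- v1) ^+ N * v2 ^+ N * (v2 - v1))).
  by rewrite !mulf_neq0 ?expf_neq0 ?oppr_eq0 // subr_eq0 eq_sym.
rewrite [LHS]mulrC e (exprNn v1) z1E z2E !exprMn !exprS.
by field; rewrite w1 w2.
Qed.
End SixVertexDet.

(** * Alternating sign matrices as six-vertex states *)

(** Converse of [asm_prefix]: ASM lines are the sequences of total 1 with partial sums in {0, 1},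
    which is what the edges of the model record. *)
Lemma asm_line_prefix (s : seq int) :
  (forall k, 0 <= \sum_(a <- take k s) a <= 1) -> \sum_(a <- s) a = 1 ->
  asm_line s.
Proof.
move=> pre sum1; rewrite /asm_line sum1 eqxx andbT.
(* [c] is the sum of the entries already read. It determines the sign of the last nonzero one, with
   a virtual -1 before the first entry. *)
have H (c : bool) (t : seq int) :
    (forall k, 0 <= (c : nat)%:Z + \sum_(a <- take k t) a <= 1) ->
    all [in sign_values] t &&
    path (fun a b => a * b < 0) (if c then 1 else -1) [seq a <- t | a != 0].
  elim: t c => [|a t IH] c //= ct.
  have ct' k : 0 <= (c : nat)%:Z + a + \sum_(a <- take k t) a <= 1.
    by have := ct k.+1; rewrite /= big_cons addrA.
  have := ct' 0%N; rewrite take0 big_nil addr0.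
  case: c ct ct' => /= _ ct' ha.
    have [a0|a0] : a = 0 \/ a = -1 by lia.
      by subst a; rewrite /= (IH true) // => k; have := ct' k; rewrite addr0.
    have /andP[h1 h2] : all [in sign_values] t &&
        path (fun a b => a * b < 0) (-1) [seq a <- t | a != 0].
      by apply: (IH false) => k; have := ct' k; rewrite a0 /= subrr.
    rewrite a0 /= h1; exact: h2.
  have [a0|a0] : a = 0 \/ a = 1 by lia.
    by subst a; rewrite /= (IH false) // => k; have := ct' k; rewrite addr0.
  have /andP[h1 h2] : all [in sign_values] t &&
      path (fun a b => a * b < 0) 1 [seq a <- t | a != 0].
    by apply: (IH true) => k; have := ct' k; rewrite a0 /= add0r.
  rewrite a0 /= h1; exact: h2.
have /andP[-> hp] : all [in sign_values] s &&
    path (fun a b => a * b < 0) (-1) [seq a <- s | a != 0].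
  by apply: (H false) => k; rewrite add0r.
by rewrite /=; apply: path_sorted hp.
Qed.

Fixpoint cols (n m : nat) : seq (seq bitseq) :=
  if m is m'.+1 then [seq ks :: L | ks <- bits n, L <- cols n m'] else [:: [::]].

Lemma bits_uniq n : uniq (bits n).
Proof.
elim: n => //= n IH; rewrite cats0 cat_uniq !map_inj_uniq ?IH; try by move=> ? ? [].
by rewrite andbT /=; apply/hasPn => _ /mapP[s _ ->]; apply/mapP => -[].
Qed.

Lemma colsP n m L : (L \in cols n m) = (size L == m) && all (fun s => size s == n) L.
Proof.
elim: m L => [|m IH] [|s L] //=.
  by apply/negbTE/allpairsPdep => -[? [? []]].
rewrite eqSS; apply/allpairsPdep/idP => [[ks [L' [hk hL [-> ->]]]]|].
  by move: hL; rewrite IH -bitsP hk => /andP[-> ->].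
by case/and3P => szL hs hL; exists s, L; rewrite bitsP hs IH szL hL.
Qed.

Lemma cols_uniq n m : uniq (cols n m).
Proof.
elim: m => //= m IH; apply: allpairs_uniq_dep => //; first exact: bits_uniq.
by case=> [a b] [c d] /= _ _ [-> ->].
Qed.

Section Expand.
Variables (R : comNzRingType) (x y : R).
Implicit Types (u v : R) (us vs : seq R) (t : bool) (hs ks : bitseq).

Fixpoint tb t hs ks i {struct i} : bool :=
  if i is i'.+1 then
    if (hs, ks) is (h :: hs', k :: ks') then tb (t (+) h (+) k) hs' ks' i' else t
  else t.

Lemma tbS t hs ks i : (i < size hs)%N -> size hs = size ks ->
  tb t hs ks i.+1 = tb t hs ks i (+) nth false hs i (+) nth false ks i.
Proof.
elim: i t hs ks => [|i IH] t [|h hs] [|k ks] //= lt_i [sz].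
by rewrite -(IH _ hs ks).
Qed.

Lemma colw_prod u vs t hs ks : size hs = size vs -> size ks = size vs ->
  colw x y u vs t hs ks =
  (\prod_(i < size vs) wt x y u vs`_i (tb t hs ks i) (nth false hs i) (nth false ks i))
  * (tb t hs ks (size vs) : nat)%:R.
Proof.
elim: vs t hs ks => [|v vs IH] t [|h hs] [|k ks] //=; first by rewrite big_ord0 mul1r.
by move=> [sz1] [sz2]; rewrite big_ord_recl /= IH // mulrA.
Qed.

Definition left_col hs (L : seq bitseq) j := nth [::] (hs :: L) j.

Lemma Zv_cols vs us hs : size hs = size vs ->
  Zv x y vs us hs = \sum_(L <- cols (size vs) (size us))
    (\prod_(j < size us) colw x y us`_j vs false (left_col hs L j) (nth [::] L j)) *
    (all id (last hs L))%:R.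
Proof.
elim: us hs => [|u us IH] hs szh; first by rewrite /= big_seq1 big_ord0 mul1r.
rewrite /= big_allpairs_dep; apply: eq_big_seq => ks; rewrite bitsP => /eqP szk.
rewrite IH // mulr_sumr; apply: eq_bigr => L _.
by rewrite big_ord_recl mulrA.
Qed.
End Expand.

Section Code.
Variable n : nat.
Implicit Types (A : 'M[int]_n) (L : seq bitseq).

Definition hb L (i j : nat) : bool :=
  nth false (left_col (nseq n false) L j) i.

Definition mat_of L : 'M[int]_n :=
  \matrix_(i, j) ((hb L i j.+1 : nat)%:Z - (hb L i j : nat)%:Z).

Definition rowpre A (i : 'I_n) (k : nat) : int := \sum_(j < n | (j < k)%N) A i j.
Definition colpre A (j : 'I_n) (k : nat) : int := \sum_(i < n | (i < k)%N) A i j.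

Definition code A : seq bitseq :=
  [seq [seq rowpre A i j.+1 == 1 | i <- enum 'I_n] | j : 'I_n <- enum 'I_n].

Lemma sum_ltS (h : 'I_n -> int) (j : 'I_n) :
  \sum_(i < n | (i < j.+1)%N) h i = \sum_(i < n | (i < j)%N) h i + h j.
Proof.
rewrite (bigD1 j) //= addrC; congr (_ + _); apply: eq_bigl => i.
by rewrite ltnS -val_eqE /= ltn_neqAle andbC.
Qed.

Lemma sum_lt_all (h : 'I_n -> int) k : (n <= k)%N ->
  \sum_(i < n | (i < k)%N) h i = \sum_i h i.
Proof. by move=> le_nk; apply: eq_bigl => i; rewrite (leq_trans _ le_nk). Qed.

Lemma sum_lt0 (h : 'I_n -> int) : \sum_(i < n | (i < 0)%N) h i = 0.
Proof. by apply: big1. Qed.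

Lemma is_asmP A :
  reflect [/\ forall i k, 0 <= rowpre A i k <= 1,
              forall j k, 0 <= colpre A j k <= 1,
              forall i, rowpre A i n = 1 & forall j, colpre A j n = 1]
          (is_asm A).
Proof.
have line (h : 'I_n -> int) : reflect
   ((forall k, 0 <= \sum_(i < n | (i < k)%N) h i <= 1) /\
    \sum_(i < n | (i < n)%N) h i = 1) (asm_line [seq h i | i <- enum 'I_n]).
  apply: (iffP idP) => [hl|[pre s1]].
    split=> [k|]; first by rewrite -sum_take_ord; apply: asm_prefix.
    have /and3P[_ _ /eqP <-] := hl.
    by rewrite -sum_take_ord take_oversize // size_map size_enum_ord.
  apply: asm_line_prefix => [k|]; first by rewrite sum_take_ord.
  by rewrite -s1 -sum_take_ord take_oversize // size_map size_enum_ord.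
apply: (iffP andP) => [[/forallP hr /forallP hc]|[hr hc hr1 hc1]].
  by split=> i; [have /line[h _] := hr i|have /line[h _] := hc i|
    have /line[_ h] := hr i|have /line[_ h] := hc i].
split; apply/forallP => i; apply/(line (_ : 'I_n -> int)).
  by split; [exact: hr | exact: hr1].
by split; [exact: hc | exact: hc1].
Qed.

Lemma hb0 L i : hb L i 0 = false.
Proof. by rewrite /hb /left_col /= nth_nseq; case: ifP. Qed.

Lemma hb_code A (i j : 'I_n) : hb (code A) i j.+1 = (rowpre A i j.+1 == 1).
Proof.
rewrite /hb /left_col /= /code (nth_map j) ?size_enum_ord // (nth_map i) ?size_enum_ord //.
by rewrite !nth_ord_enum.
Qed.

Lemma rowpreS A (i j : 'I_n) : rowpre A i j.+1 = rowpre A i j + A i j.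
Proof. exact: sum_ltS. Qed.

Lemma colpreS A (j i : 'I_n) : colpre A j i.+1 = colpre A j i + A i j.
Proof. exact: sum_ltS. Qed.

Lemma rowpre_mat_of L (i : 'I_n) k : (k <= n)%N ->
  rowpre (mat_of L) i k = (hb L i k : nat)%:Z.
Proof.
elim: k => [|k IH] lt_k; first by rewrite hb0 /rowpre sum_lt0.
by rewrite (rowpreS _ i (Ordinal lt_k)) /= IH ?(ltnW lt_k) // mxE /=; lia.
Qed.

Lemma hb_codeZ A (i : 'I_n) k : is_asm A -> (k <= n)%N ->
  (hb (code A) i k : nat)%:Z = rowpre A i k.
Proof.
move=> /is_asmP[hr _ _ _]; case: k => [|k] lt_k.
  by rewrite hb0 /rowpre sum_lt0.
rewrite (hb_code A i (Ordinal lt_k)) /=; have := hr i k.+1.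
by case: eqP => /= [->|]; lia.
Qed.

Lemma codeK A : is_asm A -> mat_of (code A) = A.
Proof.
move=> hA; apply/matrixP => i j; rewrite mxE !hb_codeZ //; last exact: ltnW.
by rewrite rowpreS; lia.
Qed.

Lemma mat_ofK L : L \in cols n n -> code (mat_of L) = L.
Proof.
rewrite colsP => /andP[/eqP szL /allP szs].
apply: (@eq_from_nth _ [::]) => [|j]; rewrite size_map size_enum_ord ?szL // => lt_j.
have szj : size (nth [::] L j) = n by apply/eqP/szs/mem_nth; rewrite szL.
apply: (@eq_from_nth _ false) => [|i].
  rewrite (nth_map (Ordinal lt_j)) ?size_enum_ord // size_map size_enum_ord.
  by rewrite szj.
rewrite (nth_map (Ordinal lt_j)) ?size_enum_ord // size_map size_enum_ord => lt_i.
rewrite (nth_map (Ordinal lt_i)) ?size_enum_ord //.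
rewrite (nth_ord_enum (Ordinal lt_j) (Ordinal lt_j)).
rewrite (nth_ord_enum (Ordinal lt_i) (Ordinal lt_i)).
by rewrite rowpre_mat_of // /hb /left_col /=; case: nth.
Qed.

Lemma code_cols A : code A \in cols n n.
Proof.
rewrite colsP size_map size_enum_ord eqxx /=; apply/allP => _ /mapP[j _ ->].
by rewrite size_map size_enum_ord.
Qed.

Definition tbL L (i j : nat) : bool :=
  tb false (left_col (nseq n false) L j) (nth [::] L j) i.

Lemma tbLS L i j : L \in cols n n -> (i < n)%N -> (j < n)%N ->
  tbL L i.+1 j = tbL L i j (+) hb L i j (+) hb L i j.+1.
Proof.
rewrite colsP => /andP[/eqP szL /allP szs] lt_i lt_j.
have szk k : (k < n)%N -> size (nth [::] L k) = n.
  by move=> lt_k; apply/eqP/szs/mem_nth; rewrite szL.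
have szl : size (left_col (nseq n false) L j) = n.
  by case: j lt_j => [|j] lt_j; rewrite /left_col /= ?size_nseq // szk // ltnW.
by rewrite /tbL tbS ?szl ?szk.
Qed.

(** The two excluded vertices have weight 0; their bottom edge t + k - h would be 2 or -1. *)
Definition okw (t h k : bool) := ~~ [&& t, ~~ h & k] && ~~ [&& ~~ t, h & ~~ k].

Definition okL L : bool :=
  [&& [forall j : 'I_n, [forall i : 'I_n, okw (tbL L i j) (hb L i j) (hb L i j.+1)]],
      [forall j : 'I_n, tbL L n j] & [forall i : 'I_n, hb L i n]].

Lemma colpre_mat_of L (j : 'I_n) k : L \in cols n n -> is_asm (mat_of L) ->
  (k <= n)%N -> colpre (mat_of L) j k = (tbL L k j : nat)%:Z.
Proof.
move=> hL /is_asmP[_ hc _ _]; elim: k => [|k IH] lt_k.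
  by rewrite /colpre sum_lt0.
have := hc j k.+1.
rewrite (colpreS _ j (Ordinal lt_k)) /= IH ?(ltnW lt_k) // mxE /= tbLS //.
by case: (tbL _ _ _); case: (hb _ _ _); case: (hb _ _ _).
Qed.

Lemma okL_asm L : L \in cols n n -> okL L = is_asm (mat_of L).
Proof.
move=> hL; apply/idP/idP => [/and3P[/forallP ok /forallP tn /forallP hn]|].
  have colE (j : 'I_n) k : (k <= n)%N -> colpre (mat_of L) j k = (tbL L k j : nat)%:Z.
    elim: k => [|k IH] lt_k; first by rewrite /colpre sum_lt0.
    rewrite (colpreS _ j (Ordinal lt_k)) /= IH ?(ltnW lt_k) // mxE /= tbLS //.
    have /forallP/(_ (Ordinal lt_k)) := ok j; rewrite /okw /=.
    by case: (tbL _ _ _); case: (hb _ _ _); case: (hb _ _ _).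
  have bnd (f : nat -> int) (b : nat -> bool) : (forall k, (k <= n)%N -> f k = (b k : nat)%:Z) ->
    (forall k, (n <= k)%N -> f k = f n) -> forall k, 0 <= f k <= 1.
    move=> fb fn k; have [le_kn|lt_nk] := leqP k n; first by rewrite fb //; case: (b k).
    by rewrite fn ?(ltnW lt_nk) // fb //; case: (b n).
  apply/is_asmP; split=> [i|j|i|j].
  - apply: (bnd _ (hb L i)) => [k|k le_nk]; first exact: rowpre_mat_of.
    by rewrite /rowpre !sum_lt_all.
  - apply: (bnd _ ((tbL L)^~ j)) => [k|k le_nk]; first exact: colE.
    by rewrite /colpre !sum_lt_all.
  - by rewrite rowpre_mat_of // hn.
  - by rewrite colE // tn.
move=> /[dup] hA /is_asmP[hr hc r1 c1].
have colE (j : 'I_n) k := @colpre_mat_of L j k hL hA.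
apply/and3P; split; apply/forallP => j.
- apply/forallP => i; have := hc j i.+1; rewrite colpreS colE ?(ltnW (ltn_ord i)) //.
  by rewrite mxE /okw; case: (tbL _ _ _); case: (hb _ _ _); case: (hb _ _ _).
- by have := c1 j; rewrite colE //; case: (tbL _ _ _).
- by have := r1 j; rewrite rowpre_mat_of //; case: (hb _ _ _).
Qed.

Lemma colpre_code A (j : 'I_n) k : is_asm A -> (k <= n)%N ->
  colpre A j k = (tbL (code A) k j : nat)%:Z.
Proof.
by move=> hA lt_k; rewrite -{1}(codeK hA) colpre_mat_of ?codeK ?code_cols.
Qed.
End Code.

(** A state whose matrix is not an ASM has a vertex of weight 0 or violates the bottom or right
    boundary condition. The others are exactly the values of [code] on ASMs. *)
Lemma Z6v_asm (R : comNzRingType) (x y : R) vs us n :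
  size vs = n -> size us = n -> 
  Z6v x y vs us = \sum_(A <- ASM n) \prod_(j < n) \prod_(i < n)
    wt x y us`_j vs`_i (tbL n (code A) i j) (hb n (code A) i j) (hb n (code A) i j.+1).
Proof.
move=> szv szu; rewrite /Z6v Zv_cols ?size_nseq // szv szu.
pose W L := \prod_(j < n) \prod_(i < n)
    wt x y us`_j vs`_i (tbL n L i j) (hb n L i j) (hb n L i j.+1).
pose G L := (\prod_(j < n) colw x y us`_j vs false (left_col (nseq n false) L j) (nth [::] L j)) *
    ((all id (last (nseq n false) L) : nat)%:R : R).
have colwE L (j : 'I_n) : L \in cols n n ->
    colw x y us`_j vs false (left_col (nseq n false) L j) (nth [::] L j) =
    (\prod_(i < n) wt x y us`_j vs`_i (tbL n L i j) (hb n L i j) (hb n L i j.+1)) *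
    (tbL n L n j : nat)%:R.
  rewrite colsP => /andP[/eqP szL /allP szs].
  have szk k : (k < n)%N -> size (nth [::] L k) = n.
    by move=> lt_k; apply/eqP/szs/mem_nth; rewrite szL.
  have szl : size (left_col (nseq n false) L j) = n.
    case: j => -[|j] lt_j; rewrite /left_col /= ?size_nseq // szk // ltnW //.
  by rewrite colw_prod ?szl ?szk ?szv // szv.
have lastE L : L \in cols n n -> all id (last (nseq n false) L) = [forall i : 'I_n, hb n L i n].
  rewrite colsP => /andP[/eqP szL /allP szs].
  have szl : size (last (nseq n false) L) = n.
    case: (L) szL szs => [|s L' _ szs] /=; first by rewrite size_nseq.
    by apply/eqP/szs/mem_last.
  move: szl; have -> : last (nseq n false) L = left_col (nseq n false) L n.
    by rewrite /left_col -[last _ _](nth_last [::] (nseq n false :: L)) /= szL.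
  move=> szl; apply/(all_nthP false)/forallP => h i; first by apply: h; rewrite szl.
  by rewrite szl => lt_i; apply: (h (Ordinal lt_i)).
have G0 L : L \in cols n n -> ~~ is_asm (mat_of n L) -> G L = 0.
  move=> hL; rewrite -okL_asm // /okL !negb_and => /or3P[||].
  - case/forallPn => j /forallPn[i nok].
    rewrite /G (bigD1 j) //= colwE // (bigD1 i) //= (_ : wt _ _ _ _ _ _ _ = 0).
      by rewrite !mul0r.
    by move: nok; case: (tbL _ _ _ _); case: (hb _ _ _ _); case: (hb _ _ _ _).
  - case/forallPn => j /negPf tj.
    by rewrite /G (bigD1 j) //= colwE // tj mulr0 !mul0r.
  - by rewrite -lastE // => /negPf nl; rewrite /G nl mulr0.
have G1 L : L \in cols n n -> is_asm (mat_of n L) -> G L = W L.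
  move=> hL; rewrite -okL_asm // => /and3P[_ /forallP tn].
  rewrite -lastE // => hl; rewrite /G hl mulr1; apply: eq_bigr => j _.
  by rewrite colwE // tn mulr1.
rewrite (bigID (fun L => is_asm (mat_of n L))) /= [X in _ + X]big1_seq ?addr0; last first.
  by move=> L /andP[nA hL]; apply: G0.
rewrite -big_filter (perm_big (map (@code n) (ASM n))) /=; last first.
  apply: uniq_perm; first by rewrite filter_uniq // cols_uniq.
    rewrite map_inj_in_uniq ?fset_uniq // => A B; rewrite !in_ASM => hA hB eAB.
    by rewrite -(codeK hA) eAB codeK.
  move=> L; rewrite mem_filter; apply/andP/mapP => [[hA hL]|[A]].
    by exists (mat_of n L); rewrite ?in_ASM // mat_ofK.
  by rewrite in_ASM => hA ->; rewrite codeK ?code_cols.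
rewrite big_map; apply: eq_big_seq => A; rewrite in_ASM => hA.
by rewrite -[LHS]/(G (code A)) G1 ?code_cols ?codeK.
Qed.

Lemma sum_ltn_ord n k : (k <= n)%N -> (\sum_(j < n) (j < k) = k)%N.
Proof.
move=> le_kn; rewrite -big_mkcond /= -[RHS](card_ord k) -sum1_card.
by rewrite (big_ord_widen _ (fun=> 1%N) le_kn).
Qed.

Lemma sum_gtn_ord n (k : 'I_n) : (\sum_(j < n) (k < j) = n.-1 - k)%N.
Proof.
have : (\sum_(j < n) ((j < k.+1) + (k < j)) = n)%N.
  rewrite -[RHS]card_ord -sum1_card; apply: eq_bigr => j _.
  by rewrite ltnS; case: leqP.
by rewrite big_split /= sum_ltn_ord //; have := ltn_ord k; lia.
Qed.

Lemma card_pairs n (P : 'I_n -> 'I_n -> bool) :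
  #|[set p : 'I_n * 'I_n | P p.1 p.2]| = (\sum_i \sum_j P i j)%N.
Proof.
rewrite -sum1_card pair_big /= big_mkcond; apply: eq_bigr => p _.
by rewrite inE; case: (P _ _).
Qed.

Lemma card_row_pairs n (i0 : 'I_n) (P : 'I_n -> bool) :
  #|[set p : 'I_n * 'I_n | (p.1 == i0) && P p.2]| = (\sum_j P j)%N.
Proof.
rewrite (card_pairs (fun i j => (i == i0) && P j)) (bigD1 i0) //= eqxx.
by rewrite [X in (_ + X)%N]big1 ?addn0 // => i /negPf ->; apply: big1.
Qed.

(** * ASM statistics as counts of vertices *)

Section Stat.
Variables (n : nat) (A : 'M[int]_n).
Hypothesis hA : is_asm A.
Let T i j := tbL n (code A) i j.
Let H i j := hb n (code A) i j.

(** Grouping the double sum by i' and j gives a strict column prefix times an inclusive row prefix,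
    both in {0, 1}. *)
Lemma asm_nuE : `|asm_nu A|%N = (\sum_(i < n) \sum_(j < n) (T i j && H i j.+1))%N.
Proof.
suff -> : asm_nu A = ((\sum_(i < n) \sum_(j < n) (T i j && H i j.+1))%N)%:Z by [].
have -> : asm_nu A = \sum_(i < n) \sum_(j < n) colpre A j i * rowpre A i j.+1.
  rewrite /asm_nu (exchange_big_dep predT) //=; apply: eq_bigr => i' _.
  under [RHS]eq_bigr => j _ do rewrite mulr_suml.
  rewrite [RHS]exchange_big /=; apply: eq_bigr => i _.
  under [RHS]eq_bigr => j _ do rewrite mulr_sumr.
  by rewrite [RHS](exchange_big_dep predT) //=.
rewrite (big_morph Posz PoszD erefl); apply: eq_bigr => i _.
rewrite (big_morph Posz PoszD erefl); apply: eq_bigr => j _.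
rewrite -!hb_codeZ // colpre_code ?(ltnW (ltn_ord i)) // -/(T i j) -/(H i j.+1).
by case: (T i j); case: (H i j.+1).
Qed.

Lemma asm_muE : asm_mu A = (\sum_(i < n) \sum_(j < n) (A i j == -1)%R)%N.
Proof. exact: (card_pairs (fun i j => A i j == -1)). Qed.

Lemma nonneg_row (i : 'I_n) : (forall j, 0 <= A i j) ->
  exists k : 'I_n, forall j, A i j = (j == k)%:R.
Proof.
move=> A0; have /is_asmP[_ _ r1 _] := hA.
have s1 : \sum_j A i j = 1 by rewrite -[RHS](r1 i) /rowpre sum_lt_all.
have [k Ak] : exists k, A i k != 0.
  apply/existsP; apply: contraTT isT; rewrite negb_exists => /forallP h.
  suff : \sum_j A i j = 0 by rewrite s1.
  by apply: big1 => j _; apply/eqP; rewrite -[_ == _]negbK h.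
move: s1; rewrite (bigD1 k) //=; set r := \sum_(_ | _) _ => s1.
have r0 : 0 <= r by apply: sumr_ge0.
have Ak1 : A i k = 1 by have := A0 k; lia.
have {}r0 : r = 0 by lia.
exists k => j; case: eqP => [->//|/eqP jk].
by rewrite (psumr_eq0P _ r0) // => l _; apply: A0.
Qed.

Lemma unit_row_rowpre (i k : 'I_n) m : (forall j, A i j = (j == k)%:R) ->
  rowpre A i m = ((k < m)%N : nat)%:Z.
Proof.
move=> Ak; rewrite /rowpre big_mkcond (bigD1 k) //= Ak eqxx big1 => [|j jk].
  by case: ifP.
by rewrite Ak (negPf jk) if_same.
Qed.

Lemma unit_row_hb (i k : 'I_n) m : (forall j, A i j = (j == k)%:R) -> (m <= n)%N ->
  H i m = (k < m)%N.
Proof.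
move=> Ak le_m; have := hb_codeZ i hA le_m; rewrite (unit_row_rowpre _ Ak) -/(H i m).
by case: (H i m); case: (k < m)%N.
Qed.

Lemma unit_row_zero_right (i k : 'I_n) : (forall j, A i j = (j == k)%:R) ->
  forall j, (A i j == 0) && [exists l : 'I_n, (j < l)%N && (A i l == 1)] = (j < k)%N.
Proof.
move=> Ak j; apply/andP/idP => [[_ /existsP[l]]|lt_jk].
  by rewrite Ak; have [->|_] := eqVneq l k; [case/andP | rewrite andbF].
split; first by rewrite Ak -val_eqE /= ltn_eqF.
by apply/existsP; exists k; rewrite lt_jk Ak eqxx.
Qed.

Lemma unit_row_zero_left (i k : 'I_n) : (forall j, A i j = (j == k)%:R) ->
  forall j, (A i j == 0) && [exists l : 'I_n, (l < j)%N && (A i l == 1)] = (k < j)%N.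
Proof.
move=> Ak j; apply/andP/idP => [[_ /existsP[l]]|lt_jk].
  by rewrite Ak; have [->|_] := eqVneq l k; [case/andP | rewrite andbF].
split; first by rewrite Ak -val_eqE /= gtn_eqF.
by apply/existsP; exists k; rewrite lt_jk Ak eqxx.
Qed.

(** At a zero entry this singles out the two vertices of weight [wB]. *)
Definition turnless (i j : nat) : bool := T i j (+) H i j.+1.

Lemma colpre0 (j : 'I_n) : colpre A j 0 = 0.
Proof. exact: sum_lt0. Qed.

(** All top edges are false, so the entries are nonnegative and the row is a unit vector; the
    vertices of weight [wB] are the zeros to the right of the 1. *)
Lemma first_row (i : 'I_n) : i = 0%N :> nat ->
  [/\ forall j, (A i j == -1) = false,
      (asm_rho1 A <= n.-1)%N &
      (\sum_(j < n) ((A i j == 0)%R && turnless i j) = n.-1 - asm_rho1 A)%N].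
Proof.
move=> i0.
have A0 j : 0 <= A i j.
  have /is_asmP[_ hc _ _] := hA; have := hc j i.+1.
  by rewrite colpreS i0 colpre0; lia.
have [k Ak] := nonneg_row A0.
have rho : asm_rho1 A = k.
  rewrite /asm_rho1 -[RHS](sum_ltn_ord (ltnW (ltn_ord k))).
  rewrite -(card_row_pairs i (fun j : 'I_n => (j < k)%N)); apply: eq_card => p.
  rewrite !inE -i0 -val_eqE /=; case: eqP => //= pi.
  have -> : p.1 = i by apply: val_inj.
  exact: unit_row_zero_right.
split=> [j||]; first by rewrite Ak; case: (j == k).
  by rewrite rho; have := ltn_ord k; lia.
rewrite rho -sum_gtn_ord; apply: eq_bigr => j _; congr (nat_of_bool _).
rewrite /turnless (unit_row_hb Ak) // Ak -val_eqE /=.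
have -> : T i j = false.
  by have := colpre_code j hA (ltnW (ltn_ord i)); rewrite i0 colpre0; case: (T i j).
by rewrite addFb ltnS; case: (ltngtP j k).
Qed.

(** All bottom edges are true, so a zero entry has top edge true, and the vertices of weight [wB]
    are the zeros to the left of the 1. *)
Lemma last_row (i : 'I_n) : i.+1 = n ->
  [/\ forall j, (A i j == -1) = false,
      (asm_rho2 A <= n.-1)%N &
      (\sum_(j < n) ((A i j == 0)%R && turnless i j) = n.-1 - asm_rho2 A)%N].
Proof.
move=> i1; have /is_asmP[_ hc _ c1] := hA.
have AE j : A i j = 1 - colpre A j i by have := colpreS A j i; rewrite i1 c1; lia.
have A0 j : 0 <= A i j by rewrite AE; have := hc j i; lia.
have [k Ak] := nonneg_row A0.
have rho : asm_rho2 A = (n.-1 - k)%N.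
  rewrite /asm_rho2 -sum_gtn_ord.
  rewrite -(card_row_pairs i (fun j : 'I_n => (k < j)%N)); apply: eq_card => p.
  rewrite !inE -[X in p.1.+1 == X]i1 eqSS -val_eqE /=; case: eqP => //= pi.
  have -> : p.1 = i by apply: val_inj.
  exact: unit_row_zero_left.
split=> [j||]; first by rewrite Ak; case: (j == k).
  by rewrite rho leq_subr.
have -> : (n.-1 - asm_rho2 A = k)%N by rewrite rho; have := ltn_ord k; lia.
rewrite -[RHS](sum_ltn_ord (ltnW (ltn_ord k))); apply: eq_bigr => j _.
rewrite /turnless (unit_row_hb Ak) //; have := AE j.
rewrite (colpre_code j hA (ltnW (ltn_ord i))) -/(T i j) Ak -val_eqE /= ltnS.
by case: (T i j); case: (ltngtP j k).
Qed.
End Stat.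

Section Weights.
Variables (R : comNzRingType) (x y v1 v2 : R) (N : nat).
Local Notation n := N.+2.

Lemma Z6v_asm_stat :
  Z6v x y (v1 :: nseq N 0 ++ [:: v2]) (nseq n 0) =
  \sum_(A <- ASM n) x ^+ `|asm_nu A|%N * y ^+ asm_mu A *
    (1 - v1) ^+ (n.-1 - asm_rho1 A) * (1 - v2) ^+ (n.-1 - asm_rho2 A).
Proof.
set vs := _ :: _; have szv : size vs = n by rewrite /= size_cat size_nseq addn1.
rewrite (Z6v_asm _ _ szv (size_nseq _ _)); apply: eq_big_seq => A.
rewrite in_ASM => hA; rewrite exchange_big /=.
have wtE (i j : 'I_n) : wt x y (nseq n 0)`_j vs`_i (tbL n (code A) i j)
    (hb n (code A) i j) (hb n (code A) i j.+1) =
    x ^+ (tbL n (code A) i j && hb n (code A) i j.+1) *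
    (qv x y vs`_i ^+ (A i j == -1)%R *
     (1 - vs`_i) ^+ ((A i j == 0)%R && turnless A i j)).
  have -> : (nseq n (0 : R))`_j = 0 by rewrite nth_nseq ltn_ord.
  have : A i j = (hb n (code A) i j.+1 : nat)%:Z - (hb n (code A) i j : nat)%:Z.
    by rewrite -{1}(codeK hA) mxE.
  have := hA; rewrite -{1}(codeK hA) -okL_asm ?code_cols //.
  case/and3P => /forallP/(_ j)/forallP/(_ i) + _ _.
  rewrite /turnless /wt /okw /wA /wB /gu.
  by case: (tbL _ _ _ _); case: (hb _ _ _ j); case: (hb _ _ _ j.+1) => //= _ ->;
    rewrite ?expr0 ?expr1 ?mul0r ?subr0 ?mulr0 ?addr0 ?expr0n ?mulr1 ?mul1r //=; ring.
under eq_bigr => i _ do under eq_bigr => j _ do rewrite wtE.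
under eq_bigr => i _ do rewrite !big_split /= !prodrXr.
rewrite !big_split /= prodrXr -asm_nuE // -!mulrA; congr (_ * _).
have [hi0 rho1 b0] := first_row hA (erefl : (ord0 : 'I_n) = 0%N :> nat).
have [hi1 rho2 b1] := last_row hA (erefl : (ord_max : 'I_n).+1 = n).
have v0 : vs`_0 = v1 by [].
have vmax : vs`_N.+1 = v2 by rewrite /= nth_cat size_nseq ltnn subnn.
have vmid i : (i < N)%N -> vs`_i.+1 = 0.
  by move=> lt_i; rewrite /= nth_cat size_nseq lt_i nth_nseq lt_i.
congr (_ * _).
  rewrite asm_muE -prodrXr; apply: eq_bigr => i _.
  (* In the first and last rows [qv] has exponent 0, so it may be replaced by y there as in the
     other rows. *)
  have zz : (forall j, (A i j == -1) = false) ->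
      qv x y vs`_i ^+ (\sum_(j < n) (A i j == -1)%R) = y ^+ (\sum_(j < n) (A i j == -1)%R).
    by move=> h; rewrite big1 ?expr0 // => j _; rewrite h.
  have [i0|i0] := eqVneq (i : nat) 0%N; first by apply: zz => j; rewrite -(hi0 j); congr (A _ _ == _); apply: val_inj.
  have [i1|i1] := eqVneq (i : nat) N.+1; first by apply: zz => j; rewrite -(hi1 j); congr (A _ _ == _); apply: val_inj.
  case: (i : nat) (ltn_ord i) i0 i1 => // i' lt_i _ ne; rewrite vmid; last first.
    by rewrite !ltnS in lt_i; rewrite ltn_neqAle lt_i andbT.
  by rewrite /qv expr0n mulr0 subr0 add0r.
rewrite big_ord_recl [X in _ * X]big_ord_recr.
have -> : lift ord0 ord_max = ord_max :> 'I_n by apply: val_inj.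
have vmax' : vs`_(ord_max : 'I_n) = v2 := vmax.
rewrite b0 b1 vmax' [X in _ * (X * _)]big1 ?mul1r // => i _.
have -> : vs`_(lift ord0 (widen_ord (leqnSn N) i)) = 0 := vmid i (ltn_ord i).
by rewrite subr0 expr1n.
Qed.
End Weights.

(** * Slices of descending plane partitions *)

Fixpoint hds (lo : nat) (hs : seq nat) : seq (seq nat) :=
  if hs is h :: hs' then
    [seq h' :: hl | h' <- iota (head lo hs').+1 (h - head lo hs'), hl <- hds lo hs']
  else [:: [::]].

Definition rem_last T (s : seq T) := take (size s).-1 s.

Lemma rem_last_rcons T (s : seq T) a : rem_last (rcons s a) = s.
Proof. by rewrite /rem_last size_rcons -cats1 take_size_cat. Qed.

Definition addhd (hl : seq nat) (R : seq (seq nat)) : seq (seq nat) :=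
  [seq p.1 :: p.2 | p <- zip hl R].

(* Left-justified arrays occupying [k] slices, the slice [m = n - k] first.  The
   list [hs] bounds the parts of the first slice from above, each of them being
   greater than the next bound, and [ss] lists the slices at which the rows
   end. *)
Fixpoint arrays n k (hs ss : seq nat) : seq (seq (seq nat)) :=
  if k is k'.+1 then
    if (ss != [::]) && (last 0%N ss == n - k)%N then
      [seq rcons (addhd hl R) [::] | hl <- hds (last 0%N hs) (rem_last hs),
                                    R <- arrays n k' hl (rem_last ss)]
    else [seq addhd hl R | hl <- hds 0 hs, R <- arrays n k' hl ss]
  else [:: [::]].

Lemma hdsP lo hs hl : reflect
  (size hl = size hs /\ forall i, (i < size hs)%N ->
     (nth lo hs i.+1 < nth 0 hl i <= nth 0 hs i)%N)
  (hl \in hds lo hs).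
Proof.
elim: hs hl => [|h hs IH] hl /=.
  by rewrite inE; apply: (iffP eqP) => [->|[/size0nil]].
apply: (iffP allpairsPdep) => [[h' [t [hh' /IH[szt ht] ->]]]|[]].
  split=> [|[|i] lt_i] /=; [by rewrite szt| |exact: ht].
  by rewrite nth0; move: hh'; rewrite mem_iota; lia.
case: hl => [|h' t] //= [szt] ht; exists h', t; split=> //.
  by have := ht 0%N isT; rewrite /= nth0 mem_iota; lia.
by apply/IH; split=> // i lt_i; apply: (ht i.+1).
Qed.

Lemma hds_sorted lo hs hl : hl \in hds lo hs -> sorted geq hl.
Proof.
case/hdsP => sz h; apply/(sortedP 0%N) => i lt_i; rewrite sz in lt_i.
have /andP[h1 _] := h i (ltnW lt_i); have /andP[_ h2] := h i.+1 lt_i.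
by rewrite (set_nth_default 0%N) // in h1; apply/ltnW/(leq_ltn_trans h2).
Qed.

Lemma size_addhd hl D : size hl = size D -> size (addhd hl D) = size D.
Proof. by move=> sz; rewrite size_map size_zip sz minnn. Qed.

Lemma nth_addhd hl D i : size hl = size D ->
  nth [::] (addhd hl D) i =
  if (i < size D)%N then nth 0%N hl i :: nth [::] D i else [::].
Proof.
move=> sz; case: ltnP => [lt_i|le_i]; last by rewrite nth_default ?size_addhd.
by rewrite (nth_map (0%N, [::])) ?size_zip ?sz ?minnn // nth_zip.
Qed.

Lemma addhdK D : all (fun r => 0 < size r)%N D ->
  addhd (map (head 0%N) D) (map behead D) = D.
Proof. by elim: D => [|[|h r] D IH] //= hD; congr (_ :: _); apply: IH. Qed.

(* Once every row of a left-justified array is preceded by its upper bound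
   (the length of the previous row), the five conditions on a DPP that involve
   an order relation take this single form. *)
Definition tight (D : seq (seq nat)) := forall i p,
  (p.+1 < size (nth [::] D i))%N ->
  (nth 0%N (nth [::] D i.+1) p < nth 0%N (nth [::] D i) p.+1 <= nth 0%N (nth [::] D i) p)%N.

Lemma tight_addhd hs D : size hs = size D ->
  (tight (addhd hs D) <->
   (forall i, (i < size D)%N -> (0 < size (nth [::] D i))%N ->
     (nth 0%N hs i.+1 < nth 0%N (nth [::] D i) 0 <= nth 0%N hs i)%N) /\ tight D).
Proof.
move=> sz; have next i p : nth 0%N (nth [::] (addhd hs D) i.+1) p =
    if p is p'.+1 then nth 0%N (nth [::] D i.+1) p' else nth 0%N hs i.+1.
  rewrite nth_addhd //; case: ltnP => [_|le_i]; first by case: p.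
  by case: p => [|p]; rewrite !nth_default // ?sz // nth_default.
split=> [tD|[t0 tD] i p].
  split=> [i lt_i nz|i p lt_p].
    by have := tD i 0%N; rewrite next nth_addhd // lt_i /=; apply.
  have lt_i : (i < size D)%N.
    by rewrite ltnNge; apply/negP => le_i; move: lt_p; rewrite nth_default.
  by have := tD i p.+1; rewrite next nth_addhd // lt_i /=; apply.
rewrite next nth_addhd //; case: ifP => // lt_i.
by case: p => [|p] /=; rewrite ltnS => lt_p; [apply: t0 | apply: tD].
Qed.

Lemma tight_rcons_nil D : tight (rcons D [::]) <-> tight D.
Proof.
have E i : nth [::] (rcons D [::]) i = nth [::] D i.
  rewrite nth_rcons; case: ltngtP => // [lt_i|->]; last by rewrite nth_default.
  by rewrite nth_default // ltnW.
by split=> tD i p; have := tD i p; rewrite !E.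
Qed.

Lemma exit_times n k ss m : (k < n)%N -> m = (n - k.+1)%N ->
  sorted gtn (rcons ss m) -> all (fun s => n - k.+1 <= s < n)%N (rcons ss m) ->
  [/\ all (fun s => m < s)%N ss, sorted gtn ss & all (fun s => n - k <= s < n)%N ss].
Proof.
move=> lt_kn mE sss lss; have gt_m : all (fun s => m < s)%N ss.
  by move: sss; rewrite sorted_pairwise ?pairwise_rcons => [/andP[]|a b c /=]; last by lia.
split=> //; first by move: sss; rewrite -cats1 => /cat_sorted2[].
apply/allP => s hs; have := allP lss s; rewrite mem_rcons inE hs orbT => /(_ isT).
by have := allP gt_m s hs; lia.
Qed.

Lemma no_exit_times n k ss : (k < n)%N ->
  (ss != [::]) && (last 0 ss == n - k.+1)%N = false ->
  sorted gtn ss -> all (fun s => n - k.+1 <= s < n)%N ss ->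
  all (fun s => n - k <= s < n)%N ss.
Proof.
move=> lt_kn noexit sss lss.
apply/allP => s hs'; have /andP[le_s ->] := allP lss s hs'; rewrite andbT.
suff : (n - k.+1 < s)%N by lia.
rewrite ltn_neqAle le_s andbT; apply/eqP => sE.
move: noexit; case/lastP: ss hs' sss lss => // ss m hs' sss lss.
rewrite last_rcons; have /andP[le_m _] : (n - k.+1 <= m < n)%N.
  by apply: (allP lss); rewrite mem_rcons mem_head.
have : (m <= s)%N.
  move: sss; rewrite sorted_pairwise ?pairwise_rcons => [/andP[/allP h _]|a b c /=]; last by lia.
  by move: hs'; rewrite mem_rcons inE => /orP[/eqP->//|/h /ltnW].
by rewrite -sE => le_ms; rewrite eqn_leq le_ms le_m andbT; case: (ss).
Qed.

(** [ss] strictly decreases, so only the last remaining row can end at a given slice. Hence one test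
    on [last] suffices in [arrays]. *)
Lemma arraysP n k hs ss D : (k <= n)%N -> size hs = size ss ->
  sorted gtn ss -> all (fun s => n - k <= s < n)%N ss ->
  (D \in arrays n k hs ss) <->
  [/\ size D = size hs, map (fun r => size r + (n - k))%N D = ss & tight (addhd hs D)].
Proof.
elim: k hs ss D => [|k IH] hs ss D le_kn sz sss lss.
  have ss0 : ss = [::].
    by case: ss lss {sss sz} => //= s ss; rewrite subn0 leqNgt; case: ltnP.
  rewrite ss0 in sz *; rewrite (size0nil sz) /= inE.
  split=> [/eqP ->|[/size0nil -> //]]; split=> // i p; by rewrite nth_nil.
have sizes hl D' : size hl = size D' ->
    map (fun r => size r + (n - k.+1))%N (addhd hl D') =
    map (fun r => size r + (n - k))%N D'.
  move=> szl; elim: D' hl szl => [|r D' IHD] [|h hl] //= [szl].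
  by rewrite -(IHD hl) //; congr (_ :: _); lia.
have head_addhd hl D' i : size hl = size D' -> (i < size D')%N ->
    nth 0%N (nth [::] (addhd hl D') i) 0 = nth 0%N hl i.
  by move=> szl lt_i; rewrite nth_addhd // lt_i.
rewrite [arrays _ _ _ _]/=; case: ifP => [/andP[ss0 /eqP lastE]|noexit].
  case/lastP: ss ss0 lastE sz sss lss => // ss m _.
  case/lastP: hs => [|hs hc]; first by rewrite size_rcons.
  (* The last row ends here and has no further part, so its bound [hc] becomes the lower limit for
     the row above it. *)
  rewrite !last_rcons !rem_last_rcons !size_rcons => mE [sz] sss lss.
  have [gt_m sss' lss'] := exit_times le_kn mE sss lss.
  have nthhs i : (i <= size hs)%N -> nth 0%N (rcons hs hc) i = nth hc hs i.
    move=> le_i; rewrite nth_rcons; case: ltngtP le_i => // [lt_i|->] _.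
      exact: set_nth_default.
    by rewrite nth_default.
  split=> [/allpairsPdep[hl [D' [/hdsP[szl hhl] hD' ->]]]|].
    have [szD' ss'E tD'] := (IH _ _ _ (ltnW le_kn) (etrans szl sz) sss' lss').1 hD'.
    have szA := size_addhd (esym szD'); split; first by rewrite size_rcons szA szD' szl.
      by rewrite map_rcons sizes // ss'E /= add0n mE.
    apply/tight_addhd; first by rewrite !size_rcons szA szD' szl.
    split; last by apply/tight_rcons_nil.
    move=> i; rewrite size_rcons szA ltnS leq_eqVlt nth_rcons szA => /orP[/eqP->|lt_i].
      by rewrite ltnn eqxx.
    have szhs : size hs = size D' by rewrite szD' szl.
    rewrite lt_i (head_addhd _ _ _ (esym szD') lt_i) => _; rewrite !nthhs ?szhs // ?(ltnW lt_i) //.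
    by rewrite [nth hc hs i](set_nth_default 0%N) ?hhl ?szhs.
  case/lastP: D => [|D r]; first by case.
  rewrite !size_rcons map_rcons => -[[szD] /rcons_inj[ssE rE] tD].
  have r0 : r = [::] by apply: size0nil; move: rE; rewrite mE /=; lia.
  rewrite {}r0 {rE} in tD *.
  have Dpos : all (fun r => 0 < size r)%N D.
    apply/allP => q hq; have : (size q + (n - k.+1))%N \in ss.
      by rewrite -ssE; apply: (map_f (fun r => (size r + (n - k.+1))%N) hq).
    by move/(allP gt_m); lia.
  have szR : size (rcons hs hc) = size (rcons D [::]) by rewrite !size_rcons szD.
  have [t0 /tight_rcons_nil tD'] := (tight_addhd szR).1 tD.
  apply/allpairsPdep; exists (map (head 0%N) D), (map behead D).
  split; last by rewrite addhdK.
    apply/hdsP; rewrite size_map; split=> // i lt_i; rewrite -szD in lt_i.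
    have := t0 i; rewrite size_rcons [nth [::] _ i]nth_rcons lt_i ltnW // => /(_ isT).
    rewrite (nth_map [::]) // -nth0 !nthhs -?szD ?(ltnW lt_i) // => h.
    rewrite [nth 0%N hs i](set_nth_default hc) -?szD //; apply: h.
    by apply: (allP Dpos); apply: mem_nth.
  apply/(IH _ _ _ (ltnW le_kn)); rewrite ?size_map ?szD // addhdK //.
  by split=> //; rewrite -(sizes (map (head 0%N) D)) ?size_map // addhdK.
have lss' := no_exit_times le_kn noexit sss lss.
have gt_m : all (fun s => n - k.+1 < s)%N ss.
  by apply/allP => s /(allP lss'); lia.
split=> [/allpairsPdep[hl [D' [/hdsP[szl hhl] hD' ->]]]|[szD ssE tD]].
  have [szD' ss'E tD'] := (IH _ _ _ (ltnW le_kn) (etrans szl sz) sss lss').1 hD'.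
  have szA := size_addhd (esym szD'); split; rewrite ?szA ?szD' ?szl ?sizes //.
  apply/tight_addhd; first by rewrite szA szD' szl.
  split=> // i; rewrite szA => lt_i _; rewrite head_addhd //; apply: hhl.
  by rewrite -szl -szD'.
have Dpos : all (fun r => 0 < size r)%N D.
  apply/allP => r hr; have : (size r + (n - k.+1))%N \in ss.
    by rewrite -ssE; apply: (map_f (fun r => (size r + (n - k.+1))%N) hr).
  by move/(allP gt_m); lia.
have [t0 tD'] := (tight_addhd (esym szD)).1 tD.
apply/allpairsPdep; exists (map (head 0%N) D), (map behead D).
split; last by rewrite addhdK.
  apply/hdsP; rewrite size_map; split=> // i lt_i; rewrite -szD in lt_i.
  rewrite (nth_map [::]) // -nth0; apply: t0 => //.
  by apply: (allP Dpos); apply: mem_nth.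
apply/(IH _ _ _ (ltnW le_kn)); rewrite ?size_map ?szD // addhdK //.
by split=> //; rewrite -(sizes (map (head 0%N) D)) ?size_map // addhdK.
Qed.

(** The possible lists of row lengths: lengths strictly decrease in a DPP because the diagonal part
    of the next row lies between consecutive lengths. *)
Fixpoint chains (i : nat) : seq (seq nat) :=
  if i is i'.+1 then chains i' ++ [seq i :: l | l <- chains i'] else [:: [::]].

Lemma chainsP i l : (l \in chains i) = sorted gtn l && all (fun s => 0 < s <= i)%N l.
Proof.
elim: i l => [|i IH] l /=.
  by rewrite inE; case: l => //= a l; rewrite andbC; case: ltngtP.
rewrite mem_cat IH; case: l => [|a l] //=.
have sub (s : seq nat) : all (fun s => 0 < s <= i)%N s -> all (fun s => 0 < s <= i.+1)%N s.
  by apply: sub_all => b; lia.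
apply/orP/idP => [[/and3P[-> ha /sub ->]|/mapP[l' + [-> ->]]]|].
- by rewrite andbT; lia.
- rewrite IH => /andP[sl al]; rewrite ltnSn (sub _ al) !andbT.
  by case: l' sl al => //= b l' -> /andP[hb _]; rewrite andbT; lia.
case/and3P => pl ha al.
have al' : all (fun s => s < a)%N l.
  by have := pl; rewrite (path_sortedE (leT := gtn)) => [/andP[]|b c d /=]; last by lia.
have al2 : all (fun s => 0 < s < a)%N l.
  by apply/allP => s hs; have := allP al s hs; have := allP al' s hs; lia.
have [lt_a|ge_a] := ltnP a i.+1; [left|right].
  by rewrite pl /=; apply/andP; split; [lia|apply: sub_all al2 => b; lia].
have -> : a = i.+1 by lia.
by apply: map_f; rewrite IH (path_sorted pl); apply: sub_all al2 => b; lia.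
Qed.

(** * Weighted sums of arrays as determinants *)

Section LGV.
Variables (R : comNzRingType) (n : nat) (wt : nat -> nat -> R).
Local Notation rowT := 'rV[R]_n.
Implicit Types (r : nat -> rowT) (hs ss : seq nat).

Definition erow (i : nat) : rowT := \row_j ((j : nat) == i)%:R.

(* The sum over the rows (weakly decreasing, parts positive and at most [h])
   starting at slice [n - k]: coordinate [s] collects the rows ending just
   before slice [s]. *)
Fixpoint Pv (k h : nat) : rowT :=
  if k is k'.+1 then
    erow (n - k) + \sum_(h' < h) wt (n - k) h'.+1 *: Pv k' h'.+1
  else 0.

Lemma PvS k h :
  Pv k.+1 h = erow (n - k.+1) + \sum_(h' < h) wt (n - k.+1) h'.+1 *: Pv k h'.+1.
Proof. by []. Qed.

Arguments Pv : simpl never.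

Definition Dt r : R := \det (\matrix_(i < n, j < n) r i 0 j).

Definition upd r s (v : rowT) : nat -> rowT := fun i => if i == s then v else r i.

Fixpoint put ss (vs : seq rowT) r : nat -> rowT :=
  if (ss, vs) is (s :: ss', v :: vs') then upd (put ss' vs' r) s v else r.

Lemma eq_Dt r r' : (forall i, (i < n)%N -> r i = r' i) -> Dt r = Dt r'.
Proof. by move=> h; congr (\det _); apply/matrixP => i j; rewrite !mxE h. Qed.

Lemma Dt_lin r s c v w : (s < n)%N ->
  Dt (upd r s (c *: v + w)) = c * Dt (upd r s v) + Dt (upd r s w).
Proof.
move=> lt_s; rewrite -[X in _ = _ + X]mul1r.
apply: (@determinant_multilinear _ _ _ _ _ (Ordinal lt_s)).
- by apply/matrixP => i j; rewrite !mxE /upd /= eqxx !mxE mul1r.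
- by apply/matrixP => i j; rewrite !mxE /upd -[s]/(val (Ordinal lt_s)) val_eqE eq_sym (negPf (neq_lift _ _)).
- by apply/matrixP => i j; rewrite !mxE /upd -[s]/(val (Ordinal lt_s)) val_eqE eq_sym (negPf (neq_lift _ _)).
Qed.

Lemma Dt_add r s v w : (s < n)%N ->
  Dt (upd r s (v + w)) = Dt (upd r s v) + Dt (upd r s w).
Proof. by move=> lt_s; rewrite -[v in LHS]scale1r Dt_lin // mul1r. Qed.

Lemma Dt_sum r s v m (c : nat -> R) (w : nat -> rowT) : (s < n)%N ->
  Dt (upd r s (v + \sum_(i < m) c i *: w i)) =
  Dt (upd r s v) + \sum_(i < m) c i * Dt (upd r s (w i)).
Proof.
move=> lt_s; elim: m => [|m IH]; first by rewrite !big_ord0 !addr0.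
by rewrite !big_ord_recr /= addrA addrC Dt_lin // IH [RHS]addrA [RHS]addrC.
Qed.

Lemma Dt_alt r s b v : (s < n)%N -> (b < n)%N -> s != b -> r b = v ->
  Dt (upd r s v) = 0.
Proof.
move=> lt_s lt_b sb rb.
apply: (@determinant_alternate _ _ _ (Ordinal lt_s) (Ordinal lt_b)) => // j.
by rewrite !mxE /upd /= eqxx eq_sym (negPf sb) rb.
Qed.

Lemma Dt_swap r s b v w : (s < n)%N -> (b < n)%N -> s != b ->
  Dt (upd (upd r b v) s w) = - Dt (upd (upd r b w) s v).
Proof.
move=> lt_s lt_b sb.
have H a : Dt (upd (upd r b a) s a) = 0.
  by apply: (Dt_alt lt_s lt_b sb); rewrite /upd eqxx.
have updC a c : Dt (upd (upd r b a) s c) = Dt (upd (upd r s c) b a).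
  apply: eq_Dt => i _; rewrite /upd; case: eqP => // ->.
  by rewrite (negPf sb).
have := H (v + w); rewrite Dt_add // !updC !Dt_add // -!updC !H add0r addr0.
by move=> /eqP; rewrite addr_eq0 => /eqP ->; rewrite opprK.
Qed.

Lemma Pv_diff k h lo : (lo <= h)%N ->
  Pv k.+1 h = Pv k.+1 lo +
    \sum_(i < h - lo) wt (n - k.+1) (lo.+1 + i) *: Pv k (lo.+1 + i).
Proof.
move=> le_lo; rewrite !PvS -addrA; congr (_ + _).
rewrite -!(big_mkord predT (fun h' => wt (n - k.+1) h'.+1 *: Pv k h'.+1)).
rewrite (big_cat_nat (n := lo)) //=; congr (_ + _).
rewrite -{1}[lo]add0n big_addn big_mkord; apply: eq_bigr => i _.
by rewrite addnC addSn.
Qed.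

Lemma Pv_low k h (j : 'I_n) : (j < n - k)%N -> Pv k h 0 j = 0.
Proof.
elim: k h => [|k IH] h lt_j; first by rewrite mxE.
rewrite PvS mxE mxE ltn_eqF // add0r summxE big1 // => i _.
by rewrite mxE IH ?mulr0 // (leq_trans lt_j) // leq_sub2l.
Qed.

Lemma put_upd ss vs r s v i : s \notin ss ->
  upd (put ss vs r) s v i = put ss vs (upd r s v) i.
Proof.
elim: ss vs => [|s' ss IH] [|v' vs] //=; rewrite inE negb_or => /andP[ne ns].
by have := IH vs ns; rewrite /upd => <-; case: (i =P s) => [->|//]; rewrite (negPf ne).
Qed.

Lemma put_notin ss vs r i : i \notin ss -> put ss vs r i = r i.
Proof.
elim: ss vs => [|s ss IH] [|v vs] //=; rewrite inE negb_or => /andP[ne ni].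
by rewrite /upd (negPf ne) IH.
Qed.

Definition wtl m (hl : seq nat) : R := \prod_(h <- hl) wt m h.

(** Replacing each [Pv k.+1 h] by its difference with the row of the next bound does not change the
    determinant. By [Pv_diff] this difference runs over exactly the values allowed to the next part.
    For the last bound, the row to subtract is row [b]. *)
Lemma Dt_slice k lo hs ss r b : size hs = size ss ->
  uniq (b :: ss) -> all (fun s => s < n)%N (b :: ss) -> r b = Pv k.+1 lo ->
  sorted geq (rcons hs lo) ->
  Dt (put ss (map (Pv k.+1) hs) r) =
  \sum_(hl <- hds lo hs) wtl (n - k.+1) hl * Dt (put ss (map (Pv k) hl) r).
Proof.
elim: hs ss r => [|h hs IH] [|s ss] r //=.
  by move=> _ _ _ _ _; rewrite big_seq1 /wtl big_nil mul1r.
move=> [sz] /and3P[]; rewrite inE negb_or => /andP[bs bss] nss uss.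
move=> /and3P[lt_b lt_s lt_ss] rb hsrt.
have le_lo : (head lo hs <= h)%N.
  by case: (hs) hsrt => [|h2 hs2] /= /andP[].
rewrite (Pv_diff _ le_lo) (@Dt_sum _ _ _ _
  (fun i => wt (n - k.+1) ((head lo hs).+1 + i)%N)
  (fun i => Pv k ((head lo hs).+1 + i)%N)) //.
(* The inserted row already occurs, at the next index of [ss], or at [b] if there is none. *)
have -> : Dt (upd (put ss [seq Pv k.+1 i | i <- hs] r) s (Pv k.+1 (head lo hs))) = 0.
  case: hs ss sz nss uss lt_ss bss {IH hsrt le_lo} => [|h2 hs] [|s2 ss] //= _.
    by move=> _ _ _ _; apply: (@Dt_alt _ _ b) => //; rewrite eq_sym.
  rewrite inE negb_or => /andP[ne _] _ /andP[lt_s2 _] _.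
  by apply: (@Dt_alt _ _ s2) => //; rewrite /upd eqxx.
rewrite add0r big_allpairs_dep -[X in iota X _]addn0 iotaDl big_map.
rewrite -[iota 0 _]val_enum_ord big_map big_enum /=; apply: eq_bigr => i _.
rewrite (@eq_Dt _ (put ss (map (Pv k.+1) hs) (upd r s (Pv k ((head lo hs).+1 + i))))); last first.
  by move=> j _; apply: put_upd.
rewrite IH //=; first last.
- by move: hsrt => /path_sorted.
- by rewrite /upd (negPf bs).
- by rewrite lt_b.
- by rewrite bss.
rewrite mulr_sumr; apply: eq_bigr => hl _; rewrite /wtl big_cons mulrA.
by congr (_ * _); apply: eq_Dt => j _; rewrite put_upd.
Qed.

Definition wtR m (D : seq (seq nat)) : R :=
  \prod_(r <- D) \prod_(p < size r) wt (m + p) (nth 0%N r p).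

Lemma wtR_addhd m hl D : size hl = size D ->
  wtR m (addhd hl D) = wtl m hl * wtR m.+1 D.
Proof.
rewrite /wtR /wtl; elim: hl D => [|h hl IH] [|r D] //=.
  by rewrite !big_nil mulr1.
case=> sz; rewrite !big_cons IH // big_ord_recl addn0 mulrACA; congr (_ * (_ * _)).
by apply: eq_bigr => p _; rewrite /= addnS addSn.
Qed.

Lemma wtR_rcons_nil m D : wtR m (rcons D [::]) = wtR m D.
Proof. by rewrite /wtR -cats1 big_cat big_seq1 big_ord0 /= mulr1. Qed.

Lemma put_rcons ss vs r s v : size ss = size vs ->
  put (rcons ss s) (rcons vs v) r = put ss vs (upd r s v).
Proof. by elim: ss vs => [|s' ss IH] [|v' vs] //= [sz]; rewrite IH. Qed.

Lemma eq_put ss vs r r' i : r i = r' i -> put ss vs r i = put ss vs r' i.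
Proof. by move=> e; elim: ss vs => [|s ss IH] [|v vs] //=; rewrite /upd IH. Qed.

Lemma put_cases ss (f : nat -> rowT) hs r i :
  put ss (map f hs) r i = r i \/ exists h, put ss (map f hs) r i = f h.
Proof.
elim: ss hs => [|s ss IH] [|h hs] /=; try by left.
by rewrite /upd; case: eqP => _; [right; exists h | exact: IH].
Qed.

(** Off row m, column m is zero: the rows [Pv k] vanish in coordinates below n - k and the others
    are different unit rows. Hence the part of [Pv k.+1 h] that continues beyond slice m contributes
    nothing. *)
Lemma Dt_exit k m ss hl h : (k < n)%N -> m = (n - k.+1)%N -> m \notin ss ->
  Dt (put ss (map (Pv k) hl) (upd erow m (Pv k.+1 h))) =
  Dt (put ss (map (Pv k) hl) erow).
Proof.
move=> lt_kn mE nm; have lt_m : (m < n)%N by lia.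
rewrite -(@eq_Dt (upd (put ss (map (Pv k) hl) erow) m (Pv k.+1 h))); last first.
  by move=> i _; apply: put_upd.
rewrite PvS -mE (@Dt_sum _ _ _ _ (fun i => wt m i.+1) (fun i => Pv k i.+1)) //.
rewrite big1 ?addr0 => [|h' _].
  by apply: eq_Dt => i _; rewrite /upd; case: eqP => // ->; rewrite put_notin.
rewrite /Dt (expand_det_col _ (Ordinal lt_m)) big1 ?mulr0 // => i _.
have low h2 : Pv k h2 0 (Ordinal lt_m) = 0 by rewrite Pv_low //=; lia.
rewrite mxE /upd; case: eqP => [_|im]; first by rewrite low mul0r.
have [->|[h2 ->]] := put_cases ss (Pv k) hl erow i; last by rewrite low mul0r.
by rewrite mxE /= eq_sym (introF eqP im) mul0r.
Qed.

Lemma Dt_erow : Dt erow = 1.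
Proof.
rewrite /Dt (_ : \matrix_(i, j) _ = 1%:M) ?det1 //.
by apply/matrixP => i j; rewrite !mxE -val_eqE eq_sym.
Qed.

(** Putting the vector of each array row at the index of its own exit slice makes all signs
    positive; the remaining indices hold unit rows. *)
Lemma arrays_sum k hs ss : (k <= n)%N -> size hs = size ss ->
  sorted gtn ss -> all (fun s => n - k <= s < n)%N ss -> sorted geq hs ->
  \sum_(D <- arrays n k hs ss) wtR (n - k) D = Dt (put ss (map (Pv k) hs) erow).
Proof.
elim: k hs ss => [|k IH] hs ss le_kn sz sss lss shs.
  case: ss sz sss lss => [/size0nil -> _ _|s ss _ _] /=; last by rewrite subn0 leqNgt; case: ltnP.
  by rewrite big_seq1 /wtR big_nil Dt_erow.
have uss : uniq ss by apply: (sorted_uniq _ _ sss) => [a b c /=|a /=]; lia.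
rewrite [arrays _ _ _ _]/=; case: ifP => [/andP[ss0 /eqP lastE]|noexit].
  case/lastP: ss ss0 lastE sz sss lss uss => // ss m _.
  case/lastP: hs shs => [|hs hc] shs; first by rewrite size_rcons.
  rewrite !last_rcons !rem_last_rcons !size_rcons => mE [sz] sss lss uss.
  have /andP[nm uss'] : (m \notin ss) && uniq ss by rewrite -rcons_uniq.
  have [_ sss' lss'] := exit_times le_kn mE sss lss.
  rewrite map_rcons put_rcons ?size_map // (@Dt_slice k hc _ _ _ m); first last.
  - by [].
  - by rewrite /upd eqxx.
  - by move: lss; rewrite all_rcons /= => /andP[/andP[_ ->]]; apply: sub_all => s /andP[].
  - by rewrite /= nm.
  - by [].
  rewrite big_allpairs_dep; apply: eq_big_seq => hl /[dup] /hdsP[szl _] hhl.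
  rewrite Dt_exit // -IH ?(hds_sorted hhl) ?szl //; last exact: ltnW.
  rewrite mulr_sumr; apply: eq_big_seq => D hD.
  have [szD _ _] := (arraysP _ (ltnW le_kn) (etrans szl sz) sss' lss').1 hD.
  by rewrite wtR_rcons_nil wtR_addhd // subnSK.
have lss' := no_exit_times le_kn noexit sss lss.
have lt_m : (n - k.+1 < n)%N by lia.
(* No row ends at this slice, so the unit row of index n - k.+1 is still present. It is [Pv k.+1 0]
   and supplies the lower limit 0. *)
rewrite (@Dt_slice k 0 _ _ _ (n - k.+1)%N) //; first last.
- by elim: (hs) shs => [|h [|h2 hs'] IHs] //= /andP[-> /IHs].
- by rewrite PvS big_ord0 addr0.
- by rewrite /= lt_m; apply: sub_all lss => s /andP[].
- by rewrite /= uss andbT; apply/negP => /(allP lss'); lia.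
rewrite big_allpairs_dep; apply: eq_big_seq => hl /[dup] /hdsP[szl _] hhl.
rewrite -IH ?(hds_sorted hhl) ?szl //; last exact: ltnW.
rewrite mulr_sumr; apply: eq_big_seq => D hD.
have [szD _ _] := (arraysP _ (ltnW le_kn) (etrans szl sz) sss lss').1 hD.
by rewrite wtR_addhd // subnSK.
Qed.

(** Expanding the rows j > 0 selects a set of row lengths. An array row of length l_1 has bound h,
    the next has bound l_1, and so on, down to a last one that ends at slice 0. This shifts the
    selected vectors cyclically against their indices, and the sign of the cycle cancels the signs
    of the terms - c j. *)
Lemma Dt_chains (c : nat -> R) i h r : (i < n)%N ->
  Dt (fun j => if j == 0%N then Pv n h
               else if (j <= i)%N then erow j - c j *: Pv n j else r j) =
  \sum_(l <- chains i) (\prod_(s <- l) c s) *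
    Dt (put (rcons l 0%N) (map (Pv n) (h :: l))
          (fun j => if (j <= i)%N then erow j else r j)).
Proof.
elim: i h r => [|i IH] h r lt_i.
  rewrite /= big_seq1 big_nil mul1r; apply: eq_Dt => j _; rewrite /upd /=.
  by case: j.
set f := fun j : nat => _.
have fE : Dt f = Dt (upd f i.+1 (- c i.+1 *: Pv n i.+1 + erow i.+1)).
  apply: eq_Dt => j _; rewrite /upd /f; case: (j =P i.+1) => [->|//].
  by rewrite /= leqnn addrC scaleNr.
rewrite {}fE Dt_lin // [chains _]/= big_cat big_map /= addrC; congr (_ + _); last first.
  transitivity (Dt (fun j => if j == 0%N then Pv n h
       else if (j <= i)%N then erow j - c j *: Pv n j else upd r i.+1 (erow i.+1) j)).
    apply: eq_Dt => j _; rewrite /upd /f; case: (j =P i.+1) => [->|ne].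
      by rewrite ltnn.
    by have -> : (j <= i.+1)%N = (j <= i)%N by lia.
  rewrite (IH h (upd r i.+1 (erow i.+1)) (ltnW lt_i)).
  apply: eq_bigr => l _; congr (_ * _).
  apply: eq_Dt => j _; apply: eq_put; rewrite /upd.
  by case: (j =P i.+1) => [->|ne]; rewrite ?ltnn ?leqnn //;
    have -> : (j <= i.+1)%N = (j <= i)%N by lia.
have -> : Dt (upd f i.+1 (Pv n i.+1)) =
    Dt (upd (upd f 0%N (Pv n h)) i.+1 (Pv n i.+1)).
  by apply: eq_Dt => -[|j] _.
(* One transposition of the cycle: the vector of bound h goes to its exit index, and the length just
   selected becomes the bound at index 0. *)
rewrite Dt_swap // ?(leq_ltn_trans _ lt_i) // mulrNN.
transitivity (c i.+1 * Dt (fun j => if j == 0%N then Pv n i.+1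
     else if (j <= i)%N then erow j - c j *: Pv n j else upd r i.+1 (Pv n h) j)).
  congr (_ * _); apply: eq_Dt => j _; rewrite /upd /f.
  case: (j =P i.+1) => [->|ne]; first by rewrite ltnn.
  case: eqP => // _; by have -> : (j <= i.+1)%N = (j <= i)%N by lia.
rewrite (IH i.+1 (upd r i.+1 (Pv n h)) (ltnW lt_i)) mulr_sumr.
apply: eq_big_seq => l; rewrite chainsP => /andP[_ al].
rewrite big_cons mulrA; congr (_ * _); apply: eq_Dt => j _.
rewrite put_upd.
  apply: eq_put; rewrite /upd; case: (j =P i.+1) => [->|ne]; first by rewrite ltnn.
  by have -> : (j <= i.+1)%N = (j <= i)%N by lia.
rewrite mem_rcons inE /=; apply/negP => /(allP al); lia.
Qed.
End LGV.

Lemma hds_uniq lo hs : uniq (hds lo hs).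
Proof.
elim: hs => //= h hs IH; apply: allpairs_uniq_dep => [||[a b] [c d] _ _ [-> ->]] //.
exact: iota_uniq.
Qed.

Lemma chains_uniq i : uniq (chains i).
Proof.
elim: i => //= i IH; rewrite cat_uniq IH map_inj_uniq ?IH ?andbT => [|a b []//].
apply/hasPn => _ /mapP[l _ ->]; apply/negP; rewrite chainsP /= => /andP[_ /andP[]].
by lia.
Qed.

Lemma addhd_inj hl hl' D D' : size hl = size D -> size hl' = size D' ->
  addhd hl D = addhd hl' D' -> hl = hl' /\ D = D'.
Proof.
elim: hl D hl' D' => [|h hl IH] [|r D] // [|h' hl'] [|r' D'] //= [sz] [sz'].
by case=> -> -> /(IH _ _ _ sz sz')[-> ->].
Qed.

Lemma arrays_uniq n k hs ss : (k <= n)%N -> size hs = size ss ->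
  sorted gtn ss -> all (fun s => n - k <= s < n)%N ss -> uniq (arrays n k hs ss).
Proof.
elim: k hs ss => // k IH hs ss le_kn sz sss lss.
rewrite [arrays _ _ _ _]/=; case: ifP => [/andP[ss0 /eqP lastE]|noexit].
  case/lastP: ss ss0 lastE sz sss lss => // ss m _.
  case/lastP: hs => [|hs hc]; first by rewrite size_rcons.
  rewrite !last_rcons !rem_last_rcons !size_rcons => mE [sz] sss lss.
  have [_ sss' lss'] := exit_times le_kn mE sss lss.
  apply: allpairs_uniq_dep => [|hl /hdsP[szl _]|]; first exact: hds_uniq.
    by apply: IH => //; [exact: ltnW | rewrite szl].
  move=> p q /allpairsPdep[a [b [/hdsP[sza _] hb ->]]].
  move=> /allpairsPdep[a' [b' [/hdsP[sza' _] hb' ->]]] /= /rcons_inj[].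
  have [szb _ _] := (arraysP _ (ltnW le_kn) (etrans sza sz) sss' lss').1 hb.
  have [szb' _ _] := (arraysP _ (ltnW le_kn) (etrans sza' sz) sss' lss').1 hb'.
  by case/(addhd_inj (esym szb) (esym szb')) => -> ->.
have lss' := no_exit_times le_kn noexit sss lss.
apply: allpairs_uniq_dep => [|hl /hdsP[szl _]|]; first exact: hds_uniq.
  by apply: IH => //; [exact: ltnW | rewrite szl].
move=> p q /allpairsPdep[a [b [/hdsP[sza _] hb ->]]].
move=> /allpairsPdep[a' [b' [/hdsP[sza' _] hb' ->]]] /=.
have [szb _ _] := (arraysP _ (ltnW le_kn) (etrans sza sz) sss lss').1 hb.
have [szb' _ _] := (arraysP _ (ltnW le_kn) (etrans sza' sz) sss lss').1 hb'.
by case/(addhd_inj (esym szb) (esym szb')) => -> ->.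
Qed.

(** * Descending plane partitions as bounded arrays *)

Lemma dppP n D : is_dpp D && parts_le n D <->
  forall i, (i < size D)%N ->
   [/\ (0 < size (nth [::] D i))%N,
       (size (nth [::] D i) < nth 0%N (nth [::] D i) 0)%N,
       (i.+1 < size D)%N -> (nth 0%N (nth [::] D i.+1) 0 <= size (nth [::] D i))%N &
       forall p, (p < size (nth [::] D i))%N ->
         [/\ (0 < nth 0%N (nth [::] D i) p <= n)%N,
            (p.+1 < size (nth [::] D i))%N ->
              (nth 0%N (nth [::] D i) p.+1 <= nth 0%N (nth [::] D i) p)%N &
            (i.+1 < size D)%N -> (p < size (nth [::] D i.+1))%N ->
              (p.+1 < size (nth [::] D i))%N ->
              (nth 0%N (nth [::] D i.+1) p < nth 0%N (nth [::] D i) p.+1)%N]].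
Proof.
have cellE i p : ((i, (i + p)%N) \in cells D) = (i < size D)%N && (p < size (nth [::] D i))%N.
  by rewrite mem_cells leq_addr andbT ltn_add2l.
have partE i p : part D i (i + p) = nth 0%N (nth [::] D i) p by rewrite /part addKn.
have part0 i : part D i i = nth 0%N (nth [::] D i) 0 by rewrite /part subnn.
have cellI i j : (i, j) \in cells D -> exists2 p, j = (i + p)%N & (i < size D)%N && (p < size (nth [::] D i))%N.
  move=> hc; have le_ij : (i <= j)%N by move: hc; rewrite mem_cells => /andP[/andP[]].
  by exists (j - i)%N; rewrite ?subnKC // -cellE subnKC.
split=> [|h].
  case/andP=> /and5P[/allP len /allP pos /allP rowd /allP cold /andP[/allP diag /allP desc]].
  move=> /allP le_n i lt_i; have hi : i \in iota 0 (size D) by rewrite mem_iota.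
  split; first exact: len.
  - by rewrite -part0; apply: diag.
  - by move=> lt_i1; rewrite -part0; have := desc i hi; rewrite lt_i1.
  move=> p lt_p; have hc : (i, (i + p)%N) \in cells D by rewrite cellE lt_i.
  split; first by rewrite -partE (pos _ hc) (le_n _ hc).
  - move=> lt_p1; have := rowd _ hc; rewrite /= -addnS cellE lt_i lt_p1 /=.
    by rewrite !partE.
  - move=> lt_i1 lt_pi lt_p1; have hc1 : (i, (i + p.+1)%N) \in cells D by rewrite cellE lt_i.
    have := cold _ hc1; rewrite /= partE addnS -addSn cellE lt_i1 lt_pi /=.
    by rewrite partE.
rewrite /is_dpp /parts_le; apply/andP; split; [apply/and5P; split; last apply/andP; try split|];
  apply/allP.
- by move=> i; rewrite mem_iota => /andP[_ lt_i]; have [] := h i lt_i.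
- move=> [i j] /cellI[p -> /andP[lt_i lt_p]] /=; rewrite partE.
  by have [_ _ _ /(_ p lt_p)[/andP[]]] := h i lt_i.
- move=> [i j] /cellI[p -> /andP[lt_i lt_p]] /=; rewrite -addnS cellE lt_i /= !partE.
  by apply/implyP; have [_ _ _ /(_ p lt_p)[]] := h i lt_i.
- move=> [i j] /cellI[[|p] -> /andP[lt_i lt_p]] /=.
    by rewrite mem_cells addn0 ltnn andbF.
  rewrite addnS -addSn cellE partE addSn -addnS partE; apply/implyP => /andP[lt_i1 lt_p1].
  by have [_ _ _ /(_ p (ltnW lt_p))[_ _]] := h i lt_i; apply.
- by move=> i; rewrite mem_iota part0 => /andP[_ lt_i]; have [] := h i lt_i.
- move=> i; rewrite mem_iota part0 => /andP[_ lt_i]; apply/implyP => lt_i1.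
  by have [_ _ + _] := h i lt_i; apply.
- move=> [i j] /cellI[p -> /andP[lt_i lt_p]] /=; rewrite partE.
  by have [_ _ _ /(_ p lt_p)[/andP[]]] := h i lt_i.
Qed.

(** The bound of a row is the length of the previous one, or n for the first row. The appended empty
    row is there to carry the last length, which is the strict lower limit of the last diagonal
    part. Positivity of the parts comes from the default value 0 of missing parts in [tight]. *)
Lemma dpp_tight n D : is_dpp D && parts_le n D <->
  map size D \in chains n.-1 /\
  tight (addhd (n :: map size D) (rcons D [::])).
Proof.
have szl : size (n :: map size D) = size (rcons D [::]) by rewrite size_rcons /= size_map.
have nthS i : (i < size D)%N -> nth 0%N (n :: map size D) i.+1 = size (nth [::] D i).
  by move=> lt_i; rewrite /= (nth_map [::]).
have nthD i : nth [::] (rcons D [::]) i = nth [::] D i.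
  rewrite nth_rcons; case: ltngtP => // [lt_i|->]; last by rewrite nth_default.
  by rewrite nth_default // ltnW.
rewrite chainsP; split=> [/dppP h|[/andP[srt bnd] /(tight_addhd szl)[t0 /tight_rcons_nil tD]]].
  have dec i : (i.+1 < size D)%N -> (size (nth [::] D i.+1) < size (nth [::] D i))%N.
    move=> lt_i; have [_ h1 _ _] := h _ lt_i; have [_ _ /(_ lt_i) h2 _] := h _ (ltnW lt_i).
    exact: leq_trans h2.
  split.
    apply/andP; split.
      apply/(sortedP 0%N) => i; rewrite size_map => lt_i.
      by rewrite !(nth_map [::]) ?(ltnW lt_i) //; apply: dec.
    apply/(all_nthP 0%N) => i; rewrite size_map => lt_i; rewrite (nth_map [::]) //.
    have [h1 h2 _ h3] := h i lt_i; have [/andP[_ h4] _ _] := h3 0%N h1; lia.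
  apply/(tight_addhd szl); split; last first.
    apply/tight_rcons_nil => i p lt_p; have lt_i : (i < size D)%N.
      by rewrite ltnNge; apply/negP => le_i; move: lt_p; rewrite nth_default.
    have [_ _ _ hp] := h i lt_i; have [h0 _ _] := hp _ lt_p.
    have [_ h1 h2] := hp _ (ltnW lt_p); rewrite (h1 lt_p) andbT.
    have [lt_p2|le_p2] := ltnP p (size (nth [::] D i.+1)); last first.
      by rewrite nth_default //; case/andP: h0.
    apply: h2 => //; rewrite ltnNge; apply/negP => le_i; move: lt_p2.
    by rewrite nth_default.
  move=> i; rewrite size_rcons nthD ltnS => le_i nz.
  have lt_i : (i < size D)%N.
    by rewrite ltnNge; apply/negP => ge_i; move: nz; rewrite nth_default.
  rewrite nthS //; have [h1 -> _ h3] := h i lt_i; case: i {le_i nz} lt_i h1 h3 => [|i] lt_i h1 h3.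
    by have [/andP[]] := h3 0%N h1.
  by rewrite (nthS i (ltnW lt_i)); have [_ _ /(_ lt_i)] := h i (ltnW lt_i).
have n_gt0 i : (i < size D)%N -> (0 < size (nth [::] D i) <= n.-1)%N.
  move=> lt_i; rewrite -[size _](@nth_map _ [::] _ 0%N size i D) //.
  by apply: (allP bnd); apply: mem_nth; rewrite size_map.
have {}t0 i : (i < size D)%N ->
    (size (nth [::] D i) < nth 0%N (nth [::] D i) 0 <= nth 0%N (n :: map size D) i)%N.
  move=> lt_i; have := t0 i; rewrite size_rcons nthD nthS //; apply; first exact: ltnW.
  by have /andP[] := n_gt0 i lt_i.
apply/dppP => i lt_i; split.
- by have /andP[] := n_gt0 i lt_i.
- by have /andP[] := t0 i lt_i.
- by move=> lt_i1; have := t0 i.+1 lt_i1; rewrite nthS // => /andP[].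
move=> p lt_p; split.
- apply/andP; split.
    case: p lt_p => [|p] lt_p; last first.
      by have /andP[h1 _] := tD i p lt_p; apply: leq_ltn_trans h1.
    by have /andP[h1 _] := t0 i lt_i; apply: leq_ltn_trans h1.
  elim: p lt_p => [|p IHp] lt_p; last first.
    by have /andP[_ h1] := tD i p lt_p; apply: leq_trans h1 (IHp (ltnW lt_p)).
  have /andP[_ h1] := t0 i lt_i; apply: leq_trans h1 _.
  case: i lt_i {lt_p} => [|i] lt_i //; rewrite (nthS i (ltnW lt_i)).
  by have /andP[_ h2] := n_gt0 i (ltnW lt_i); lia.
- by move=> lt_p1; have /andP[] := tD i p lt_p1.
- by move=> _ _ lt_p1; have /andP[] := tD i p lt_p1.
Qed.

Section DPPSum.
Variables (R : comNzRingType) (x y z1 z2 : R) (n : nat).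
Hypothesis n_gt0 : (0 < n)%N.

Definition dwt (m h : nat) : R :=
  (if (m < h)%N then x else y) * (if h == n then z1 else 1) *
  (if h == n.-1 then z2 else 1).

Definition dlen (s : nat) : R := if s == n.-1 then z2 else 1.

Lemma dpp_weight D :
  x ^+ dpp_nu D * y ^+ dpp_mu D * z1 ^+ dpp_rho1 n D * z2 ^+ dpp_rho2 n D =
  (\prod_(s <- map size D) dlen s) * wtR dwt 0 D.
Proof.
have cnt (T : Type) (P : pred T) (s : seq T) (a : R) :
    a ^+ count P s = \prod_(i <- s) (if P i then a else 1).
  by elim: s => [|i s IH]; rewrite ?big_nil // big_cons /= exprD IH; case: (P i).
rewrite /dpp_rho2 exprD !cnt.
have -> : \prod_(i <- iota 0 (size D)) (if (row_length D i == n - 1)%N then z2 else 1) =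
    \prod_(s <- map size D) dlen s.
  rewrite big_map (big_nth [::]) /index_iota subn0; apply: eq_bigr => i _.
  by rewrite /dlen subn1.
rewrite [X in _ * X]mulrC mulrCA; congr (_ * _).
rewrite -!big_split /wtR big_allpairs_dep (big_nth [::]) /index_iota subn0.
apply: eq_bigr => i _; rewrite -[X in iota X _]addn0 iotaDl big_map.
rewrite -[X in _ = X](big_mkord predT (fun p => dwt (0 + p) (nth 0%N (nth [::] D i) p))).
rewrite /index_iota subn0 /row_length; apply: eq_bigr => p _.
rewrite /part /= addKn add0n subn1 /dwt; congr (_ * _ * _).
by case: ltnP; rewrite ?mulr1 ?mul1r.
Qed.

Lemma chain_times l : l \in chains n.-1 -> [/\ size (n :: l) = size (rcons l 0%N),
  sorted gtn (rcons l 0%N) & all (fun s => n - n <= s < n)%N (rcons l 0%N)].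
Proof.
rewrite chainsP => /andP[srt al]; split; first by rewrite size_rcons.
  rewrite sorted_pairwise ?pairwise_rcons => [|a b c /=]; last by lia.
  rewrite -sorted_pairwise => [|a b c /=]; last by lia.
  by rewrite srt andbT; apply: sub_all al => s /andP[].
rewrite all_rcons subnn n_gt0 /=; apply: sub_all al => s; lia.
Qed.

(** Grouping by row lengths: D followed by an empty row is an array whose bounds are n and these
    lengths, and whose exit slices are the lengths and 0. *)
Lemma ZDPP_chains :
  ZDPP n x y z1 z2 = \sum_(l <- chains n.-1) (\prod_(s <- l) dlen s) *
    \sum_(A <- arrays n n (n :: l) (rcons l 0%N)) wtR dwt 0 A.
Proof.
have lprop := chain_times.
pose W A := (\prod_(s <- map size (rem_last A)) dlen s) * wtR dwt 0 A.
transitivity (\sum_(A <- map (fun D => rcons D [::]) (DPP n)) W A).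
  rewrite big_map; apply: eq_bigr => D _.
  by rewrite dpp_weight /W rem_last_rcons wtR_rcons_nil.
rewrite (perm_big [seq A | l <- chains n.-1, A <- arrays n n (n :: l) (rcons l 0%N)]) /=.
  rewrite big_allpairs_dep; apply: eq_big_seq => l hl; have [h1 h2 h3] := lprop l hl.
  rewrite mulr_sumr; apply: eq_big_seq => A hA; rewrite /W.
  have [_ + _] := (arraysP _ (leqnn n) h1 h2 h3).1 hA.
  by case/lastP: A {hA} => [|A r]; [case: (l) | rewrite rem_last_rcons map_rcons subnn];
    rewrite // => /rcons_inj[<- _]; congr (_ * _); rewrite !big_map; apply: eq_bigr => r' _; rewrite addn0.
apply: uniq_perm.
- by rewrite map_inj_uniq ?fset_uniq // => A B /rcons_inj[].
- apply: allpairs_uniq_dep; first exact: chains_uniq.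
    by move=> l /lprop[h1 h2 h3]; apply: arrays_uniq.
  move=> p q /allpairsPdep[l [A [/lprop[h1 h2 h3] hA ->]]].
  move=> /allpairsPdep[l' [A' [/lprop[h1' h2' h3'] hA' ->]]] /= e.
  have [_ E _] := (arraysP _ (leqnn n) h1 h2 h3).1 hA.
  have [_ E' _] := (arraysP _ (leqnn n) h1' h2' h3').1 hA'.
  by move: E; rewrite e E' => /rcons_inj[->].
move=> A; apply/mapP/allpairsPdep => [[D]|[l [A' [hl hA ->]]]].
  rewrite in_DPP => /dpp_tight[hl tD] ->; exists (map size D), (rcons D [::]).
  have [h1 h2 h3] := lprop _ hl; split=> //; apply/(arraysP _ (leqnn n) h1 h2 h3).
  split=> //; first by rewrite size_rcons /= size_map.
  rewrite map_rcons subnn; congr rcons; apply: eq_map => r; exact: addn0.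
have [h1 h2 h3] := lprop l hl; have [szA + tA] := (arraysP _ (leqnn n) h1 h2 h3).1 hA.
case/lastP: A' szA tA {hA} => [|D r] //.
move=> szA tA; rewrite map_rcons subnn => /rcons_inj[lE /= rE].
have r0 : r = [::] by apply: size0nil; move: rE; rewrite addn0.
exists D; last by rewrite r0.
rewrite in_DPP; apply/dpp_tight.
have <- : l = map size D by rewrite -lE; apply: eq_map => q; rewrite addn0.
by rewrite -r0.
Qed.

Lemma ZDPP_det :
  ZDPP n x y z1 z2 = Dt (fun j => if j == 0%N then Pv n dwt n n
                                    else erow R n j - dlen j *: Pv n dwt n j).
Proof.
have lt_n : (n.-1 < n)%N by rewrite prednK.
rewrite ZDPP_chains.
transitivity (Dt (fun j => if j == 0%N then Pv n dwt n n else
   if (j <= n.-1)%N then erow R n j - dlen j *: Pv n dwt n j else 0)); last first.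
  by apply: eq_Dt => j lt_j; case: eqP => // _; rewrite -ltnS prednK // lt_j.
rewrite Dt_chains //; apply: eq_big_seq => l hl; have [h1 h2 h3] := chain_times hl.
have := arrays_sum dwt (leqnn n) h1 h2 h3; rewrite subnn => -> //.
  congr (_ * _).
  by apply: eq_Dt => i lt_i; apply: eq_put; rewrite -ltnS prednK // lt_i.
move: hl; rewrite chainsP => /andP[srt al] /=; rewrite path_min_sorted.
  by apply: sub_sorted srt => a b /ltnW.
by apply: sub_all al => s /=; lia.
Qed.
End DPPSum.

(** * Comparison of the two determinants *)

Section DPPRows.
Variables (F : fieldType) (x y z1 z2 : F) (N : nat).
Local Notation n := N.+2.
Local Notation a := (apoly y).
Local Notation b := (bpoly x y).
Local Notation d1 := (dpoly x y z1).
Local Notation d2 := (dpoly x y z2).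
Local Notation w := (dwt x y z1 z2 n).

(* Solution of the recurrence defining [Pv] in the form of generating functions
   multiplied by [a ^+ N * d1 * d2]; cancelling these factors is what leaves
   three cases for [h]. *)
Definition gpoly (m h : nat) : {poly F} :=
  'X^m * b ^+ (h - m) *
  (if h == n then 1 else if h == N.+1 then d1 else a ^+ (N - h) * d1 * d2).

Definition prow (p : {poly F}) : 'rV[F]_n := \row_j p`_j.

Definition toeplitz : 'M[F]_n := \matrix_(i, j) ('X^i * (a ^+ N * d1 * d2))`_j.

Lemma prowD p q : prow (p + q) = prow p + prow q.
Proof. by apply/rowP => j; rewrite !mxE coefD. Qed.

Lemma prowZ c p : prow (c *: p) = c *: prow p.
Proof. by apply/rowP => j; rewrite !mxE coefZ. Qed.

Lemma eq_prow p q : eqX n p q -> prow p = prow q.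
Proof. by move=> e; apply/rowP => j; rewrite !mxE e. Qed.

(** Passing from h to h + 1 with m at most h replaces one factor a, d2 or d1 by b, and b = a + x X =
    d2 + z2 x X = d1 + z1 x X supplies the weight. For m > h the power of b stays 1 and a = 1 - y X
    supplies y. *)
Lemma gpolyS m h : (m < n)%N -> (h < n)%N ->
  prow (gpoly m h.+1) = prow (gpoly m h) + w m h.+1 *: prow (gpoly m.+1 h.+1).
Proof.
move=> lt_m lt_h; rewrite -prowZ -prowD; apply: eq_prow.
have bE : b = a + x *: 'X by rewrite /bpoly /apoly -!mul_polyC polyCB; ring.
have b1 : b = d1 + (z1 * x) *: 'X.
  by rewrite /bpoly /dpoly -!mul_polyC !(polyCB, polyCM); ring.
have b2 : b = d2 + (z2 * x) *: 'X.
  by rewrite /bpoly /dpoly -!mul_polyC !(polyCB, polyCM); ring.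
suff [r rE] : exists r, gpoly m h.+1 = gpoly m h + w m h.+1 *: gpoly m.+1 h.+1 + 'X^n * r.
  exact: (eqXD (leqnn n) rE).
rewrite /gpoly /dwt subSS /=.
have [hN|hN] : (h < N)%N \/ (N <= h)%N by lia.
  exists 0; rewrite !ltn_eqF ?mulr1; try lia.
  have -> : (N - h = (N - h.+1).+1)%N by lia.
  case: ltnP => [le_mh|lt_hm].
    have -> : (h.+1 - m = (h - m).+1)%N by lia.
    by rewrite !exprS {1}bE -!mul_polyC; ring.
  have -> : (h.+1 - m = 0)%N by lia.
  have -> : (h - m = 0)%N by lia.
  by rewrite !exprS /apoly -!mul_polyC; ring.
have [{hN}hN|{hN}hN] : h = N \/ h = N.+1 by lia.
  rewrite {h}hN in lt_h *; rewrite eqxx !ltn_eqF //= subnn mulr1.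
  have [le_mN|le_Nm] := leqP m N.
    exists 0; rewrite ltnS le_mN subSn // !exprS {1}b2 -!mul_polyC polyCM; ring.
  have -> : m = N.+1 by lia.
  (* Only at m = N + 1, h = N does the recurrence fail exactly; the error is a multiple of
     X^(N+2). *)
  exists ((- (x - y - z2 * x) - y * z2)%:P * d1).
  have e0 : (N - N.+1 = 0)%N by lia.
  rewrite ltnn subnn e0.
  by rewrite !exprS /dpoly -!mul_polyC !(polyCB, polyCD, polyCM, polyCN); ring.
have e1 : (N.+1 == n) = false by apply: ltn_eqF.
have e2 : (n == N.+1) = false by apply: gtn_eqF.
rewrite {h}hN in lt_h *; rewrite eqxx e1.
exists 0; rewrite lt_m eqxx e2 subSn // !exprS {1}b1 -!mul_polyC polyCM; ring.
Qed.

Lemma gpoly0 m : gpoly m 0 = 'X^m * (a ^+ N * d1 * d2).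
Proof. by rewrite /gpoly !ltn_eqF // sub0n subn0 expr0 mulr1. Qed.

Lemma erow_toeplitz m : (m < n)%N -> erow F n m *m toeplitz = prow (gpoly m 0).
Proof.
move=> lt_m; apply/rowP => j; rewrite !mxE (bigD1 (Ordinal lt_m)) //= !mxE eqxx mul1r.
rewrite gpoly0 big1 ?addr0 // => i; rewrite -val_eqE /= => /negPf ne.
by rewrite mxE ne mul0r.
Qed.

Lemma Pv_toeplitz k h : (k <= n)%N -> (h <= n)%N ->
  Pv n w k h *m toeplitz = prow (gpoly (n - k) h).
Proof.
elim: k h => [|k IH] h le_k le_h.
  rewrite mul0mx subn0; apply/rowP => j; rewrite !mxE /gpoly -mulrA.
  by rewrite eqX_XnM ?coef0.
rewrite PvS mulmxDl erow_toeplitz; last by lia.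
elim: h le_h => [|h IHh] lt_h; first by rewrite big_ord0 mul0mx addr0.
rewrite big_ord_recr /= mulmxDl addrA IHh 1?ltnW // gpolyS //; last by lia.
rewrite -scalemxAl IH //; last by rewrite ltnW.
by rewrite subnSK.
Qed.

Lemma det_toeplitz : \det toeplitz = 1.
Proof.
rewrite -det_tr det_trig; last first.
  by apply/is_trig_mxP => i j lt_ij; rewrite !mxE coefXnM lt_ij.
apply: big1 => i _; rewrite !mxE coefXnM ltnn subnn !coef0M !dpoly0 !mulr1.
rewrite -horner_coef0 horner_exp horner_coef0 /apoly !coefE /= mulr0 subr0.
exact: expr1n.
Qed.

Lemma Dt_rdet (r : nat -> 'rV[F]_n) (rs : seq {poly F}) :
  (forall i, (i < n)%N -> r i *m toeplitz = prow rs`_i) -> Dt r = rdet n rs.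
Proof.
move=> h; rewrite -[LHS]mulr1 -[X in _ * X]det_toeplitz -det_mulmx /rdet.
congr (\det _); apply/matrixP => i j; have /rowP/(_ j) := h i (ltn_ord i).
by rewrite !mxE => <-; apply: eq_bigr => k _; rewrite !mxE.
Qed.

(** For i < N, row i + 1 becomes d1 d2 a^(N-i-1) ((X a)^(i+1) - b^(i+1)), which is - d1 d2 [kappa]
    i. *)
Lemma ZDPP_rdet : ZDPP n x y z1 z2 = rdet n (dpp_rows x y N z1 z2).
Proof.
rewrite ZDPP_det //; apply: Dt_rdet => -[|i] lt_i.
  by rewrite eqxx Pv_toeplitz // subnn /gpoly eqxx expr0 mul1r subn0 mulr1.
rewrite [(_ == _)%N]/= mulmxBl -scalemxAl erow_toeplitz // Pv_toeplitz //; last exact: ltnW.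
rewrite subnn gpoly0 -scaleNr -prowZ -prowD; apply: eq_prow.
rewrite [nth _ _ _]/= nth_cat size_mkseq /gpoly subn0 expr0 mul1r ltn_eqF // eqSS.
case: ltnP => [lt_iN|le_Ni].
  rewrite nth_mkseq // /dlen /= eqSS !ltn_eqF // scaleN1r => j lt_j.
  congr (nth 0 (polyseq _) j); rewrite /kappa.
  have -> : a ^+ N = a ^+ (N - i.+1) * a ^+ i.+1 by rewrite -exprD subnK.
  have -> : (N.-1 - i = N - i.+1)%N by lia.
  by rewrite exprMn; ring.
(* In the last row a^N d1 d2 multiplies X^(N+1), so only its constant term 1 counts modulo
   X^(N+2). *)
have -> : i = N by lia.
rewrite subnn eqxx /dlen /= eqxx => j lt_j.
rewrite scaleNr !coefB; congr (_ - _).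
rewrite mulrC eqX_XnSM // !coef0M !dpoly0 !mulr1.
rewrite -horner_coef0 horner_exp horner_coef0 /apoly !coefE /= mulr0 subr0.
exact: expr1n.
Qed.
End DPPRows.

Lemma asm_rho_bound N (A : 'M[int]_N.+2) : is_asm A ->
  (asm_rho1 A <= N.+1)%N /\ (asm_rho2 A <= N.+1)%N.
Proof.
move=> hA; have [_ rho1 _] := first_row hA (erefl : (ord0 : 'I_N.+2) = 0%N :> nat).
by have [_ rho2 _] := last_row hA (erefl : (ord_max : 'I_N.+2).+1 = N.+2).
Qed.

(** The parameters are v = 1 - 1/z, and the last two hypotheses are z^2 [qv v] != 0. Powers of 1 - v
    = 1/z with exponent N + 1 - rho, divided by the prefactor, become z^rho. *)
Lemma ZASM_ZDPP_generic (F : fieldType) (x y z1 z2 : F) N :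
  z1 != 0 -> z2 != 0 -> z1 != 1 -> z2 != 1 -> z1 != z2 ->
  1 + (y - 1 - x) * z1 + x * z1 ^+ 2 != 0 ->
  1 + (y - 1 - x) * z2 + x * z2 ^+ 2 != 0 ->
  ZASM N.+2 x y z1 z2 = ZDPP N.+2 x y z1 z2.
Proof.
move=> z10 z20 z11 z21 z12 q1 q2.
have vq (z : F) : z != 0 -> 1 + (y - 1 - x) * z + x * z ^+ 2 != 0 ->
    qv x y (1 - z^-1) != 0.
  move=> z0; apply: contraNneq => qz.
  suff -> : 1 + (y - 1 - x) * z + x * z ^+ 2 = z ^+ 2 * qv x y (1 - z^-1).
    by rewrite qz mulr0.
  by rewrite /qv; field.
have v0 (z : F) : z != 1 -> 1 - z^-1 != 0.
  by move=> z1'; rewrite subr_eq0 eq_sym invr_eq1.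
have v1 (z : F) : z != 0 -> 1 - z^-1 != 1.
  by move=> z0; rewrite -subr_eq0 addrAC subrr add0r oppr_eq0 invr_eq0.
have vK (z : F) : 1 - (1 - z^-1) = z^-1 by rewrite opprB addrC subrK.
have v12 : 1 - z1^-1 != 1 - z2^-1.
  apply: contra_neq z12 => /(congr1 (fun v => (1 - v)^-1)).
  by rewrite !vK !invrK.
have := @six_vertex_dpp_rows _ x y N _ _ z1 z2 (v0 _ z11) (v0 _ z21) v12
  (v1 _ z10) (v1 _ z20).
rewrite !vK !invrK => /(_ erefl erefl (vq _ z10 q1) (vq _ z20 q2)).
rewrite -ZDPP_rdet Z6v_asm_stat !vK => h.
have zz : (z1^-1 * z2^-1) ^+ N.+1 != 0.
  by rewrite expf_neq0 // mulf_neq0 ?invr_eq0.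
apply: (mulfI zz); rewrite -h mulr_sumr; apply: eq_big_seq => A.
rewrite in_ASM => /asm_rho_bound[b1 b2].
have e (z : F) k : z != 0 -> (k <= N.+1)%N -> z^-1 ^+ N.+1 * z ^+ k = z^-1 ^+ (N.+1 - k).
  move=> z0 le_k; rewrite -{1}(subnK le_k) exprD -mulrA -exprMn mulVf //.
  by rewrite expr1n mulr1.
rewrite /= -(e z1) // -(e z2) // exprMn.
move: (z1^-1 ^+ _) (z2^-1 ^+ _) (x ^+ _) (y ^+ _) (z1 ^+ _) (z2 ^+ _).
by move=> *; ring.
Qed.

(** * Kronecker substitution and equality of the multisets of statistics *)

Definition stat := (nat * nat * nat * nat)%type.
Definition stat_mon (R : comNzRingType) (x y z1 z2 : R) (q : stat) : R :=
  let: (p, m, k1, k2) := q in x ^+ p * y ^+ m * z1 ^+ k1 * z2 ^+ k2.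

(* The exponent of the variable after Kronecker substitution. *)
Definition stat_code B (q : stat) : nat :=
  let: (p, m, k1, k2) := q in (p + B * (m + B * (k1 + B * k2)))%N.

Definition stat_max (q : stat) : nat :=
  let: (p, m, k1, k2) := q in maxn p (maxn m (maxn k1 k2)).

Lemma digit_inj B a b c d : (a < B)%N -> (b < B)%N ->
  (a + B * c = b + B * d)%N -> a = b /\ c = d.
Proof.
move=> lt_a lt_b e; have B0 : (0 < B)%N by lia.
have := congr1 (modn^~ B) e; have := congr1 (divn^~ B) e.
rewrite /= !(addnC _ (B * _)%N) !(mulnC B) !divnMDl // !modnMDl.
by rewrite !divn_small // !addn0 !modn_small.
Qed.

Lemma stat_code_inj B q q' : (stat_max q < B)%N -> (stat_max q' < B)%N ->
  stat_code B q = stat_code B q' -> q = q'.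
Proof.
case: q => [[[p m] k1] k2]; case: q' => [[[p' m'] k1'] k2'].
rewrite /stat_max !gtn_max => /and4P[? ? ? ?] /and4P[? ? ? ?].
by case/digit_inj => // -> /digit_inj[//|//|->] /digit_inj[//|//|->] ->.
Qed.

(** With B above every statistic in both lists, the exponents have distinct base B expansions, so
    the coefficients count multiplicities. *)
Lemma perm_eq_stat (s t : seq stat) :
  (forall B, (1 < B)%N ->
     \sum_(q <- s) 'X^(stat_code B q) = \sum_(q <- t) 'X^(stat_code B q)
       :> {poly int}) ->
  perm_eq s t.
Proof.
move=> st; apply/allP => q hq /=.
pose B := (\max_(r <- s ++ t) stat_max r).+2.
have bB r : r \in s ++ t -> (stat_max r < B)%N.
  by move=> hr; rewrite /B ltnS ltnW // ltnS (@leq_bigmax_seq _ _ xpredT).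
have cnt (u : seq stat) : {subset u <= s ++ t} ->
    (\sum_(r <- u) 'X^(stat_code B r) : {poly int})`_(stat_code B q) =
    (count_mem q u)%:R.
  move=> sub; rewrite coef_sum -sum1_count natr_sum [RHS]big_mkcond.
  apply: eq_big_seq => r hr; rewrite coefXn /=.
  have -> : (stat_code B q == stat_code B r) = (r == q).
    by apply/eqP/eqP => [/stat_code_inj->|->] //; apply: bB => //; exact: sub.
  by case: (r == q).
rewrite -(eqr_nat int) -!cnt ?st // => r hr; rewrite mem_cat hr ?orbT //.
Qed.

Definition asm_stat n (A : 'M[int]_n) : stat :=
  (`|asm_nu A|%N, asm_mu A, asm_rho1 A, asm_rho2 A).

Definition dpp_stat n D : stat := (dpp_nu D, dpp_mu D, dpp_rho1 n D, dpp_rho2 n D).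

Lemma ZASM_stat (R : comNzRingType) n (x y z1 z2 : R) :
  ZASM n x y z1 z2 = \sum_(q <- map (@asm_stat n) (ASM n)) stat_mon x y z1 z2 q.
Proof. by rewrite big_map. Qed.

Lemma ZDPP_stat (R : comNzRingType) n (x y z1 z2 : R) :
  ZDPP n x y z1 z2 = \sum_(q <- map (dpp_stat n) (DPP n)) stat_mon x y z1 z2 q.
Proof. by rewrite big_map. Qed.

Lemma ASM1 : ASM 1 = [fset 1%:M]%fset.
Proof.
apply/fsetP => A; rewrite in_ASM in_fset1; apply/idP/eqP => [/andP[/forallP h _]|->].
  apply/matrixP => i j; rewrite !ord1 mxE eqxx.
  have /and3P[_ _] := h 0; rewrite enum_ordSl big_cons big_map.
  by rewrite (size0nil (size_enum_ord 0)) big_nil addr0 => /eqP.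
apply/andP; split; apply/forallP => i; rewrite enum_ordSl;
  by rewrite (size0nil (size_enum_ord 0)) /= !mxE !ord1 /asm_line big_seq1.
Qed.

Lemma DPP1 : DPP 1 = [fset [::]]%fset.
Proof.
apply/fsetP => D; rewrite in_DPP in_fset1; apply/idP/eqP => [|->//].
case: D => // r D /andP[/and5P[/allP h1 _ _ _ /andP[/allP h2 _]] /allP h3].
have i0 : 0%N \in iota 0 (size (r :: D)) by [].
have := h1 _ i0; have := h2 _ i0; have := h3 (0, 0)%N; rewrite mem_cells /=.
by move=> h4 h5 h6; have := h4 h6; lia.
Qed.

Lemma asm_dpp_stat n : (0 < n)%N ->
  perm_eq (map (@asm_stat n) (ASM n)) (map (dpp_stat n) (DPP n)).
Proof.
case: n => [|[|N]] // _.
  (* The case n = 1 is checked directly, because the first and last rows, hence v1 and v2, would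
     coincide. *)
  rewrite ASM1 DPP1 -!fset_seq1 /= /asm_stat /dpp_stat /=.
  rewrite /asm_nu /asm_mu /asm_rho1 /asm_rho2.
  have nu0 : (\sum_(i < 1) \sum_(i' < 1 | (i < i')%N)
    \sum_(j' < 1) \sum_(j < 1 | (j' <= j)%N) (1%:M i j * 1%:M i' j' : int)) = 0.
    by apply: big1 => i _; apply: big1 => i'; rewrite !ord1.
  by rewrite nu0 !eq_card0 // => -[i j]; rewrite !inE /= !ord1 !mxE eqxx.
apply: perm_eq_stat => B lt_B.
pose T := @tofrac {poly int}.
have TX k m : T 'X^k ^+ m = T 'X^(k * m) by rewrite -tofracXn exprM.
have e : forall s, T (\sum_(q <- s) 'X^(stat_code B q)) =
    \sum_(q <- s) stat_mon (T 'X^1) (T 'X^B) (T 'X^(B * B)) (T 'X^(B * (B * B))) q.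
  move=> s; rewrite (big_morph T (@tofracD _) (tofrac0 _)); apply: eq_bigr => -[[[p m] k1] k2] _ /=.
  by rewrite !TX -!tofracM -!exprD; congr (T 'X^_); ring.
apply/eqP; rewrite -tofrac_eq -/T !e -ZASM_stat -ZDPP_stat; apply/eqP.
have X0 k : (0 < k)%N -> ('X^k : {poly int}).[0] = 0.
  by move=> k0; rewrite hornerXn expr0n gtn_eqF.
have B0 : (0 < B)%N by lia.
have BB : (0 < B * B)%N by lia.
have BBB : (0 < B * (B * B))%N by rewrite muln_gt0 B0.
have X1 k : (0 < k)%N -> T 'X^k != 1.
  move=> k0; rewrite -(tofrac1 {poly int}) tofrac_eq.
  by apply/eqP => /(congr1 (horner^~ 0)); rewrite X0 // hornerC.
(* All powers of X involved vanish at 0, where the expression is 1. *)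
have q k : (0 < k)%N ->
    1 + (T 'X^B - 1 - T 'X^1) * T 'X^k + T 'X^1 * T 'X^k ^+ 2 != 0.
  move=> k0; rewrite -(tofrac1 {poly int}) -!(tofracD, tofracB, tofracM, tofracXn).
  rewrite tofrac_eq0; apply/eqP => /(congr1 (horner^~ 0)).
  by rewrite expr2 !(hornerD, hornerM, hornerN) !X0 // !hornerC; lia.
apply: ZASM_ZDPP_generic; rewrite ?tofrac_eq0 ?X1 ?q //.
- exact: monic_neq0 (monicXn _ _).
- exact: monic_neq0 (monicXn _ _).
(* The exponents B^2 and B^3 differ because B > 1. *)
rewrite tofrac_eq; apply/eqP => /(congr1 (fun p : {poly int} => size p)).
rewrite !size_polyXn; nia.
Qed.

Lemma card_fset_count (K : choiceType) (A : {fset K}) (P : pred K) :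
  #|` [fset a in A | P a]%fset|%fset = count P A.
Proof.
rewrite -size_filter; apply: perm_size; apply: uniq_perm.
- exact: fset_uniq.
- by rewrite filter_uniq // fset_uniq.
by move=> a; rewrite mem_filter !inE andbC.
Qed.

Theorem theorem1 (n : nat) (hn : (0 < n)%N) :
  (forall (R : comNzRingType) (x y z1 z2 : R),
     ZASM n x y z1 z2 = ZDPP n x y z1 z2) /\
  (forall p m k1 k2 : int,
     #|` [fset A in ASM n | [&& asm_nu A == p, Posz (asm_mu A) == m,
            Posz (asm_rho1 A) == k1 & Posz (asm_rho2 A) == k2]]%fset |%fset =
     #|` [fset D in DPP n | [&& Posz (dpp_nu D) == p, Posz (dpp_mu D) == m,
            Posz (dpp_rho1 n D) == k1 & Posz (dpp_rho2 n D) == k2]]%fset |%fset).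
Proof.
have perm_stat := asm_dpp_stat hn; split=> [R x y z1 z2 | p m k1 k2].
  by rewrite ZASM_stat ZDPP_stat; apply: perm_big.
pose P (q : stat) := [&& Posz q.1.1.1 == p, Posz q.1.1.2 == m, Posz q.1.2 == k1
                       & Posz q.2 == k2].
rewrite !card_fset_count; transitivity (count P (map (@asm_stat n) (ASM n))).
  rewrite count_map; apply: eq_in_count => A; rewrite in_ASM => /asm_nu_ge0 nu0.
  by rewrite /P /= gez0_abs.
by rewrite (permP perm_stat) count_map.
Qed.
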